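(* Let $\alpha>0$ and, for $n\in\mathbb{N}_0$, let $$\phi_n(x)=\frac{\sqrt{2n+2\alpha+1}\;n!}{2^{\alpha+1/2}\,\Gamma(n+\alpha+1)}\,(1-x^2)^{\alpha}P_n^{\alpha,\alpha}(x),\qquad x\in(-1,1).$$ Then for all $i,j\in\mathbb{N}_0$ the stiffness and mass entries are $$S_{ij}:=a(\phi_j,\phi_i)=\delta_{ij},$$ $$M_{ij}:=(\phi_j,\phi_i)=\begin{cases}\dfrac{(-1)^{\frac{j-i}{2}}\sqrt{\pi(2i+2\alpha+1)(2j+2\alpha+1)}\;\Gamma(2\alpha+1)\,(i+j)!}{2^{2\alpha+i+j+1}\,\Gamma\big(2\alpha+\frac{i+j}{2}+\frac32\big)\,\Gamma\big(\alpha+\frac{i-j}{2}+1\big)\,\Gamma\big(\alpha+\frac{j-i}{2}+1\big)\,\big(\frac{i+j}{2}\big)!}, & i+j\text{ even},\\[2mm] 0,& i+j\text{ odd}.\end{cases}$$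
   Context: $\Lambda=(-1,1)$, $\mathbb{N}_0=\{0,1,2,\dots\}$, $\delta_{ij}$ is the Kronecker delta, and $(u,v)=\int_{-1}^1u\overline v\,dx$. For $v$ on $\Lambda$, $\tilde v$ is its extension by zero to $\mathbb{R}$, $\widehat w(\xi)=\int_{\mathbb{R}}w(x)e^{-\mathrm{i}\xi x}\,dx$, and $a(u,v)=\frac1{2\pi}\int_{\mathbb{R}}|\xi|^{2\alpha}\,\widehat{\tilde u}(\xi)\overline{\widehat{\tilde v}(\xi)}\,d\xi$ (written $(D^\alpha u,D^\alpha v)$ in terms of the Riesz fractional derivative $D^\alpha$). $P_n^{\alpha,\alpha}$ are the classical Jacobi polynomials, orthogonal with respect to $(1-x^2)^{\alpha}$ on $\Lambda$ with $\int_{-1}^1P_n^{\alpha,\alpha}P_m^{\alpha,\alpha}(1-x^2)^\alpha dx=\delta_{nm}\frac{2^{2\alpha+1}}{2n+2\alpha+1}\frac{\Gamma(n+\alpha+1)^2}{n!\,\Gamma(n+2\alpha+1)}$ and positive leading coefficient. The convention $1/\Gamma(z)=0$ for $z\in\{0,-1,-2,\dots\}$ is used. *)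

(* Defs.v *)
From HB Require Import structures.
From mathcomp Require Import all_boot all_order all_algebra.
From mathcomp Require Import all_classical all_reals all_analysis.
From mathcomp.real_closed Require Import complex.
Set Implicit Arguments.
Unset Strict Implicit.
Unset Printing Implicit Defensive.
Import Order.TTheory GRing.Theory Num.Theory.
Import numFieldNormedType.Exports.
Local Open Scope classical_set_scope.
Local Open Scope ring_scope.
Local Open Scope complex_scope.

(* Euler's integral for x > 0.  For x <= 0, the functional equation
     Gamma x = Gamma (x + n) / (x (x + 1) ... (x + n - 1))
   with n the least natural number such that x + n > 0.  At the poles
   0, -1, -2, ... the denominator vanishes, so Gamma x = 0 and, both by
   0^-1 = 0, (Gamma x)^-1 = 0: this is the convention 1 / Gamma = 0 there. *)
Definition Gamma_pos (R : realType) (x : R) : R :=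
  \int[lebesgue_measure]_(t in `]0, +oo[) (t `^ (x - 1) * expR (- t)).

Definition Gamma (R : realType) (x : R) : R :=
  if 0 < x then Gamma_pos x
  else let n := (Num.truncn (- x)).+1 in
       Gamma_pos (x + n%:R) / \prod_(k < n) (x + k%:R).

Lemma Gamma_pole (R : realType) (n : nat) : Gamma (- n%:R : R) = 0.
Proof.
rewrite /Gamma oppr_gt0 ltrn0 opprK natrK.
by rewrite big_ord_recr /= addNr mulr0 invr0 mulr0.
Qed.

Definition is_jacobi (R : realType) (a : R) (P : nat -> {poly R}) : Prop :=
  [/\ forall n, size (P n) = n.+1,
      forall n, 0 < lead_coef (P n) &
      forall n m,
        \int[lebesgue_measure]_(x in `]-1, 1[)
            ((P n).[x] * (P m).[x] * (1 - x ^+ 2) `^ a)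
        = (n == m)%:R * (2 `^ (2 * a + 1) / (2 * n%:R + 2 * a + 1)
            * (Gamma (n%:R + a + 1) ^+ 2
               / (n`!%:R * Gamma (n%:R + 2 * a + 1))))].

(* Definite description: for a > 0, is_jacobi a holds of exactly one sequence,
   so the default value is never used. *)
Definition jacobi (R : realType) (a : R) : nat -> {poly R} :=
  xget (fun=> 0) [set P | is_jacobi a P].

Definition cintegral (R : realType) (D : set R) (f : R -> R[i]) : R[i] :=
  (\int[lebesgue_measure]_(x in D) complex.Re (f x))
  +i* (\int[lebesgue_measure]_(x in D) complex.Im (f x)).

Definition inner (R : realType) (u v : R -> R[i]) : R[i] :=
  cintegral `]-1, 1[ (fun x => u x * (v x)^*).

Definition zero_ext (R : realType) (v : R -> R[i]) : R -> R[i] :=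
  patch (fun=> 0) `]-1, 1[ v.

(* The factor cos (xi x) - i sin (xi x) is e^(- i xi x). *)
Definition fourier (R : realType) (w : R -> R[i]) (xi : R) : R[i] :=
  cintegral setT (fun x => w x * (cos (xi * x) -i* sin (xi * x))).

Definition energy (R : realType) (a : R) (u v : R -> R[i]) : R[i] :=
  (2 * pi)^-1%:C *
  cintegral setT (fun xi => (`|xi| `^ (2 * a))%:C
    * fourier (zero_ext u) xi * (fourier (zero_ext v) xi)^*).

(* Only the values at x in (-1, 1) matter: both forms ignore the others. *)
Definition phi (R : realType) (a : R) (n : nat) (x : R) : R[i] :=
  (Num.sqrt (2 * n%:R + 2 * a + 1) * n`!%:R
   / (2 `^ (a + 2^-1) * Gamma (n%:R + a + 1))
   * (1 - x ^+ 2) `^ a * (jacobi a n).[x])%:C.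

Definition stiffness (R : realType) (a : R) (i j : nat) : R[i] :=
  energy a (phi a j) (phi a i).

Definition mass (R : realType) (a : R) (i j : nat) : R[i] :=
  inner (phi a j) (phi a i).

(* Main.v *)
(* By Rodrigues' formula [(1 - x^2)^a P_n] is a multiple of the n-th derivative of
   [(1 - x^2)^(n + a)], so its Fourier transform is a multiple of [xi^n * J_m(xi) / xi^m]
   with [m = n + a + 1/2], where [J_m] is the Bessel function.  The stiffness entries are
   therefore Weber integrals of [J_m(x) * J_l(x) / x] over [(0, +oo)]: they vanish when
   [m - l] is a nonzero even integer, and parity settles the case of an odd difference.
   For the mass entries, moving all derivatives onto one factor leaves the integral of
   [(1 - x^2)^(i + a)] times the (i + j)-th derivative of [(1 - x^2)^(j + a)], which a
   recurrence in [i + j] evaluates. *)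
Require Import Defs.
From mathcomp Require Import all_boot all_order all_algebra.
From mathcomp Require Import all_classical all_reals all_analysis.
From mathcomp Require Import measurable_realfun.
From mathcomp.real_closed Require Import complex.
From mathcomp Require Import ring lra zify.
Set Implicit Arguments.
Unset Strict Implicit.
Unset Printing Implicit Defensive.
Import Order.TTheory GRing.Theory Num.Theory.
Import numFieldNormedType.Exports.
Local Open Scope classical_set_scope.
Local Open Scope ring_scope.
Local Open Scope complex_scope.

(** * Integrals with prescribed value *)

Section has_int.
Context {R : realType}.
Notation mu := (@lebesgue_measure R).
Implicit Types (D A B : set (measurableTypeR R)) (f g h : R -> R) (v w : R).

(** A real-valued Lebesgue integral takes a default value when the integrand is not integrable, so
    every evaluation is carried as [has_int]: integrability together with the value. Expanding a
    Weber integrand in powers of x and integrating over (0, +oo) term by term diverges. A Gaussian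
    factor exp(- s x^2), produced by a Gamma integral in s, repairs this: the power series of the
    product of two Bessel functions, obtained from Vandermonde's identity, now integrates term by
    term. The outcome is the series in 1/s of the integral of cos(2 k t) cos(t)^(2 h) exp(- cos(t)^2
    / s) over (0, pi / 2). Integrating s out leaves the integral of cos(2 k t), whence the Kronecker
    delta. With y = tan t all this is stated for rational functions of y. Orders differing by 2 k
    are what make cos(2 k t) a polynomial in cos(t)^2; this is why odd differences are left to
    parity. In the mass entries Gamma may be evaluated at poles. The shift identities that meet them
    are stated for 1 / Gamma, where the value 0 at the poles makes them true for every real
    argument. *)

Definition has_int D f v :=
  mu.-integrable D (EFin \o f) /\ (\int[mu]_(x in D) (f x)%:E = v%:E)%E.

Lemma has_intE D f v : has_int D f v -> \int[mu]_(x in D) f x = v.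
Proof. by move=> [_ E]; rewrite /Rintegral E. Qed.

Lemma has_int_Rintegral D f : measurable D -> mu.-integrable D (EFin \o f) ->
  has_int D f (\int[mu]_(x in D) f x).
Proof. by move=> mD fi; split => //; rewrite fineK// integrable_fin_num. Qed.

Lemma has_int_unique D f v w : has_int D f v -> has_int D f w -> v = w.
Proof. by move=> /has_intE <- /has_intE <-. Qed.

Lemma eq_has_int D g f v : {in D, f =1 g} -> has_int D g v ->
  measurable D -> has_int D f v.
Proof.
move=> fg [gi gv] mD; split.
  by apply: eq_integrable gi => // x xD /=; rewrite fg.
by rewrite -gv; apply: eq_integral => x xD; rewrite fg.
Qed.

Lemma has_int0 D : measurable D -> has_int D (fun=> 0) 0.
Proof. by move=> mD; split; [exact: integrable0|rewrite integral0]. Qed.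

Lemma has_intD D f g v w : measurable D ->
  has_int D f v -> has_int D g w -> has_int D (fun x => f x + g x) (v + w).
Proof.
move=> mD [fi fv] [gi gw]; split.
  by have := integrableD mD fi gi; apply: eq_integrable.
have := integralD mD fi gi; rewrite /= fv gw EFinD => <-.
exact: eq_integral.
Qed.

Lemma has_intZ D f v k : measurable D ->
  has_int D f v -> has_int D (fun x => k * f x) (k * v).
Proof.
move=> mD [fi fv]; split.
  by have := integrableZl mD k fi; apply: eq_integrable.
have := integralZl mD fi k; rewrite /= fv EFinM => <-.
exact: eq_integral.
Qed.

Lemma has_intB D f g v w : measurable D ->
  has_int D f v -> has_int D g w -> has_int D (fun x => f x - g x) (v - w).
Proof.
move=> mD fv gw; rewrite -[- w]mulN1r.
by apply: eq_has_int (has_intD mD fv (has_intZ (-1) mD gw)) _ => // x _; rewrite mulN1r.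
Qed.

Lemma has_int_sum D (F : nat -> R -> R) (v : nat -> R) n : measurable D ->
  (forall k, (k < n)%N -> has_int D (F k) (v k)) ->
  has_int D (fun x => \sum_(k < n) F k x) (\sum_(k < n) v k).
Proof.
move=> mD; elim: n => [|n IH] H.
  rewrite big_ord0; apply: eq_has_int (has_int0 mD) mD => x _.
  by rewrite big_ord0.
rewrite big_ord_recr/=; apply: eq_has_int (has_intD mD _ (H n _)) mD => //.
  move=> x _; rewrite big_ord_recr/=; reflexivity.
by apply: IH => k kn; apply: H; rewrite ltnS ltnW.
Qed.

Lemma has_int_measurable D f v : has_int D f v -> measurable_fun D f.
Proof. by move=> [/measurable_int /measurable_EFinP]. Qed.

Lemma ge0_has_int D f v : measurable_fun D f -> (forall x, D x -> 0 <= f x) ->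
  (\int[mu]_(x in D) (f x)%:E = v%:E)%E -> has_int D f v.
Proof.
move=> mf f0 E; split => //; apply/integrableP; split.
  exact/measurable_EFinP.
rewrite (eq_integral (fun x : measurableTypeR R => (f x)%:E)) ?E ?ltry// => x /[!inE] xD /=.
by rewrite ger0_norm// f0.
Qed.

Lemma le_has_int D f g v w : measurable D -> has_int D f v -> has_int D g w ->
  (forall x, D x -> f x <= g x) -> v <= w.
Proof.
move=> mD [fi fv] [gi gw] fg; rewrite -lee_fin -fv -gw.
by apply: le_integral => // x /[!inE] xD; rewrite /= lee_fin fg.
Qed.

Lemma dom_has_int D f g w : measurable D -> measurable_fun D f ->
  has_int D g w -> (forall x, D x -> `|f x| <= g x) ->
  has_int D f (\int[mu]_(x in D) f x).
Proof.
move=> mD mf [gi _] fg; apply: has_int_Rintegral => //.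
apply: le_integrable gi => //; first exact/measurable_EFinP.
by move=> x xD /=; rewrite lee_fin (le_trans (fg _ xD))// ler_norm.
Qed.

Lemma has_int_restrict A D f v : measurable A -> measurable D ->
  has_int (A `&` D) f v <-> has_int A (f \_ D) v.
Proof.
move=> mA mD; rewrite /has_int integral_mkcondr (restrict_EFin f D).
have := integrable_restrict mu mD mA (EFin \o f).
by rewrite restrict_EFin => ->.
Qed.

(** Moves a condition from the domain into the integrand, so that a region whose sections vary with
    the other variable can be treated on a fixed product set. *)
Lemma has_int_if A (b : pred R) f v : measurable A -> measurable [set x | b x] ->
  has_int (A `&` [set x | b x]) f v <->
  has_int A (fun x => if b x then f x else 0) v.
Proof.
move=> mA mb; rewrite has_int_restrict//.
suff -> : f \_ [set x | b x] = (fun x => if b x then f x else 0) by [].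
apply/funext => x; rewrite patchE; suff -> : (x \in [set x | b x]) = b x by [].
by apply/idP/idP; rewrite inE.
Qed.

Lemma has_int_mkcond D f v : measurable D -> has_int D f v <-> has_int setT (f \_ D) v.
Proof. by move=> mD; rewrite -{1}(setTI D) has_int_restrict. Qed.

End has_int.

(** * Iterated integrals over product sets *)

Section tonelli.
Context {R : realType}.
Notation mu := (@lebesgue_measure R).
Implicit Types (A B : set (measurableTypeR R)) (f : measurableTypeR R * measurableTypeR R -> R).

(** Extension by zero outside the rectangle, so that the exchange theorems are applied on the whole
    product space. *)
Let patch2 A B f : R * R -> R := f \_ (A `*` B).

Let measurable_patch2 A B f : measurable A -> measurable B ->
  measurable_fun setT f -> measurable_fun setT (patch2 A B f).
Proof.
move=> mA mB mf; apply/(measurable_restrictT f).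
  exact: measurableX.
exact: measurable_funTS.
Qed.

Let patch2E A B f x y : patch2 A B f (x, y) = ((fun y => f (x, y)) \_ B) y * \1_A x.
Proof.
rewrite /patch2 !patchE in_setX indicE /=.
by case: (x \in A); case: (y \in B); rewrite ?mulr1 ?mulr0 ?mul0r.
Qed.

Let patch2E' A B f x y : patch2 A B f (x, y) = ((fun x => f (x, y)) \_ A) x * \1_B y.
Proof.
rewrite /patch2 !patchE in_setX indicE /=.
by case: (x \in A); case: (y \in B); rewrite ?mulr1 ?mulr0 ?mul0r.
Qed.

Let int_patch2l A B f (g : R -> R) : measurable A -> measurable B ->
  (forall x, A x -> has_int B (fun y => f (x, y)) (g x)) ->
  (fun x => \int[mu]_y (patch2 A B f (x, y))%:E)%E = EFin \o (g \_ A).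
Proof.
move=> mA mB H; apply/funext => x /=; rewrite patchE; case: ifPn => xA.
  have /has_int_mkcond : has_int B (fun y => f (x, y)) (g x).
    by apply: H; rewrite inE in xA.
  move=> /(_ mB)[_ <-]; apply: eq_integral => y _.
  by rewrite patch2E indicE xA mulr1.
under eq_integral do rewrite patch2E indicE (negbTE xA) mulr0.
by rewrite integral0.
Qed.

Let int_patch2r A B f (h : R -> R) : measurable A -> measurable B ->
  (forall y, B y -> has_int A (fun x => f (x, y)) (h y)) ->
  (fun y => \int[mu]_x (patch2 A B f (x, y))%:E)%E = EFin \o (h \_ B).
Proof.
move=> mA mB H; apply/funext => y /=; rewrite patchE; case: ifPn => yB.
  have /has_int_mkcond : has_int A (fun x => f (x, y)) (h y).
    by apply: H; rewrite inE in yB.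
  move=> /(_ mA)[_ <-]; apply: eq_integral => x _.
  by rewrite patch2E' indicE yB mulr1.
under eq_integral do rewrite patch2E' indicE (negbTE yB) mulr0.
by rewrite integral0.
Qed.

(** For a nonnegative integrand, finiteness of one iterated integral is enough: integrability of the
    other inner integral [g] comes out together with its value. *)
Lemma has_int_tonelli A B f (g h : R -> R) v : measurable A -> measurable B ->
  measurable_fun setT f -> (forall x y, A x -> B y -> 0 <= f (x, y)) ->
  (forall x, A x -> has_int B (fun y => f (x, y)) (g x)) ->
  (forall y, B y -> has_int A (fun x => f (x, y)) (h y)) ->
  has_int B h v -> has_int A g v.
Proof.
move=> mA mB mf f0 fg fh hv.
have mp := measurable_patch2 mA mB mf.
have p0 z : 0 <= patch2 A B f z.
  case: z => x y; rewrite /patch2 patchE in_setX; case: ifPn => //.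
  by move=> /andP[]; rewrite !inE; exact: f0.
have mpE : measurable_fun setT (EFin \o patch2 A B f).
  by apply/measurable_EFinP.
have gE := int_patch2l mA mB fg; have hE := int_patch2r mA mB fh.
have := @fubini_tonelli _ _ _ _ R mu mu _ mpE (fun z => p0 z).
rewrite [X in (\int[_]_x X x)%E = _](_ : _ = EFin \o (g \_ A))//.
rewrite [X in _ = (\int[_]_x X x)%E](_ : _ = EFin \o (h \_ B))//.
have mg : measurable_fun setT (g \_ A).
  apply/measurable_EFinP; rewrite -gE.
  exact: (@measurable_fun_fubini_tonelli_F _ _ _ _ _ mu (EFin \o patch2 A B f)).
have [_ ->] := (has_int_mkcond h v mB).1 hv => E.
apply/has_int_mkcond => //; apply: ge0_has_int => // x _.
rewrite patchE; case: ifPn => // /[!inE] xA.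
have [_ E2] := fg x xA.
by rewrite -lee_fin -E2; apply: integral_ge0 => y yB; rewrite lee_fin f0.
Qed.

(** [ga] is the inner integral of the absolute value; its finite integral [w] is what yields
    integrability on the product. *)
Lemma has_int_fubini A B f (g h ga : R -> R) v w : measurable A -> measurable B ->
  measurable_fun setT f ->
  (forall x, A x -> has_int B (fun y => `|f (x, y)|) (ga x)) -> has_int A ga w ->
  (forall x, A x -> has_int B (fun y => f (x, y)) (g x)) ->
  (forall y, B y -> has_int A (fun x => f (x, y)) (h y)) ->
  has_int B h v -> has_int A g v.
Proof.
move=> mA mB mf fga gaw fg fh hv.
have mp := measurable_patch2 mA mB mf.
have mpE : measurable_fun setT (EFin \o patch2 A B f).
  by apply/measurable_EFinP.
have gE := int_patch2l mA mB fg; have hE := int_patch2r mA mB fh.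
have gaE : (fun x => \int[mu]_y `|(patch2 A B f (x, y))%:E|)%E = EFin \o (ga \_ A).
  rewrite -(@int_patch2l A B (fun z => `|f z|) ga mA mB fga).
  apply/funext => x; apply: eq_integral => y _.
  by rewrite /patch2 !patchE /=; case: ifPn; rewrite ?normr0.
have ip : (mu \x mu)%E.-integrable setT (EFin \o patch2 A B f).
  apply/integrable12ltyP => //.
  rewrite [X in (\int[_]_x X x)%E](_ : _ = EFin \o (ga \_ A))//.
  by have [_ ->] := (has_int_mkcond ga w mA).1 gaw; rewrite ltry.
have := Fubini ip.
rewrite [X in (\int[_]_x X x)%E = _](_ : _ = EFin \o (g \_ A))//.
rewrite [X in _ = (\int[_]_x X x)%E](_ : _ = EFin \o (h \_ B))//.
have [_ ->] := (has_int_mkcond h v mB).1 hv => E.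
apply/has_int_mkcond => //; split => //.
have := integrable_fubini_F ip.
rewrite (_ : fubini_F _ _ = EFin \o (g \_ A))//.
Qed.

End tonelli.

(** * Affine change of variables *)

Section affine.
Context {R : realType}.
Notation mu := (@lebesgue_measure R).
Notation RM := (measurableTypeR R).
Implicit Types (D : set RM) (f : R -> R) (v : R).

Let aff (c d : R) : RM -> RM := fun x => c * x + d.

Let measurable_aff c d : measurable_fun setT (aff c d).
Proof. by apply: measurable_funD => //; exact: measurable_funM. Qed.

(** The scaled image measure on the right gives each interval []a, b]] its length, so uniqueness of
    Lebesgue measure applies. For c < 0 the preimage is half-open on the other side, with the same
    length. *)
Let lebesgue_affine (c d : R) (A : set RM) : c != 0 -> measurable A ->
  mu A = (`|c|%:E * mu (aff c d @^-1` A))%E.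
Proof.
move=> c0 mA.
have c0' : (0 < `|c|) by rewrite normr_gt0.
have -> : (`|c|%:E * mu (aff c d @^-1` A))%E =
   mscale (NngNum (ltW c0')) (pushforward mu (aff c d)) A by [].
apply: lebesgue_measure_unique => //= _ [[a b]] _ <-.
rewrite /mscale/= /pushforward.
have [cp|cn] := ltP 0 c.
  have -> : aff c d @^-1` `]a, b] = `](a - d) / c, (b - d) / c]%classic.
    apply/seteqP; split => x; rewrite /aff /= !in_itv/= ltr_pdivrMr// ler_pdivlMr//;
    by rewrite ltrBlDr lerBrDr mulrC.
  rewrite !lebesgue_measure_itv/= !lte_fin ltr_pM2r ?invr_gt0// ltrD2r.
  case: ifPn => _; rewrite ?mule0// gtr0_norm// -!EFinD -EFinM.
  by congr EFin; field.
have cn' : c < 0 by rewrite lt_neqAle c0.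
have -> : aff c d @^-1` `]a, b] = `[(b - d) / c, (a - d) / c[%classic.
  apply/seteqP; split => x; rewrite /aff /= !in_itv/= ltr_ndivlMr// ler_ndivrMr//;
  by rewrite ltrBlDr lerBrDr (mulrC x) andbC.
rewrite !lebesgue_measure_itv/= !lte_fin ltr_nM2r ?invr_lt0// ltrD2r.
case: ifPn => _; rewrite ?mule0// ltr0_norm// -!EFinD -EFinM.
by congr EFin; field.
Qed.


Let ge0_integral_affine c d (G : RM -> \bar R) : c != 0 ->
  measurable_fun setT G -> (forall x, 0 <= G x)%E ->
  (\int[mu]_x G x = `|c|%:E * \int[mu]_x G (aff c d x))%E.
Proof.
move=> c0 mG G0; have c0' : (0 < `|c|) by rewrite normr_gt0.
pose m : {measure set RM -> \bar R} :=
  measure_function_pushforward__canonical__measure_function_Measure mu (measurable_aff c d).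
transitivity (\int[mscale (NngNum (ltW c0')) m]_x G x)%E.
  apply: eq_measure_integral => A mA _; exact: lebesgue_affine.
rewrite ge0_integral_mscale//; congr (_ * _)%E.
by rewrite ge0_integral_pushforward.
Qed.

Lemma has_int_affine c d D f v : c != 0 -> measurable D ->
  has_int D f v ->
  has_int [set x | D (c * x + d)] (fun x => f (c * x + d)) (v / `|c|).
Proof.
move=> c0 mD fv; have c0' : (0 < `|c|) by rewrite normr_gt0.
have mpre : measurable (aff c d @^-1` D).
  by rewrite -[X in measurable X]setTI; apply: measurable_aff.
have [gi gv] := (has_int_mkcond f v mD).1 fv.
have mg : measurable_fun setT (f \_ D).
  exact: has_int_measurable ((has_int_mkcond f v mD).1 fv).
apply/(has_int_mkcond (D := aff c d @^-1` D)) => //.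
have -> : (fun x => f (c * x + d)) \_ (aff c d @^-1` D) = (f \_ D) \o aff c d.
  by apply/funext => x; rewrite /= !patchE.
move: gi gv mg; move: (f \_ D) => g gi gv mg.
have mgE : measurable_fun setT (EFin \o g) by exact/measurable_EFinP.
have mga : measurable_fun setT (g \o aff c d) by exact: measurableT_comp.
split.
  apply/integrableP; split; first exact/measurable_EFinP.
  move/integrableP : gi => [_].
  rewrite (@ge0_integral_affine c d (abse \o (EFin \o g)))//.
  - move=> H; rewrite ltey; apply/negP => /eqP E; move: H.
    by rewrite E/= mulry gtr0_sg// mul1e.
  - exact: measurableT_comp.
  - by move=> x /=.
(* The scaling identity is known for nonnegative functions, so positive and negative parts are
   rescaled separately and recombined as finite numbers. *)
rewrite integralE.
set p := (\int[_]_x _)%E; set q := (\int[_]_x _)%E.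
have Ep : (\int[mu]_x (EFin \o g)^\+ x = `|c|%:E * p)%E.
  have mG := measurable_funepos mgE.
  rewrite (ge0_integral_affine d c0 mG)//; congr (_ * _)%E.
  by apply: eq_integral => x _; rewrite !funeposE.

have Eq : (\int[mu]_x (EFin \o g)^\- x = `|c|%:E * q)%E.
  have mG := measurable_funeneg mgE.
  rewrite (ge0_integral_affine d c0 mG)//; congr (_ * _)%E.
  by apply: eq_integral => x _; rewrite !funenegE.

have fp := integrable_pos_fin_num measurableT gi.
have fq := integrable_neg_fin_num measurableT gi.
move: gv; rewrite integralE /= Ep Eq => gv.
move: fp fq; rewrite Ep Eq; clear Ep Eq; clearbody p q.
have pf : forall r : \bar R, (`|c|%:E * r)%E \is a fin_num -> r \is a fin_num.
  by move=> [r _|/=|/=]; [reflexivity|rewrite gt0_muley ?lte_fin|rewrite gt0_muleNy ?lte_fin].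
move=> fp fq; have {}fp := pf _ fp; have {}fq := pf _ fq.
move: gv; clear -fp fq c0'; case: p fp => // p _; case: q fq => // q _.
rewrite -!EFinM -!EFinB => -[<-]; congr EFin.
by field; rewrite gt_eqF.
Qed.

End affine.

(** * Termwise integration *)

Section series.
Context {R : realType}.
Notation mu := (@lebesgue_measure R).
Notation RM := (measurableTypeR R).
Implicit Types (D : set RM).

(** Dominated convergence for the partial sums, with the sum of the [g n] as dominating function;
    its integral is the limit of [series M] by monotone convergence. The limit [w] is left
    existential: callers identify it by uniqueness of limits. *)
Lemma has_int_series D (f g : nat -> R -> R) (F : R -> R) (v M : nat -> R) :
  measurable D ->
  (forall n, has_int D (f n) (v n)) -> (forall n, has_int D (g n) (M n)) ->
  (forall n x, D x -> `|f n x| <= g n x) -> cvgn (series M) ->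
  (forall x, D x -> series (f ^~ x) @ \oo --> F x) ->
  exists2 w, has_int D F w & series v @ \oo --> w.
Proof.
move=> mD fv gM fg cM fF.
pose S := fun n (x : RM) => (series (f ^~ x) n)%:E.
pose G := fun x : RM => (\sum_(n <oo) (g n x)%:E)%E.
have g0 n x : D x -> 0 <= g n x by move=> Dx; exact: le_trans (fg n x Dx).
have mg n : measurable_fun D (EFin \o g n).
  by apply/measurable_EFinP; exact: has_int_measurable (gM n).
have iS n : has_int D (fun x => series (f ^~ x) n) (series v n).
  rewrite /series/= big_mkord.
  by apply: eq_has_int (has_int_sum mD (fun k _ => fv k)) mD => x _; rewrite big_mkord.
have mS n : measurable_fun D (S n).
  by apply/measurable_EFinP; exact: has_int_measurable (iS n).
have mF : measurable_fun D F.
  apply: (measurable_fun_cvg (h := fun n x => series (f ^~ x) n)) => //.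
  by move=> n; exact: has_int_measurable (iS n).
have IG : (\int[mu]_(x in D) G x = (limn (series M))%:E)%E.
  rewrite /G integral_nneseries//.
  under eq_eseriesr do rewrite (proj2 (gM _)).
  rewrite -EFin_lim//; apply: congr_lim; apply/funext => n /=.
  by rewrite /series/= -sumEFin.
have mG : measurable_fun D G.
  have H : forall k x, D x -> xpredT k -> (0 <= (g k x)%:E)%E.
    by move=> k x Dx _; rewrite lee_fin g0.
  exact: (@ge0_emeasurable_sum _ RM R D (fun n x => (g n x)%:E) xpredT H (fun k _ => mg k)).
have G0 x : D x -> (0 <= G x)%E.
  by move=> Dx; apply: nneseries_ge0 => n _ _; rewrite lee_fin g0.
have iG : mu.-integrable D G.
  apply/integrableP; split => //.
  rewrite (eq_integral G) ?IG ?ltry// => x /[!inE] Dx.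
  by rewrite gee0_abs// G0.
have [] := @dominated_convergence _ _ _ mu D mD S (EFin \o F) G mS _ _ iG _.
- exact/measurable_EFinP.
- by apply: aeW => x Dx; apply: cvg_EFin; [exact: nearW|exact: fF].
- apply: aeW => x n Dx; rewrite /S abse_EFin.
  apply: (@le_trans _ _ (series (g ^~ x) n)%:E).
    rewrite lee_fin /series/=; apply: le_trans (ler_norm_sum _ _ _) _.
    by apply: ler_sum => k _; exact: fg.
  rewrite /series/= -sumEFin; apply: nneseries_lim_ge => k _ _.
  by rewrite lee_fin g0.
move=> iF _ cF; exists (\int[mu]_(x in D) F x); first exact: has_int_Rintegral.
have /fine_cvgP[_] : (EFin \o series v) n @[n --> \oo] --> (\int[mu]_(x in D) F x)%:E.
  rewrite -(proj2 (has_int_Rintegral mD iF)).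
  suff <- : [sequence \int[mu]_(x in D) S n x]_n%E = EFin \o series v by [].
  by apply/funext => n; rewrite /= (proj2 (iS n)).
by [].
Qed.

End series.

(** * Powers, including a singularity at the origin *)

Section powers.
Context {R : realType}.
Notation mu := (@lebesgue_measure R).
Notation RM := (measurableTypeR R).

Lemma continuous_powR_gt0 (p x : R) : 0 < x -> {for x, continuous (@powR R ^~ p)}.
Proof.
move=> x0; apply: differentiable_continuous; apply/derivable1_diffP.
by apply: derivable_powR; rewrite in_itv/= x0.
Qed.

(** For p < 1 the integrand is unbounded at 0; the primitive is used on intervals that exhaust []0,
    u]], followed by monotone convergence. *)
Lemma has_int_powR (p u : R) : 0 < p -> 0 < u ->
  has_int `]0, u]%classic (fun x => x `^ (p - 1)) (u `^ p / p).
Proof.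
move=> p0 u0; apply: ge0_has_int.
- exact: measurable_funTS.
- by move=> x _; exact: powR_ge0.
(* With [n.+2] instead of [n.+1] the left end is strictly below [u] for every [n], as the
   fundamental theorem of calculus requires. *)
pose F n : set RM := `[u / n.+2%:R, u]%classic.
have an0 n : 0 < u / n.+2%:R by rewrite divr_gt0.
have anu n : u / n.+2%:R < u.
  by rewrite ltr_pdivrMr// ltr_pMr// (_ : 1 = 1%:R)// ltr_nat.
have IF n : (\int[mu]_(x in F n) (x `^ (p - 1))%:E =
    (u `^ p / p - (u / n.+2%:R) `^ p / p)%:E)%E.
  rewrite /F (@continuous_FTC2 R _ (fun x => x `^ p / p))//.
  - apply: continuous_in_subspaceT => x /[!inE] /=; rewrite in_itv/= => /andP[ax _].
    by apply: continuous_powR_gt0; exact: lt_le_trans ax.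
  - have dp x : 0 < x -> derivable (fun x => x `^ p / p) x 1.
      by move=> x0; apply: derivableM => //; apply: derivable_powR; rewrite in_itv/= x0.
    have cp x : 0 < x -> {for x, continuous (fun x => x `^ p / p)}.
      by move=> /dp ?; apply: differentiable_continuous; exact/derivable1_diffP.
    split.
    + by move=> x; rewrite in_itv/= => /andP[ax _]; apply: dp; exact: lt_trans ax.
    + exact/cvg_at_right_filter/cp.
    + exact/cvg_at_left_filter/cp.
  - move=> x; rewrite in_itv/= => /andP[ax _]; have x0 : 0 < x by exact: lt_trans ax.
    rewrite derive1E deriveMr//; last by apply: derivable_powR; rewrite in_itv/= x0.
    rewrite -derive1E powR_derive1 ?in_itv/= ?x0//.
    by rewrite /GRing.scale/=; field; rewrite gt_eqF.
have -> : `]0, u]%classic = \bigcup_n F n.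
  apply/seteqP; split => [x/=|x [n _]]; rewrite /F /= !in_itv/=.
    move=> /andP[x0 xu]; exists (Num.truncn (u / x)) => //=.
    rewrite /F/= in_itv/=; rewrite xu andbT ler_pdivrMr// -ler_pdivrMl// mulrC.
    have := truncnS_gt (u / x) => /ltW/le_trans; apply.
    by rewrite ler_nat.
  by move=> /andP[ax xu]; rewrite xu andbT; exact: lt_le_trans ax.
have ndF : nondecreasing_seq F.
  move=> m n mn; rewrite subsetEset => x /=; rewrite /F/= !in_itv/= => /andP[ax ->].
  rewrite andbT; apply: le_trans ax; rewrite ler_pM2l// lef_pV2 ?posrE//.
  by rewrite ler_nat !ltnS.
have mf i : measurable_fun (F i) (fun x : RM => (x `^ (p - 1))%:E).
  by apply/measurable_EFinP; exact: measurable_funTS.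
have mF i : measurable (F i) by exact: measurable_itv.
have f0 i x : F i x -> (0 <= (x `^ (p - 1))%:E)%E by rewrite lee_fin powR_ge0.
have := ge0_nondecreasing_set_cvg_integral (mu := mu) ndF mF mf f0.
move/(cvg_lim (@ereal_hausdorff _)) => <-.
apply: (cvg_lim (@ereal_hausdorff _)).
under eq_fun do rewrite IF.
apply: cvg_EFin; first exact: nearW.
rewrite -[X in _ --> X]subr0; apply: cvgB; first exact: cvg_cst.
rewrite -(mul0r p^-1); apply: cvgMl.
apply: (cvg_at_rightP _ _ _).1 (powR_cvg0 p0) _ _; split => //.
rewrite -(mulr0 u); apply: cvgMr; rewrite (_ : (fun n => _) = fun n => harmonic n.+1)//.
by rewrite (cvg_shiftS (@harmonic R)); exact: cvg_harmonic.
Qed.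

End powers.

(** * Gamma and beta integrals *)

Section gamma.
Context {R : realType}.
Notation RM := (measurableTypeR R).

Lemma measurable_boolset (b : RM -> bool) :
  measurable_fun setT b -> measurable [set x | b x].
Proof.
move=> mb; rewrite -[X in measurable X]setTI.
rewrite (_ : [set x | b x] = b @^-1` [set true]); first exact: mb.
by apply/seteqP; split => x /=.
Qed.

Lemma ge0_has_int_oy (f F : R -> R) (a l : R) :
  (forall x, a <= x -> 0 <= f x) -> (forall x, a <= x -> {for x, continuous f}) ->
  (forall x, a <= x -> is_derive x 1 F (f x)) -> F x @[x --> +oo] --> l ->
  has_int `]a, +oo[%classic f (l - F a).
Proof.
move=> f0 cf dF Fl.
have cfw : {within `[a, +oo[, continuous f}.
  by apply: continuous_in_subspaceT => x /[!inE]/=; rewrite in_itv/= andbT => /cf.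
have mf : measurable_fun (`]a, +oo[%classic : set RM) f.
  apply: measurable_funS (subspace_continuous_measurable_fun _ cfw) => //.
  by apply: subset_itvr; rewrite bnd_simp.
apply: ge0_has_int => //.
  by move=> x /=; rewrite in_itv/= andbT => /ltW; exact: f0.
rewrite integral_itv_obnd_cbnd; last exact/measurable_EFinP.
rewrite (ge0_continuous_FTC2y f0 cfw Fl)//.
- by move=> x /ltW /dF[].
- apply: cvg_at_right_filter; apply: differentiable_continuous.
  by apply/derivable1_diffP; have [] := dF a (lexx a).
- by move=> x; rewrite in_itv/= andbT => /ltW /dF[_ <-]; rewrite derive1E.
Qed.

Lemma has_int_expRN (a : R) : has_int `]a, +oo[%classic (fun x => expR (- x)) (expR (- a)).
Proof.
have -> : expR (- a) = 0 - - expR (- a) by rewrite sub0r opprK.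
apply: (ge0_has_int_oy (F := fun x => - expR (- x))).
- by move=> x _; exact: expR_ge0.
- move=> x _; apply: continuous_comp; first exact: opp_continuous.
  exact: continuous_expR.
- move=> x _; apply: is_derive_eq; rewrite /GRing.scale/=; ring.
- by rewrite -oppr0; apply: cvgN; exact: cvgr_expR.
Qed.

Lemma has_int_powRN (a p : R) : 0 < a -> 0 < p ->
  has_int `]a, +oo[%classic (fun x => x `^ (- p - 1)) (a `^ (- p) / p).
Proof.
move=> a0 p0.
have -> : a `^ (- p) / p = 0 - - (p^-1 * a `^ (- p)) by rewrite sub0r opprK mulrC.
apply: (ge0_has_int_oy (F := fun x => - (p^-1 * x `^ (- p)))).
- by move=> x _; exact: powR_ge0.
- by move=> x ax; apply: continuous_powR_gt0; exact: lt_le_trans ax.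
- move=> x ax; have x0 : 0 < x by exact: lt_le_trans ax.
  have := is_derive1_powR (- p) x0 => H; apply: is_derive_eq.
  by rewrite /GRing.scale/=; field; rewrite gt_eqF.
- rewrite -oppr0; apply: cvgN; rewrite -(mulr0 p^-1); apply: cvgMr.
  apply/cvgrPdist_le => e e0; near=> x.
  have x0 : 0 < x by near: x; exact: nbhs_pinfty_gt.
  rewrite sub0r normrN ger0_norm ?powR_ge0// powRN invf_ple ?posrE ?powR_gt0//.
  (* Written as a [p]-th power, the bound reduces to monotonicity of powers once x exceeds the
     base. *)
  have -> : e^-1 = (e^-1 `^ p^-1) `^ p by rewrite -powRrM mulVf ?gt_eqF// powRr1// invr_ge0 ltW.
  apply: ge0_ler_powR; rewrite ?nnegrE ?powR_ge0 ?ltW//.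
Unshelve. all: by end_near. Qed.

Lemma measurable_id_RM : measurable_fun (setT : set RM) (fun t : RM => t : R).
Proof. exact: measurable_id. Qed.

Lemma has_int_itvo (a : itv_bound R) (r : R) f v :
  has_int [set` Interval a (BRight r)] f v -> has_int [set` Interval a (BLeft r)] f v.
Proof.
move=> fv; have mf := has_int_measurable fv; case: fv => fi fv.
have S : [set` Interval a (BLeft r)] `<=` [set` Interval a (BRight r)].
  by apply: subset_itvl; rewrite bnd_simp.
split; first exact: integrableS fi.
by rewrite -fv integral_itv_bndo_bndc//; apply/measurable_EFinP; exact: measurable_funS mf.
Qed.

Lemma has_int_itvo_l (b : itv_bound R) (r : R) f v :
  has_int [set` Interval (BLeft r) b] f v -> has_int [set` Interval (BRight r) b] f v.
Proof.
move=> fv; have mf := has_int_measurable fv; case: fv => fi fv.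
have S : [set` Interval (BRight r) b] `<=` [set` Interval (BLeft r) b].
  by apply: subset_itvr; rewrite bnd_simp.
split; first exact: integrableS fi.
by rewrite -fv integral_itv_obnd_cbnd//; apply/measurable_EFinP; exact: measurable_funS mf.
Qed.

Let itvoy : set RM := `]0, +oo[%classic.

(* Layer cake: [expR (- phi x)] is the integral of [expR (- t)] over [t > phi x]. *)
Lemma has_int_layer (D : set RM) (w phi c : R -> R) v :
  measurable D -> measurable_fun (setT : set RM) w ->
  measurable_fun (setT : set RM) phi ->
  (forall x, D x -> 0 <= w x) -> (forall x, D x -> 0 <= phi x) ->
  (forall t, 0 < t -> has_int (D `&` [set x | phi x < t]) w (c t)) ->
  has_int itvoy (fun t => c t * expR (- t)) v <->
  has_int D (fun x => w x * expR (- phi x)) v.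
Proof.
move=> mD mw mphi w0 phi0 wc.
have mi : measurable itvoy by exact: measurable_itv.
pose f (z : RM * RM) := if phi z.1 < z.2 then w z.1 * expR (- z.2) else 0.
have mb : measurable_fun setT (fun z : RM * RM => phi z.1 < z.2).
  by apply: measurable_fun_ltr => //; exact: measurableT_comp.
have mf : measurable_fun setT f.
  apply: measurable_fun_ifT => //; apply: measurable_funM.
    exact: measurableT_comp.
  by apply: measurableT_comp => //; exact: measurableT_comp.
have mfs : measurable_fun setT (fun z => f (z.2, z.1)).
  exact: (measurableT_comp mf (measurable_fun_pair measurable_snd measurable_fst)).
have f0 x y : D x -> itvoy y -> 0 <= f (x, y).
  by move=> Dx _; rewrite /f/=; case: ifPn => // _; rewrite mulr_ge0 ?w0 ?expR_ge0.
have H1 x : D x -> has_int itvoy (fun t => f (x, t)) (w x * expR (- phi x)).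
  move=> Dx; apply/(has_int_if (b := fun t => phi x < t)) => //.
    by apply: measurable_boolset; exact: (measurable_fun_ltr (measurable_cst (phi x)) measurable_id_RM).
  have -> : itvoy `&` [set t | phi x < t] = `]phi x, +oo[%classic.
    apply/seteqP; split => t /=; rewrite /itvoy/= !in_itv/= !andbT; first by case.
    by move=> pt; split => //; exact: le_lt_trans (phi0 _ Dx) pt.
  by apply: (has_intZ (w x) _ (has_int_expRN (phi x))); exact: measurable_itv.
have H2 t : itvoy t -> has_int D (fun x => f (x, t)) (c t * expR (- t)).
  rewrite /itvoy/= in_itv/= andbT => t0.
  apply/(has_int_if (b := fun x => phi x < t)) => //.
    by apply: measurable_boolset; exact: (measurable_fun_ltr mphi (measurable_cst t)).
  have mDt : measurable (D `&` [set x | phi x < t]).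
    apply: measurableI => //; by apply: measurable_boolset; exact: (measurable_fun_ltr mphi (measurable_cst t)).
  rewrite mulrC; apply: eq_has_int (has_intZ _ mDt (wc t t0)) mDt => x _.
  by rewrite mulrC.
split => H.
  exact: (has_int_tonelli mD mi mf f0 H1 H2 H).
exact: (has_int_tonelli mi mD mfs (fun x y Ax By => f0 y x By Ax) H2 H1 H).
Qed.

Let gammaf (p : R) (t : R) := t `^ (p - 1) * expR (- t).

(** Layer cake with weight t^(p - 1): its mass below level t is t^p / p. The two Gamma integrals
    thus exist together, in both directions, with the functional equation relating their values. *)
Let gamma_step p v : 0 < p ->
  has_int itvoy (gammaf (p + 1)) (p * v) <-> has_int itvoy (gammaf p) v.
Proof.
move=> p0.
have mi : measurable itvoy by exact: measurable_itv.
have := @has_int_layer itvoy (fun t => t `^ (p - 1)) id (fun t => t `^ p / p) v mi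
  (measurable_powR _) measurable_id_RM.
have H t : 0 < t ->
    has_int (itvoy `&` [set x | id x < t]) (fun t0 : R => t0 `^ (p - 1)) (t `^ p / p).
  move=> t0.
  have -> : itvoy `&` [set x | id x < t] = `]0, t[%classic.
    by apply/seteqP; split => x /=; rewrite /itvoy/= !in_itv/= andbT => /andP.
  exact/has_int_itvo/has_int_powR.
move=> /(_ _ _ H) E; rewrite -E.
- split => h.
    have := has_intZ p^-1 mi h; rewrite mulrA mulVf ?gt_eqF// mul1r.
    move=> /eq_has_int; apply => // t _; rewrite /gammaf addrK; ring.
  have := has_intZ p mi h.
  move=> /eq_has_int; apply => // t _; rewrite /gammaf addrK; field.
  by rewrite gt_eqF.
- by move=> x _; exact: powR_ge0.
- by move=> x; rewrite /itvoy /= in_itv/= andbT => /ltW.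
Qed.


Let gammaf1 : has_int itvoy (gammaf 1) 1.
Proof.
have := has_int_expRN (0 : R); rewrite oppr0 expR0.
move=> /eq_has_int; apply; last exact: measurable_itv.
by move=> t _; rewrite /gammaf subrr powRr0 mul1r.
Qed.

Let gammaf_nat n : has_int itvoy (gammaf n.+1%:R) n`!%:R.
Proof.
elim: n => [|n IH]; first exact: gammaf1.
by rewrite -[n.+2%:R]natr1 factS natrM; exact: (gamma_step _ (ltr0Sn _ n)).2.
Qed.

Let measurable_gammaf p : measurable_fun itvoy (gammaf p).
Proof.
apply: measurable_funTS; apply: measurable_funM; first exact: measurable_powR.
by apply: measurableT_comp => //; exact: measurableT_comp.
Qed.

(** For p >= 1, t^(p - 1) is at most 1 when t <= 1 and at most t^N when t > 1, where N > p; integer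
    arguments are known from [gammaf_nat]. *)
Let gammaf_ge1 p : 1 <= p -> has_int itvoy (gammaf p) (Gamma_pos p).
Proof.
move=> p1; have mi : measurable itvoy by exact: measurable_itv.
pose N := (Num.truncn p).+1.
have pN : p < N%:R by exact: truncnS_gt.
apply: (dom_has_int mi (measurable_gammaf p)
  (has_intD mi gammaf1 (gammaf_nat N))) => t.
rewrite /itvoy/= in_itv/= andbT => t0.
rewrite /gammaf ger0_norm; last by rewrite mulr_ge0 ?powR_ge0 ?expR_ge0.
rewrite -mulrDl ler_wpM2r ?expR_ge0// subrr powRr0.
have [t1|t1] := leP t 1.
  rewrite (@le_trans _ _ 1)//; last by rewrite lerDl powR_ge0.
  by rewrite -[leRHS](powRr0 t) ger_powR ?t0// subr_ge0.
rewrite (@le_trans _ _ (t `^ (N.+1%:R - 1)))//; last by rewrite lerDr.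
by apply: ler_powR; [exact: ltW|rewrite lerD2r (le_trans (ltW pN))// ler_nat].
Qed.

Lemma has_int_Gamma (p : R) : 0 < p ->
  has_int `]0, +oo[%classic (fun t => t `^ (p - 1) * expR (- t)) (Gamma p).
Proof.
move=> p0; rewrite /Gamma p0.
suff [v H] : exists v, has_int itvoy (gammaf p) v.
  by rewrite /Gamma_pos (has_intE H).
(* For p < 1 the integrand is singular at 0. Existence is established at p + 1 >= 1 and brought down
   by the functional equation. *)
exists (p^-1 * Gamma_pos (p + 1)).
apply/(gamma_step _ p0); rewrite mulrA divff ?gt_eqF// mul1r.
by apply: gammaf_ge1; rewrite lerDr ltW.
Qed.

Lemma GammaS (p : R) : 0 < p -> Gamma (p + 1) = p * Gamma p.
Proof.
move=> p0; have p10 : 0 < p + 1 by rewrite addr_gt0.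
exact: has_int_unique (has_int_Gamma p10) ((gamma_step _ p0).2 (has_int_Gamma p0)).
Qed.

Lemma Gamma1 : Gamma 1 = 1 :> R.
Proof. exact: has_int_unique (has_int_Gamma ltr01) gammaf1. Qed.

(** When the mass of [w] below level t is a pure power of t, the layer cake is a Gamma integral.
    This takes the place of the nonlinear substitutions in the integrals below. *)
Lemma has_int_layer_Gamma (D : set RM) (w phi : R -> R) (C p : R) :
  measurable D -> measurable_fun (setT : set RM) w ->
  measurable_fun (setT : set RM) phi ->
  (forall x, D x -> 0 <= w x) -> (forall x, D x -> 0 <= phi x) -> 0 < p + 1 ->
  (forall t, 0 < t -> has_int (D `&` [set x | phi x < t]) w (C * t `^ p)) ->
  has_int D (fun x => w x * expR (- phi x)) (C * Gamma (p + 1)).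
Proof.
move=> mD mw mphi w0 phi0 p0 H; apply/(has_int_layer _ mD mw mphi w0 phi0 H).
have mi : measurable itvoy by exact: measurable_itv.
have := has_intZ C mi (has_int_Gamma p0).
by move=> /eq_has_int; apply => // t _; rewrite addrK mulrA.
Qed.

End gamma.

(** * Integrals reduced to the Gamma function *)

Section gamma_integrals.
Context {R : realType}.
Notation RM := (measurableTypeR R).

Let itvoy : set RM := `]0, +oo[%classic.
Let mi : measurable itvoy. Proof. exact: measurable_itv. Qed.

(** On t > 1 the integrand is at least exp(- t). This crude uniform bound gives positivity of Gamma
    and later the domination of Bessel series by exponential series. *)
Lemma Gamma_ge_expN1 (q : R) : 1 <= q -> expR (- 1) <= Gamma q.
Proof.
move=> q1; have q0 : 0 < q by exact: lt_le_trans q1.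
have H : has_int itvoy (fun t => if 1 < t then expR (- t) else 0) (expR (- 1)).
  apply/has_int_if => //.
    by apply: measurable_boolset; exact: (measurable_fun_ltr (measurable_cst (1:R)) measurable_id_RM).
  have -> : itvoy `&` [set t | 1 < t] = `]1, +oo[%classic.
    apply/seteqP; split => t /=; rewrite /itvoy/= !in_itv/= !andbT; first by case.
    by move=> t1; split => //; exact: lt_trans t1.
  exact: has_int_expRN.
refine (le_has_int mi H (has_int_Gamma q0) _) => t.
rewrite /itvoy/= in_itv/= andbT => t0; case: ifPn => t1; last by rewrite mulr_ge0 ?powR_ge0 ?expR_ge0.
rewrite ler_peMl ?expR_ge0// -[leLHS](powRr0 t); apply: ler_powR; first exact: ltW.
by rewrite subr_ge0.
Qed.

Lemma Gamma_gt0 (p : R) : 0 < p -> 0 < Gamma p.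
Proof.
have G1 (q : R) : 1 <= q -> 0 < Gamma q.
  by move=> /Gamma_ge_expN1; apply: lt_le_trans; exact: expR_gt0.
move=> p0; have := G1 (p + 1); rewrite GammaS// pmulr_rgt0// => -> //.
by rewrite lerDr ltW.
Qed.

Lemma has_int_gauss_moment (m s : R) : 0 < m -> 0 < s ->
  has_int `]0, +oo[%classic (fun x => x `^ (2 * m - 1) * expR (- (s * x ^+ 2)))
    (Gamma m / 2 * s `^ (- m)).
Proof.
move=> m0 s0.
have -> : Gamma m / 2 * s `^ (- m) = s `^ (- m) / (2 * m) * Gamma (m + 1).
  by rewrite GammaS//; field; rewrite gt_eqF.
have mphi : measurable_fun (setT : set RM) (fun x : R => s * x ^+ 2).
  by apply: measurable_funM => //; exact: measurableT_comp.
apply: has_int_layer_Gamma => //.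
- by move=> x _; exact: powR_ge0.
- by move=> x _; rewrite mulr_ge0 ?sqr_ge0// ltW.
- by rewrite addr_gt0.
move=> t t0.
have r0 : 0 < Num.sqrt (t / s) by rewrite sqrtr_gt0 divr_gt0.
have -> : itvoy `&` [set x | s * x ^+ 2 < t] = `]0, Num.sqrt (t / s)[%classic.
  apply/seteqP; split => x /=; rewrite /itvoy/= !in_itv/= andbT.
    move=> [x0]; rewrite mulrC -ltr_pdivlMr// => h; rewrite x0/=.
    by rewrite -(gtr0_norm x0) -sqrtr_sqr ltr_sqrt// divr_gt0.
  move=> /andP[x0]; rewrite -{1}(gtr0_norm x0) -sqrtr_sqr ltr_sqrt ?divr_gt0// => h.
  by rewrite mulrC -ltr_pdivlMr.
have -> : s `^ (- m) / (2 * m) * t `^ m = Num.sqrt (t / s) `^ (2 * m) / (2 * m).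
  rewrite -powR12_sqrt ?divr_ge0 ?ltW// -powRrM mulrA mulVf// mul1r.
  rewrite powRM ?invr_ge0 ?ltW//.
  have -> : s^-1 `^ m = s `^ (- m) by rewrite -[s^-1]powR_inv1 ?ltW// -powRrM mulN1r.
  by ring.
by apply/has_int_itvo/has_int_powR => //; rewrite mulr_gt0.
Qed.

Lemma has_int_Gamma_scale (m s : R) : 0 < m -> 0 < s ->
  has_int `]0, +oo[%classic (fun x => x `^ (m - 1) * expR (- (s * x)))
    (Gamma m * s `^ (- m)).
Proof.
move=> m0 s0.
have -> : Gamma m * s `^ (- m) = s `^ (- m) / m * Gamma (m + 1).
  by rewrite GammaS//; field; rewrite gt_eqF.
have mphi : measurable_fun (setT : set RM) (fun x : R => s * x).
  exact: measurable_funM.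
apply: has_int_layer_Gamma => //.
- by move=> x _; exact: powR_ge0.
- by move=> x /=; rewrite in_itv/= andbT => x0; rewrite mulr_ge0 ?ltW.
- by rewrite addr_gt0.
move=> t t0.
have -> : itvoy `&` [set x | s * x < t] = `]0, t / s[%classic.
  apply/seteqP; split => x /=; rewrite /itvoy/= !in_itv/= andbT ltr_pdivlMr// mulrC.
    by move=> [-> ->].
  by move=> /andP[].
have -> : s `^ (- m) / m * t `^ m = (t / s) `^ m / m.
  rewrite powRM ?invr_ge0 ?ltW//.
  have -> : s^-1 `^ m = s `^ (- m) by rewrite -[s^-1]powR_inv1 ?ltW// -powRrM mulN1r.
  by ring.
by apply/has_int_itvo/has_int_powR => //; rewrite divr_gt0.
Qed.

Lemma has_int_Gamma_inv (m r : R) : 0 < m -> 0 < r ->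
  has_int `]0, +oo[%classic (fun x => x `^ (- m - 1) * expR (- (r / x)))
    (Gamma m * r `^ (- m)).
Proof.
move=> m0 r0.
have -> : Gamma m * r `^ (- m) = r `^ (- m) / m * Gamma (m + 1).
  by rewrite GammaS//; field; rewrite gt_eqF.
(* The inverse is rewritten as a power because the layer cake asks for an exponent function
   measurable on the whole line. *)
suff : has_int itvoy (fun x => x `^ (- m - 1) * expR (- (r * x `^ (- 1))))
    (r `^ (- m) / m * Gamma (m + 1)).
  move=> /eq_has_int; apply => // x; rewrite inE /itvoy/= in_itv/= andbT => x0.
  by rewrite powR_inv1// ltW.
have mphi : measurable_fun (setT : set RM) (fun x : R => r * x `^ (- 1)).
  by apply: measurable_funM => //; exact: measurable_powR.
apply: has_int_layer_Gamma => //.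
- by move=> x _; exact: powR_ge0.
- by move=> x /=; rewrite /itvoy/= in_itv/= andbT => x0; rewrite mulr_ge0 ?powR_ge0 ?ltW.
- by rewrite addr_gt0.
move=> t t0.
have -> : itvoy `&` [set x | r * x `^ (- 1) < t] = `]r / t, +oo[%classic.
  apply/seteqP; split => x /=; rewrite /itvoy/= !in_itv/= !andbT.
    by move=> [x0]; rewrite powR_inv1 ?ltW// !ltr_pdivrMr// mulrC.
  move=> h; have x0 : 0 < x by apply: lt_trans h; rewrite divr_gt0.
  by split => //; move: h; rewrite powR_inv1 ?ltW// !ltr_pdivrMr// mulrC.
have -> : r `^ (- m) / m * t `^ m = (r / t) `^ (- m) / m.
  rewrite powRM ?invr_ge0 ?ltW//.
  have -> : t^-1 `^ (- m) = t `^ m.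
    by rewrite -[t^-1]powR_inv1 ?ltW// -powRrM mulN1r opprK.
  by ring.
by apply: has_int_powRN => //; rewrite divr_gt0.
Qed.

(** The Gaussian moment with m = 1/2 and s = 1 carries the weight x^0, so it is the Gaussian
    integral. *)
Lemma Gamma_half : Gamma 2^-1 = Num.sqrt pi :> R.
Proof.
have h0 : 0 < 2^-1 :> R by rewrite invr_gt0.
have := has_int_gauss_moment h0 ltr01; rewrite powR1 mulr1 mulfV// subrr => H.
have [_ G] := H.
have := @integral0y_gauss R; rewrite -integral_itv_obnd_cbnd; last first.
  by apply/measurable_EFinP/measurable_funTS; exact: measurable_gauss_fun.
move=> G2; have [] : (Gamma 2^-1 / 2)%:E = (Num.sqrt pi / 2)%:E :> \bar R.
  rewrite -G -G2; apply: eq_integral => x _.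
  by rewrite powRr0 mul1r mul1r.
by move=> /(congr1 (fun x => x * 2)); rewrite !divfK.
Qed.

(** The integrand times Gamma (s + 1) is a Gamma integral in t of t^s exp(- (1 + y^2) t). After
    exchange the inner integral in y is Gaussian and the outer one is again a Gamma integral. *)
Lemma has_int_cauchy_power (s : R) : - 2^-1 < s ->
  has_int `]0, +oo[%classic (fun y => (1 + y ^+ 2) `^ (- (s + 1)))
    (Num.sqrt pi * Gamma (s + 2^-1) / (2 * Gamma (s + 1))).
Proof.
move=> s1; have s10 : 0 < s + 1 by lra.
have s20 : 0 < s + 2^-1 by lra.
have G0 := Gamma_gt0 s10.
pose f (z : RM * RM) : R := z.2 `^ (s + 1 - 1) * expR (- ((1 + z.1 ^+ 2) * z.2)).
have mf : measurable_fun setT f.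
  apply: measurable_funM.
    exact: (measurableT_comp (measurable_powR _) measurable_snd).
  apply: measurableT_comp => //; apply: measurableT_comp => //.
  apply: measurable_funM => //; apply: measurable_funD => //.
  exact: (@measurableT_comp _ _ _ _ _ _ (fun x : R => x ^+ 2)).
have : has_int itvoy (fun y => Gamma (s + 1) * (1 + y ^+ 2) `^ (- (s + 1)))
    (Num.sqrt pi / 2 * Gamma (s + 2^-1)).
  apply: (@has_int_tonelli R itvoy itvoy f _
     (fun t => Num.sqrt pi / 2 * (t `^ (s + 2^-1 - 1) * expR (- t)))) => //.
  - by move=> x y _ _; rewrite mulr_ge0 ?powR_ge0 ?expR_ge0.
  - move=> y _; have y0 : 0 < 1 + y ^+ 2 by rewrite ltr_pwDl// sqr_ge0.
    exact: (has_int_Gamma_scale s10 y0).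
  - move=> t; rewrite /itvoy/= in_itv/= andbT => t0.
    have h0 : 0 < 2^-1 :> R by rewrite invr_gt0.
    have := has_intZ (t `^ (s + 1 - 1) * expR (- t)) mi (has_int_gauss_moment h0 t0).
    rewrite Gamma_half.
    have -> : t `^ (s + 1 - 1) * expR (- t) * (Num.sqrt pi / 2 * t `^ (- 2^-1)) =
       Num.sqrt pi / 2 * (t `^ (s + 2^-1 - 1) * expR (- t)).
      have -> : s + 2^-1 - 1 = (s + 1 - 1) + - 2^-1 by field.
      by rewrite [in RHS]powRD; [ring|rewrite (gt_eqF t0) implybT].
    move=> /eq_has_int; apply => // y _; rewrite /f/= mulfV// subrr powRr0 mul1r.
    by rewrite mulrDl mul1r opprD expRD mulrA (mulrC t).
  - exact: (has_intZ _ mi (has_int_Gamma s20)).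
move=> /(has_intZ (Gamma (s + 1))^-1 mi); have -> : (Gamma (s + 1))^-1 * (Num.sqrt pi / 2 * Gamma (s + 2^-1)) = Num.sqrt pi * Gamma (s + 2^-1) / (2 * Gamma (s + 1)).
  by field; rewrite gt_eqF.
by move=> /eq_has_int; apply => // y _; rewrite mulrA mulVf ?mul1r// gt_eqF.
Qed.

End gamma_integrals.

(** * Beta integral, duplication formula, reciprocal Gamma *)

Section beta_integrals.
Context {R : realType}.
Notation mu := (@lebesgue_measure R).
Notation RM := (measurableTypeR R).

Let itvoy : set RM := `]0, +oo[%classic.
Let mi : measurable itvoy. Proof. exact: measurable_itv. Qed.
Let itv11 : set RM := `]-1, 1[%classic.
Let mi1 : measurable itv11. Proof. exact: measurable_itv. Qed.

Lemma powRDr1 (x p : R) : 0 < x -> x `^ (p + 1) = x `^ p * x.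
Proof.
by move=> x0; rewrite powRD ?powRr1 ?(ltW x0)// (gt_eqF x0) implybT.
Qed.

Lemma one_sub_sqr_gt0 (x : R) : -1 < x -> x < 1 -> 0 < 1 - x ^+ 2.
Proof.
move=> x1 x2; rewrite subr_gt0 -(real_normK (num_real x)) -[ltRHS](expr1n _ 2).
by rewrite ltr_sqr ?nnegrE ?normr_ge0// ltr_norml x1.
Qed.

Lemma measurable_one_sub_sqr (b : R) :
  measurable_fun (setT : set RM) (fun x : R => (1 - x ^+ 2) `^ b).
Proof.
apply: (@measurableT_comp _ _ _ _ _ _ (fun x : R => x `^ b)) => //.
apply: measurable_funB => //.
Qed.

Lemma has_int_cst (a b c : R) : a < b ->
  has_int `]a, b[%classic (fun=> c) (c * (b - a)).
Proof.
move=> ab; have mab : measurable (`]a, b[%classic : set RM) by exact: measurable_itv.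
have E : lebesgue_measure (`]a, b[%classic : set RM) = (b - a)%:E.
  by rewrite lebesgue_measure_itv/= lte_fin ab EFinB.
split.
  apply/integrableP; split; first exact/measurable_EFinP.
  rewrite (eq_integral (cst `|c|%:E))// integral_cst//.
  by rewrite [X in (_ * X)%E]E -EFinM ltry.
by rewrite (eq_integral (cst c%:E))// integral_cst// [X in (_ * X)%E]E -EFinM.
Qed.

Let W b := \int[mu]_(x in itv11) (1 - x ^+ 2) `^ b.

Let has_int_W0 b : 0 < b -> has_int itv11 (fun x => (1 - x ^+ 2) `^ b) (W b).
Proof.
move=> b0; have ltN11 : -1 < 1 :> R by lra.
apply: (dom_has_int mi1 _ (has_int_cst 1 ltN11)).
  by apply: measurable_funTS; exact: measurable_one_sub_sqr.
move=> x; rewrite /itv11/= in_itv/= => /andP[x1 x2].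
have h : 0 <= 1 - x ^+ 2 <= 1.
  rewrite subr_ge0 gerBl sqr_ge0 andbT -[leRHS](expr1n _ 2).
  by rewrite -(real_normK (num_real x)) ler_sqr ?nnegrE ?normr_ge0// ler_norml !ltW.
case/andP: h => h0 h1.
have E1 : 1 = 1 `^ b :> R by rewrite powR1.
by rewrite ger0_norm ?powR_ge0// [leRHS]E1 ge0_ler_powR ?nnegrE// ltW.
Qed.

(** Two evaluations of the integral of (u - x^2)^b exp(- u) over the region x^2 < u. Integrating in
    x first rescales to [W b] and leaves a Gamma integral in u; integrating in u first leaves Gamma
    (b + 1) times a Gaussian. *)
Lemma has_int_one_sub_sqr_powR (b : R) : 0 < b ->
  has_int `]-1, 1[%classic (fun x => (1 - x ^+ 2) `^ b)
    (Num.sqrt pi * Gamma (b + 1) / Gamma (b + 3 / 2)).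
Proof.
move=> b0; have b10 : 0 < b + 1 by lra.
have b20 : 0 < b + 3 / 2 by lra.
have G0 := Gamma_gt0 b20.
suff E : W b * Gamma (b + 3 / 2) = Num.sqrt pi * Gamma (b + 1).
  by rewrite -E mulfK ?gt_eqF//; exact: has_int_W0.
have H0 : has_int itvoy (fun u => W b * (u `^ (b + 3 / 2 - 1) * expR (- u)))
   (W b * Gamma (b + 3 / 2)).
  exact: (has_intZ _ mi (has_int_Gamma b20)).
apply: has_int_unique H0 _.
pose f (z : RM * RM) : R :=
  if z.2 ^+ 2 < z.1 then (z.1 - z.2 ^+ 2) `^ b * expR (- z.1) else 0.
have msq : measurable_fun setT (fun z : RM * RM => z.2 ^+ 2 : R).
  apply: (measurableT_comp (f := fun x : R => x ^+ 2)) => //.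
have mf : measurable_fun setT f.
  apply: measurable_fun_ifT => //; first exact: measurable_fun_ltr.
  apply: measurable_funM.
    apply: (measurableT_comp (measurable_powR b)).
    exact: measurable_funB.
  by apply: measurableT_comp => //; exact: measurableT_comp.
apply: (@has_int_tonelli R itvoy setT f _
   (fun x => Gamma (b + 1) * expR (- x ^+ 2))) => //.
- move=> u x _ _; rewrite /f/=; case: ifPn => // _.
  by rewrite mulr_ge0 ?powR_ge0 ?expR_ge0.
- move=> u; rewrite /itvoy/= in_itv/= andbT => u0.
  have ru : 0 < Num.sqrt u by rewrite sqrtr_gt0.
  have ru2 : Num.sqrt u ^+ 2 = u by rewrite sqr_sqrtr// ltW.
  have c0 : (Num.sqrt u)^-1 != 0 by rewrite invr_eq0 gt_eqF.
  have := has_int_affine 0 c0 mi1 (has_int_W0 b0).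
  have -> : [set x | itv11 ((Num.sqrt u)^-1 * x + 0)] = [set x | x ^+ 2 < u].
    apply/seteqP; split => x /=; rewrite /itv11/= in_itv/= addr0 mulrC.
      rewrite ltr_pdivlMr// ltr_pdivrMr// mul1r mulN1r => h.
      by rewrite -ru2 -(real_normK (num_real x)) ltr_sqr ?nnegrE ?normr_ge0 ?(ltW ru)// ltr_norml.
    move=> h; rewrite ltr_pdivlMr// ltr_pdivrMr// mul1r mulN1r -ltr_norml.
    by move: h; rewrite -{1}ru2 -(real_normK (num_real x)) ltr_sqr ?nnegrE ?normr_ge0 ?(ltW ru).
  have mu' : measurable [set x : RM | x ^+ 2 < u].
    apply: measurable_boolset; apply: (measurable_fun_ltr _ (measurable_cst u)).
    exact: (measurableT_comp (f := fun x : R => x ^+ 2)).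
  move=> /(has_intZ (u `^ b * expR (- u)) mu').
  have -> : u `^ b * expR (- u) * (W b / `|(Num.sqrt u)^-1|) =
     W b * (u `^ (b + 3 / 2 - 1) * expR (- u)).
    rewrite gtr0_norm ?invr_gt0// invrK -powR12_sqrt ?(ltW u0)//.
    have -> : b + 3 / 2 - 1 = b + 2^-1 by field.
    rewrite [u `^ (_ + _)]powRD; first ring.
    by rewrite (gt_eqF u0) implybT.
  rewrite -{1}[[set x | _]]setTI => H.
  apply/(has_int_if (b := fun x => x ^+ 2 < u)) => //.
  apply: eq_has_int H _; last by rewrite setTI.
  move=> x; rewrite inE/= => -[_ xu].
  rewrite [RHS]mulrAC; congr (_ * _).
  rewrite addr0 -powRM ?(ltW u0)//; last first.
    rewrite subr_ge0 exprMn exprVn ru2 mulrC ler_pdivrMr// mul1r ltW//.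
  by rewrite exprMn exprVn ru2 mulrBr mulr1 mulrA divff ?mul1r ?gt_eqF.
- move=> x _.
  have mx : measurable [set u : RM | x ^+ 2 < u].
    apply: measurable_boolset.
    exact: (measurable_fun_ltr (measurable_cst (x ^+ 2)) measurable_id_RM).
  apply/(has_int_if (b := fun u => x ^+ 2 < u)) => //.
  have c0 : (1 : R) != 0 by exact: oner_neq0.
  have := has_int_affine (- x ^+ 2) c0 mi (has_int_Gamma b10).
  have <- : itvoy `&` [set u | x ^+ 2 < u] = [set u | itvoy (1 * u + - x ^+ 2)].
    apply/seteqP; split => u /=; rewrite /itvoy/= !in_itv/= !andbT mul1r subr_gt0.
      by case.
    by move=> h; split => //; apply: le_lt_trans h; exact: sqr_ge0.
  have mix := measurableI _ _ mi mx.
  move=> /(has_intZ (expR (- x ^+ 2)) mix).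
  rewrite normr1 divr1 mulrC => /eq_has_int; apply => // u _ /=.
  by rewrite mul1r addrK mulrCA -expRD; congr (_ * expR _); ring.
- have [iG G] : has_int setT (@gauss_fun R) (Num.sqrt pi).
    by split; [exact: integrableT_gauss|exact: integralT_gauss].
  rewrite mulrC; exact: (has_intZ _ measurableT (conj iG G)).
Qed.

(** The product of two Gamma integrals is the integral of s^b (u - s)^b exp(- u) over 0 < s < u, and
    the section in s is a Beta integral proportional to [W b]. *)
Lemma Gamma_sqr (b : R) : 0 < b ->
  Gamma (b + 1) ^+ 2 = W b * (2^-1) `^ (2 * b + 1) * Gamma (2 * b + 2).
Proof.
move=> b0; have b10 : 0 < b + 1 by lra.
have b20 : 0 < 2 * b + 2 by lra.
pose f (z : RM * RM) : R :=
  if z.1 < z.2 then (z.1 `^ b * (z.2 - z.1) `^ b) * expR (- z.2) else 0.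
have mf : measurable_fun setT f.
  apply: measurable_fun_ifT => //; first exact: measurable_fun_ltr.
  apply: measurable_funM; last by apply: measurableT_comp => //; exact: measurableT_comp.
  apply: measurable_funM.
    exact: (measurableT_comp (measurable_powR b) measurable_fst).
  apply: (measurableT_comp (measurable_powR b)); exact: measurable_funB.
have H0 : has_int itvoy (fun s => Gamma (b + 1) * (s `^ (b + 1 - 1) * expR (- s)))
   (Gamma (b + 1) ^+ 2).
  exact: (has_intZ _ mi (has_int_Gamma b10)).
apply: has_int_unique H0 _.
apply: (@has_int_tonelli R itvoy itvoy f _
   (fun u => W b * 2^-1 `^ (2 * b + 1) * (u `^ (2 * b + 2 - 1) * expR (- u)))) => //.
- move=> u x _ _; rewrite /f/=; case: ifPn => // _.
  by rewrite mulr_ge0 ?mulr_ge0 ?powR_ge0 ?expR_ge0.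
- move=> s; rewrite /itvoy/= in_itv/= andbT => s0.
  have mx : measurable [set u : RM | s < u].
    apply: measurable_boolset.
    exact: (measurable_fun_ltr (measurable_cst s) measurable_id_RM).
  apply/(has_int_if (b := fun u => s < u)) => //; rewrite addrK.
  have c0 : (1 : R) != 0 by exact: oner_neq0.
  have := has_int_affine (- s) c0 mi (has_int_Gamma b10).
  have <- : itvoy `&` [set u | s < u] = [set u | itvoy (1 * u + - s)].
    apply/seteqP; split => u /=; rewrite /itvoy/= !in_itv/= !andbT mul1r subr_gt0.
      by case.
    by move=> h; split => //; apply: lt_trans h.
  have mix := measurableI _ _ mi mx.
  move=> /(has_intZ (s `^ b * expR (- s)) mix).
  rewrite normr1 divr1 !addrK [_ * Gamma _]mulrC => /eq_has_int; apply => // u _ /=.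
  rewrite mul1r (_ : expR (- u) = expR (- s) * expR (- (u - s))); first ring.
  by rewrite -expRD; congr expR; ring.
- move=> u; rewrite /itvoy/= in_itv/= andbT => u0.
  have mx : measurable [set s : RM | s < u].
    apply: measurable_boolset.
    exact: (measurable_fun_ltr measurable_id_RM (measurable_cst u)).
  apply/(has_int_if (b := fun s => s < u)) => //.
  have u20 : 0 < 2 / u by rewrite divr_gt0.
  have c0 : 2 / u != 0 by rewrite gt_eqF.
  (* The map x = 2 s / u - 1 takes (0, u) to (-1, 1), and s (u - s) = (u / 2)^2 (1 - x^2). *)
  have := has_int_affine (- 1) c0 mi1 (has_int_W0 b0).
  have <- : itvoy `&` [set s | s < u] = [set x | itv11 (2 / u * x + -1)].
    apply/seteqP; split => s /=; rewrite /itvoy /itv11/= !in_itv/= !andbT mulrAC => h;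
    move: h; rewrite ltrDr ltrBlDr (_ : 1 + 1 = 2)// ltr_pdivrMr// ltr_pM2l//.
      by move=> [s0 ->]; rewrite andbT divr_gt0// mulr_gt0.
    by move=> /andP[+ ->]; rewrite pmulr_lgt0 ?invr_gt0// pmulr_rgt0.
  have mix := measurableI _ _ mi mx.
  move=> /(has_intZ ((u / 2) `^ (2 * b) * expR (- u)) mix).
  have -> : (u / 2) `^ (2 * b) * expR (- u) * (W b / `|2 / u|) =
    W b * 2^-1 `^ (2 * b + 1) * (u `^ (2 * b + 2 - 1) * expR (- u)).
    rewrite gtr0_norm// invf_div.
    have -> : 2 * b + 2 - 1 = 2 * b + 1 by ring.
    rewrite powRM ?(ltW u0) ?invr_ge0// !powRDr1 ?invr_gt0//; by field.
  move=> /eq_has_int; apply => // s; rewrite inE /itvoy/= in_itv/= andbT => -[s0 su] /=.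
  rewrite [RHS]mulrAC; congr (_ * _).
  have us : 0 < u - s by rewrite subr_gt0.
  rewrite powRrM -!powRM ?(ltW s0) ?(ltW us)// ?powR_ge0//.
    congr (_ `^ _); rewrite powR_mulrn ?divr_ge0 ?(ltW u0)//; field; by rewrite gt_eqF.
  have -> : 1 - (2 / u * s - 1) ^+ 2 = 4 * s * (u - s) / u ^+ 2 by field; rewrite gt_eqF.
  by rewrite divr_ge0 ?mulr_ge0 ?sqr_ge0// ltW.
- exact: (has_intZ _ mi (has_int_Gamma b20)).
Qed.

(** [Gamma_sqr] and [has_int_one_sub_sqr_powR] give two values for the same integral [W b]; equating
    them is the duplication formula at b + 1. *)
Lemma Gamma_dup (p : R) : 0 < p ->
  Num.sqrt pi * Gamma (2 * p) = 2 `^ (2 * p - 1) * Gamma p * Gamma (p + 2^-1).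
Proof.
have H (b : R) : 0 < b ->
  Num.sqrt pi * Gamma (2 * (b + 1)) = 2 `^ (2 * b + 1) * Gamma (b + 1) * Gamma (b + 1 + 2^-1).
  move=> b0; have b10 : 0 < b + 1 by lra.
  have b20 : 0 < b + 3 / 2 by lra.
  have G1 := Gamma_gt0 b10; have G2 := Gamma_gt0 b20.
  have := Gamma_sqr b0; rewrite /W (has_intE (has_int_one_sub_sqr_powR b0)).
  have -> : b + 1 + 2^-1 = b + 3 / 2 by field.
  have -> : 2 * (b + 1) = 2 * b + 2 by ring.
  have -> : 2^-1 `^ (2 * b + 1) = (2 `^ (2 * b + 1))^-1 :> R.
    by rewrite -powRN -mulN1r powRrM powR_inv1.
  move=> E.
  have P0 : 2 `^ (2 * b + 1) != 0 by rewrite gt_eqF// powR_gt0.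
  apply: (mulIf (lt0r_neq0 G1)); apply/eqP; rewrite -subr_eq0.
  have -> : 2 `^ (2 * b + 1) * Gamma (b + 1) * Gamma (b + 3 / 2) * Gamma (b + 1) =
     2 `^ (2 * b + 1) * Gamma (b + 3 / 2) * Gamma (b + 1) ^+ 2 by ring.
  by rewrite E subr_eq0; apply/eqP; field; rewrite P0 gt_eqF.
(* [H] covers arguments above 1; all of p > 0 is reached by stepping down from p + 1, with common
   factor (2 p + 1) (2 p). *)
move=> p0; have := H p p0; rewrite GammaS//.
have -> : p + 1 + 2^-1 = p + 2^-1 + 1 by ring.
have h2 : 0 < p + 2^-1 by rewrite addr_gt0// invr_gt0.
have t0 : 0 < 2 * p by rewrite mulr_gt0.
rewrite GammaS//; have -> : 2 * (p + 1) = 2 * p + 1 + 1 by ring.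
rewrite !GammaS ?addr_gt0//.
have -> : 2 `^ (2 * p + 1) = 4 * 2 `^ (2 * p - 1) :> R.
  have -> : 2 * p + 1 = 2 * p - 1 + 1 + 1 by ring.
  by rewrite !powRDr1//; ring.
move=> E; apply: (@mulfI _ ((2 * p + 1) * (2 * p))).
  by rewrite mulf_neq0// gt_eqF// addr_gt0.
have -> : (2 * p + 1) * (2 * p) * (Num.sqrt pi * Gamma (2 * p)) =
   Num.sqrt pi * ((2 * p + 1) * (2 * p * Gamma (2 * p))) by ring.
by rewrite E; field.
Qed.

(** In reciprocal form the functional equation holds for every real z: at the poles both sides are
    0. *)
Lemma rGammaS (z : R) : (Gamma z)^-1 = z * (Gamma (z + 1))^-1.
Proof.
have [z0|z0] := ltP 0 z.
  by rewrite GammaS// invfM mulrA divff ?mul1r// gt_eqF.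
rewrite /Gamma ltNge z0/=.
have N0 : 0 <= - z by rewrite oppr_ge0.
have /andP[t1 t2] := truncn_itv N0; set n := Num.truncn (- z) in t1 t2 *.
(* If z + 1 > 0, the defining product at z is the single factor z. Otherwise the product at z + 1
   has one factor fewer, over the same value of [Gamma_pos]. *)
case: ifPn => [z1|].
  have -> : n = 0%N.
    apply/eqP; rewrite -leqn0 -ltnS -(@ltr_nat R); apply: (le_lt_trans t1); lra.
  by rewrite big_ord1 addr0 invf_div.
rewrite -leNgt => z1.
have n0 : (0 < n)%N by rewrite -(@ltr_nat R); move: t2; rewrite -natr1; lra.
clearbody n; case: n n0 t1 t2 => // n _ t1 t2.
have -> : Num.truncn (- (z + 1)) = n.
  by apply: truncn_def; move: t1 t2; rewrite -!natr1 => t1 t2; apply/andP; split; lra.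
rewrite !invf_div big_ord_recl/= addr0.
have -> : z + n.+2%:R = z + 1 + n.+1%:R by rewrite -[n.+2%:R]natr1; ring.
rewrite mulrA; congr (_ * _ / _); apply: eq_bigr => i _.
by rewrite /bump/= add1n -natr1; ring.
Qed.

End beta_integrals.

(** * Integration by parts against the weight *)

Section ibp.
Context {R : realType}.
Notation mu := (@lebesgue_measure R).
Notation RM := (measurableTypeR R).
Let itv11 : set RM := `]-1, 1[%classic.
Let mi1 : measurable itv11. Proof. exact: measurable_itv. Qed.

(** [powR] at a negative base is a default value that breaks continuity at 0. Truncation makes the
    weight continuous on the whole line without changing it on [-1, 1]. *)
Let pospow (d t : R) : R := (Num.max 0 t) `^ d.

Let continuous_pospow d : 0 < d -> continuous (pospow d).
Proof.
move=> d0 t; have [t0|t0|t0] := ltgtP t 0.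
- apply: cvg_near_cst; near=> x.
  have x0 : x < 0 by near: x; exact: lt_nbhsl.
  by rewrite /pospow (max_idPl (ltW x0)) (max_idPl (ltW t0)).
- apply: (@cvg_trans _ (x `^ d @[x --> t])); last first.
    by rewrite /pospow max_r ?ltW//; exact: continuous_powR_gt0.
  apply: near_eq_cvg; near=> x.
  have x0 : 0 < x by near: x; exact: lt_nbhsr.
  by rewrite /pospow max_r// ltW.
- rewrite t0; apply/cvgrPdist_le => e e0; near=> x.
  rewrite {1}/pospow maxxx powR0 ?gt_eqF// sub0r normrN ger0_norm ?powR_ge0//.
  have -> : e = (e `^ d^-1) `^ d by rewrite -powRrM mulVf ?gt_eqF// powRr1// ltW.
  have xe : x < e `^ d^-1 by near: x; apply: lt_nbhsl; exact: powR_gt0.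
  apply: ge0_ler_powR; rewrite ?nnegrE ?powR_ge0 ?(ltW d0) ?le_max ?lexx//.
  by rewrite ge_max powR_ge0 ltW.
Unshelve. all: by end_near. Qed.

Lemma has_int_weight (d : R) (f : R -> R) : 0 < d -> continuous f ->
  has_int `]-1, 1[%classic (fun x => (1 - x ^+ 2) `^ d * f x)
    (\int[mu]_(x in `]-1, 1[) ((1 - x ^+ 2) `^ d * f x)).
Proof.
move=> d0 cf; apply: has_int_Rintegral => //.
have N11 : -1 <= 1 :> R by lra.
have cnf : {within `[-1, 1], continuous (fun x => `|f x|)}.
  apply: continuous_subspaceT => x; apply: continuous_comp; first exact: cf.
  exact: norm_continuous.
have [c _ fc] := EVT_max N11 cnf.
have [+ _] := has_intZ `|f c| mi1 (has_int_one_sub_sqr_powR d0).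
apply: le_integrable => //.
  apply/measurable_EFinP; apply: measurable_funM.
    by apply: measurable_funTS; exact: measurable_one_sub_sqr.
  by apply: measurable_funTS; exact: continuous_measurable_fun.
move=> x; rewrite /itv11/= in_itv/= => /andP[x1 x2].
rewrite lee_fin !normrM !(ger0_norm (powR_ge0 _ _)) normr_id mulrC ler_wpM2r ?powR_ge0//.
have xin : x \in `[-1, 1]%R by rewrite in_itv/= !ltW.
exact: fc xin.
Qed.

(* Fundamental theorem of calculus for [(1 - x^2)^(d+1) f(x)], which vanishes at both ends. *)
Lemma has_int_weight_deriv (d : R) (f g : R -> R) : 0 < d ->
  (forall x : R, is_derive x 1 f (g x)) -> continuous g ->
  has_int `]-1, 1[%classic
    (fun x => (1 - x ^+ 2) `^ d * ((1 - x ^+ 2) * g x - 2 * (d + 1) * x * f x)) 0.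
Proof.
move=> d0 fg cg; have d10 : 0 < d + 1 by rewrite addr_gt0.
have cf : continuous f.
  move=> x; apply: differentiable_continuous; apply/derivable1_diffP.
  by have [] := fg x.
have cw : continuous (fun x : R => 1 - x ^+ 2).
  by move=> x; apply: cvgB; [exact: cvg_cst|exact: exprn_continuous].
pose h x := pospow d (1 - x ^+ 2) * ((1 - x ^+ 2) * g x - 2 * (d + 1) * x * f x).
pose F x := pospow (d + 1) (1 - x ^+ 2) * f x.
have cp e : 0 < e -> continuous (fun x : R => pospow e (1 - x ^+ 2)).
  move=> e0 x; apply: (continuous_comp (cw x)); exact: continuous_pospow.
have ch : continuous h.
  move=> x; apply: cvgM; first exact: cp.
  apply: cvgB; first by apply: cvgM; [exact: cw|exact: cg].
  apply: cvgM; last exact: cf.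
  by apply: cvgM; [exact: cvg_cst|exact: cvg_id].
have cF : continuous F.
  by move=> x; apply: cvgM; [exact: cp|exact: cf].
have hE x : itv11 x -> h x = (1 - x ^+ 2) `^ d * ((1 - x ^+ 2) * g x - 2 * (d + 1) * x * f x).
  rewrite /itv11/= in_itv/= => /andP[x1 x2].
  rewrite /h /pospow max_r// subr_ge0 -(real_normK (num_real x)) -[leRHS](expr1n _ 2).
  by rewrite ler_sqr ?nnegrE ?normr_ge0// ler_norml !ltW.
have ltN11 : -1 < 1 :> R by lra.
have dF (x : R) : itv11 x -> is_derive x 1 F (h x).
  move=> x11; rewrite hE//; move: x11; rewrite /itv11/= in_itv/= => /andP[x1 x2].
  have w0 := one_sub_sqr_gt0 x1 x2.
  have dw : is_derive x 1 (fun x : R => 1 - x ^+ 2) (- (2 * x)).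
    by apply: is_derive_eq; rewrite /GRing.scale/=; ring.
  have dp : is_derive x 1 ((@powR R ^~ (d + 1)) \o (fun x : R => 1 - x ^+ 2))
      ((d + 1) * (1 - x ^+ 2) `^ (d + 1 - 1) * (- (2 * x))).
    by apply: is_derive1_comp; exact: is_derive1_powR.
  have := is_deriveM dp (fg x).
  have -> : (1 - x ^+ 2) `^ d * ((1 - x ^+ 2) * g x - 2 * (d + 1) * x * f x) =
    ((@powR R ^~ (d + 1)) \o (fun x : R => 1 - x ^+ 2)) x *: g x +
    f x *: ((d + 1) * (1 - x ^+ 2) `^ (d + 1 - 1) * (- (2 * x))).
    by rewrite /= powRDr1// addrK /GRing.scale/=; ring.
  apply: near_eq_is_derive; near=> y.
  have y1 : -1 < y by near: y; exact: lt_nbhsr.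
  have y2 : y < 1 by near: y; exact: lt_nbhsl.
  rewrite /F /pospow/= max_r// ltW// subr_gt0 -(real_normK (num_real y)) -[ltRHS](expr1n _ 2).
  by rewrite ltr_sqr ?nnegrE ?normr_ge0// ltr_norml y1.
have F0 (x : R) : x ^+ 2 = 1 -> F x = 0.
  by move=> E; rewrite /F /pospow E subrr maxxx powR0 ?gt_eqF// mul0r.
have H : has_int (`[-1, 1]%classic : set RM) h 0.
  split; first by apply: continuous_compact_integrable; [exact: segment_compact|exact: continuous_subspaceT].
  rewrite (@continuous_FTC2 R h F)//.
  - by rewrite (F0 1) ?(F0 (-1)) ?sqrrN ?expr1n// subee.
  - exact: continuous_subspaceT.
  - split.
    + by move=> x xi; have [] := dF x xi.
    + exact/cvg_at_right_filter/cF.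
    + exact/cvg_at_left_filter/cF.
  - by move=> x xi; rewrite derive1E; have [_ ->] := dF x xi.
apply: eq_has_int (has_int_itvo (has_int_itvo_l H)) mi1 => x /[!inE] xi.
by rewrite hE.
Unshelve. all: by end_near. Qed.

End ibp.

(** * Jacobi polynomials by Rodrigues' formula *)

Section gegenbauer.
Context {R : realType}.
Notation mu := (@lebesgue_measure R).
Notation RM := (measurableTypeR R).
Implicit Types (p q : {poly R}) (c d : R).
Let itv11 : set RM := `]-1, 1[%classic.
Let mi1 : measurable itv11. Proof. exact: measurable_itv. Qed.

(** A linear functional on polynomials: from here on, integration by parts on (-1, 1) becomes an
    identity in the polynomial ring. *)
Definition wint d p : R := \int[mu]_(x in `]-1, 1[) ((1 - x ^+ 2) `^ d * p.[x]).

Lemma has_int_wint d p : 0 < d ->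
  has_int `]-1, 1[%classic (fun x => (1 - x ^+ 2) `^ d * p.[x]) (wint d p).
Proof. by move=> d0; apply: has_int_weight => //; exact: continuous_horner. Qed.

Lemma wintD d p q : 0 < d -> wint d (p + q) = wint d p + wint d q.
Proof.
move=> d0; have := has_intD mi1 (has_int_wint p d0) (has_int_wint q d0).
move/has_intE => <-; apply: eq_Rintegral => x _.
by rewrite hornerD mulrDr.
Qed.

Lemma wintZ d k p : 0 < d -> wint d (k *: p) = k * wint d p.
Proof.
move=> d0; have := has_intZ k mi1 (has_int_wint p d0).
move/has_intE => <-; apply: eq_Rintegral => x _.
by rewrite hornerZ mulrCA.
Qed.

Lemma wintN d p : 0 < d -> wint d (- p) = - wint d p.
Proof. by move=> d0; rewrite -scaleN1r wintZ// mulN1r. Qed.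

Lemma wintC d k p : 0 < d -> wint d (k%:P * p) = k * wint d p.
Proof. by move=> d0; rewrite mul_polyC wintZ. Qed.

Lemma wint_sum d n (F : 'I_n -> {poly R}) : 0 < d ->
  wint d (\sum_(i < n) F i) = \sum_(i < n) wint d (F i).
Proof.
move=> d0; elim/big_ind2: _ => [|p x q y <- <-|//]; last exact: wintD.
by rewrite -(scale0r 0) wintZ// mul0r.
Qed.

Definition omega : {poly R} := 1 - 'X^2.

Lemma wint_omega d p : 0 < d -> wint d (omega * p) = wint (d + 1) p.
Proof.
move=> d0; apply: eq_Rintegral => x; rewrite inE /= in_itv/= => /andP[x1 x2].
have w0 := one_sub_sqr_gt0 x1 x2.
by rewrite powRDr1// /omega !hornerE.
Qed.

Lemma wint_ibp d p : 0 < d ->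
  wint d (omega * p^`() - (2 * (d + 1))%:P * 'X * p) = 0.
Proof.
move=> d0; have dp (x : R) : is_derive x 1 (horner p) (p^`()).[x].
  exact: is_derive_poly.
have := has_int_weight_deriv d0 dp (@continuous_horner _ _).
move/has_intE => E; rewrite -[RHS]E; apply: eq_Rintegral => x _.
by rewrite /omega !hornerE; ring.
Qed.

(* Rodrigues' formula: [(1 - x^2)^c * (gegen n c).[x]] is the n-th derivative of
   [(1 - x^2)^(c + n)]. *)
Fixpoint gegen n c : {poly R} :=
  if n is m.+1 then
    omega * (gegen m (c + 1))^`() - (2 * (c + 1))%:P * 'X * gegen m (c + 1)
  else 1.

Lemma gegenS n c : gegen n.+1 c =
  omega * (gegen n (c + 1))^`() - (2 * (c + 1))%:P * 'X * gegen n (c + 1).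
Proof. by []. Qed.

Lemma deriv_omega : omega^`() = - (2%:P * 'X).
Proof.
by rewrite /omega derivB derivC derivXn sub0r expr1 -mulr_natl polyCMn.
Qed.

(** Differentiating lowers the degree and raises the parameter. With G = [gegen n (c + 1)], the
    recursion folds omega G'' - 2 (c + 2) x G' back into a multiple of G (Jacobi's differential
    equation), and the remaining term is - 2 (c + 1) G. *)
Lemma deriv_gegen n c :
  (gegen n c)^`() = - (n%:R * (n%:R + 2 * c + 1))%:P * gegen n.-1 (c + 1).
Proof.
elim: n c => [c|n IH c]; first by rewrite derivC mul0r polyC0 oppr0 mul0r.
have E : (gegen n (c + 1))^`() =
   - (n%:R * (n%:R + 2 * (c + 1) + 1))%:P * gegen n.-1 (c + 1 + 1) by exact: IH.
rewrite gegenS derivB !derivM deriv_omega derivC derivX mul0r add0r mulr1.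
have -> : (gegen n (c + 1))^`()^`() =
    - (n%:R * (n%:R + 2 * (c + 1) + 1))%:P * (gegen n.-1 (c + 1 + 1))^`().
  by rewrite E derivM derivN derivC oppr0 mul0r add0r.
(* For n = 0 the truncated index [n.-1] comes with coefficient 0; the recursion used afterwards
   needs a positive index. *)
case: n IH E => [|n] IH E.
  by rewrite E /= !mul0r polyC0 oppr0 !mul0r !mulr0 ; rewrite !add0r ?sub0r ?mulr1 ?oppr0 ?addr0; congr (- _%:P); ring.
rewrite E.
have -> : gegen n.+1 (c + 1) = omega * (gegen n (c + 1 + 1))^`() - (2 * (c + 1 + 1))%:P * 'X * gegen n (c + 1 + 1) by [].
rewrite /= -[n.+2%:R]natr1 -[n.+1%:R]natr1.
rewrite !(rmorphM, rmorphD, rmorphN, rmorph1, rmorph_nat)/=; ring.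
Qed.

End gegenbauer.

(** * Weighted integrals of the Rodrigues polynomials *)

Section gegenbauer_integrals.
Context {R : realType}.
Notation mu := (@lebesgue_measure R).
Implicit Types (p q : {poly R}) (b c d g : R).

Lemma wint_gegen_deriv c n q : 0 < c ->
  wint c (gegen n.+1 c * q) = - wint (c + 1) (gegen n (c + 1) * q^`()).
Proof.
move=> c0; have := wint_ibp (gegen n (c + 1) * q) c0.
have -> : omega * (gegen n (c + 1) * q)^`() -
    (2 * (c + 1))%:P * 'X * (gegen n (c + 1) * q) =
    gegen n.+1 c * q + omega * (gegen n (c + 1) * q^`()).
  by rewrite gegenS derivM; ring.
by rewrite wintD// wint_omega// => /eqP; rewrite addr_eq0 => /eqP.
Qed.

Lemma wint_gegen c n q : 0 < c ->
  wint c (gegen n c * q) = (-1) ^+ n * wint (c + n%:R) q^`(n).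
Proof.
elim: n c q => [|n IH] c q c0; first by rewrite mul1r addr0 mul1r derivn0.
rewrite wint_gegen_deriv// IH ?addr_gt0// -derivSn exprS mulN1r mulNr.
by rewrite -[n.+1%:R]natr1 addrAC addrA.
Qed.

(** Iterating [deriv_gegen] down to degree 0 gives the leading coefficient without expanding the
    polynomial. *)
Lemma derivn_gegen n c :
  (gegen n c)^`(n) = (n`!%:R * \prod_(k < n) - (n%:R + 2 * c + 1 + k%:R))%:P.
Proof.
elim: n c => [|n IH] c; first by rewrite derivn0 big_ord0 mulr1.
rewrite derivSn deriv_gegen -rmorphN mul_polyC derivnZ IH -mul_polyC -rmorphM.
congr (_%:P); rewrite big_ord_recl/= addr0 factS natrM.
rewrite [in RHS](eq_bigr (fun k : 'I_n => - (n%:R + 2 * (c + 1) + 1 + k%:R))).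
  by rewrite -[n.+1%:R]natr1; ring.
by move=> k _; rewrite /bump/= add1n -[n.+1%:R]natr1 -[k.+1%:R]natr1; ring.
Qed.

Lemma coef_gegen n c : (gegen n c)`_n = \prod_(k < n) - (n%:R + 2 * c + 1 + k%:R).
Proof.
have := congr1 (fun p => p`_0) (derivn_gegen n c).
rewrite coef_derivn addn0 coefC/= ffactnn => E.
have f0 : n`!%:R != 0 :> R by rewrite pnatr_eq0 -lt0n fact_gt0.
by apply: (mulfI f0); rewrite -E mulr_natl.
Qed.

Lemma size_gegen_leq n c : (size (gegen n c) <= n.+1)%N.
Proof.
elim: n c => [|n IH] c; first by rewrite size_polyC oner_eq0.
apply/leq_sizeP => -[//|k] nk.
have : (gegen n.+1 c)^`()`_k = 0.
  rewrite deriv_gegen -rmorphN coefCM nth_default ?mulr0//.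
  exact: leq_trans (IH _) _.
by rewrite coef_deriv => /eqP; rewrite mulrn_eq0 => /eqP.
Qed.

Lemma coef_gegen_gt0 n c : 0 <= c -> 0 < (-1) ^+ n * (gegen n c)`_n.
Proof.
move=> c0; rewrite coef_gegen.
have -> : (-1) ^+ n = \prod_(k < n) (-1 : R) by rewrite prodr_const card_ord.
rewrite -big_split/=; apply: prodr_gt0 => k _; rewrite mulN1r opprK.
have : 0 <= n%:R + k%:R :> R by rewrite addr_ge0.
lra.
Qed.

Lemma size_gegen n c : 0 <= c -> size (gegen n c) = n.+1.
Proof.
move=> c0; apply/eqP; rewrite eqn_leq size_gegen_leq/= ltnNge; apply/negP.
move=> /(nth_default 0) E; have := coef_gegen_gt0 n c0.
by rewrite E mulr0 ltxx.
Qed.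

Lemma wint1 d : 0 < d ->
  wint d 1 = Num.sqrt pi * Gamma (d + 1) / Gamma (d + 3 / 2).
Proof.
move=> d0; rewrite -(has_intE (has_int_one_sub_sqr_powR d0)).
by apply: eq_Rintegral => x _; rewrite hornerC mulr1.
Qed.

(** The form of the total mass without sqrt(pi), which is the one matching the Jacobi
    normalisation. *)
Lemma wint1_dup b : 0 < b ->
  wint b 1 = 2 `^ (2 * b + 1) * Gamma (b + 1) ^+ 2 / Gamma (2 * b + 2).
Proof.
move=> b0; have b20 : 0 < 2 * b + 2 by lra.
have -> : wint b 1 = \int[mu]_(x in `]-1, 1[) (1 - x ^+ 2) `^ b.
  by apply: eq_Rintegral => x _; rewrite hornerC mulr1.
have := Gamma_sqr b0 => ->.
have -> : 2^-1 `^ (2 * b + 1) = (2 `^ (2 * b + 1))^-1 :> R.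
  by rewrite -powRN -mulN1r powRrM powR_inv1.
by field; rewrite !gt_eqF ?powR_gt0// Gamma_gt0.
Qed.

Lemma wint_gegen_small c n q : 0 < c -> (size q <= n)%N -> wint c (gegen n c * q) = 0.
Proof.
move=> c0 qn; rewrite wint_gegen// derivn_poly0//.
by rewrite -(scale0r 0) wintZ ?mul0r ?mulr0// ltr_wpDr.
Qed.

(** Stated for reciprocals so that z may be a pole, as happens in the mass entries. *)
Lemma rGammaD n (z : R) :
  (\prod_(k < n) (z + k%:R)) / Gamma (z + n%:R) = (Gamma z)^-1.
Proof.
elim: n => [|n IH]; first by rewrite big_ord0 mul1r addr0.
rewrite big_ord_recr/= -IH -mulrA; congr (_ * _).
by rewrite -natr1 addrA [in RHS]rGammaS.
Qed.

Lemma GammaD n (z : R) : 0 < z -> \prod_(k < n) (z + k%:R) = Gamma (z + n%:R) / Gamma z.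
Proof.
move=> z0; rewrite -(rGammaD n z) mulrCA divff ?mulr1//.
by rewrite gt_eqF// Gamma_gt0// ltr_wpDr.
Qed.

(** Moving n derivatives onto the second factor leaves its constant n-th derivative against the
    weight of exponent c + n. *)
Lemma wint_gegen_norm c n : 0 < c ->
  wint c (gegen n c * gegen n c) =
  n`!%:R * 2 `^ (2 * (c + n%:R) + 1) * Gamma (n%:R + c + 1) ^+ 2
   / ((2 * n%:R + 2 * c + 1) * Gamma (n%:R + 2 * c + 1)).
Proof.
move=> c0; have n0 : 0 <= n%:R :> R by [].
have cn0 : 0 < c + n%:R by rewrite ltr_wpDr.
rewrite wint_gegen// derivn_gegen -[_%:P]mulr1 wintC//.
have -> : \prod_(k < n) - (n%:R + 2 * c + 1 + k%:R) =
    (-1) ^+ n * \prod_(k < n) (n%:R + 2 * c + 1 + k%:R).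
  have -> : (-1) ^+ n = \prod_(k < n) (-1 : R) by rewrite prodr_const card_ord.
  by rewrite -big_split/=; apply: eq_bigr => k _; rewrite mulN1r.
rewrite GammaD; last by lra.
rewrite wint1_dup//.
have -> : 2 * (c + n%:R) + 2 = 2 * n%:R + 2 * c + 1 + 1 by ring.
rewrite (@GammaS _ (2 * n%:R + 2 * c + 1)); last by lra.
have -> : n%:R + 2 * c + 1 + n%:R = 2 * n%:R + 2 * c + 1 by ring.
have -> : c + n%:R + 1 = n%:R + c + 1 by ring.
have G1 : 0 < Gamma (2 * n%:R + 2 * c + 1) by apply: Gamma_gt0; lra.
have G2 : 0 < Gamma (n%:R + 2 * c + 1) by apply: Gamma_gt0; lra.
(* [field] does not know that the square of a sign is 1, so the target is multiplied by e * e
   beforehand. *)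
set e := (-1) ^+ n; set Y := RHS; have ee : e * e = 1 by rewrite /e -expr2 sqrr_sign.
transitivity (e * e * Y); last by rewrite ee mul1r.
rewrite /Y; field; rewrite !gt_eqF//; lra.
Qed.

(** The total derivative of (1 - x^2)^(b + 1) [gegen i (b + 1)] times (1 - x^2)^c [gegen j c]
    integrates to 0, and each term of the product rule is a Rodrigues step. The parameters move in
    opposite directions, so the exponent b + c of the weight is preserved even when c - 1 becomes
    negative. *)
Lemma wint_gegen_shift b c i j : 0 < b + c ->
  wint (b + c) (gegen i.+1 b * gegen j c) =
  - wint (b + c) (gegen i (b + 1) * gegen j.+1 (c - 1)).
Proof.
move=> d0; have := wint_ibp (gegen i (b + 1) * gegen j c) d0.
have -> : omega * (gegen i (b + 1) * gegen j c)^`() -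
    (2 * (b + c + 1))%:P * 'X * (gegen i (b + 1) * gegen j c) =
    gegen i.+1 b * gegen j c + gegen i (b + 1) * gegen j.+1 (c - 1).
  rewrite !gegenS subrK derivM !(rmorphM, rmorphD, rmorphN, rmorph1, rmorph_nat)/=; ring.
by rewrite wintD// => /eqP; rewrite addr_eq0 => /eqP.
Qed.

(* All derivatives of the first Rodrigues factor are moved onto the second one. *)
Lemma wint_gegen_gegen b c i j : 0 < b + c ->
  wint (b + c) (gegen i b * gegen j c) =
  (-1) ^+ i * wint (b + c) (gegen (i + j) (c - i%:R)).
Proof.
elim: i b c j => [|i IH] b c j d0; first by rewrite !mul1r subr0.
rewrite wint_gegen_shift//.
have E : b + c = (b + 1) + (c - 1) by ring.
rewrite E IH; last by rewrite -E.
rewrite exprS mulN1r mulNr addnS addSn -[i.+1%:R]natr1; congr (- (_ * wint _ (gegen _ _))); ring.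
Qed.

(** Integration by parts turns the term in x G of the recursion into the term in omega G', leaving
    the factor 1 - (g + 1) / (d + 1) = (d - g) / (d + 1); then G' is lowered by [deriv_gegen]. At m
    = 0 the coefficient m makes the right side vanish. *)
Lemma wint_gegenSS d g m : 0 < d ->
  wint d (gegen m.+1 g) =
  - ((d - g) / (d + 1)) * (m%:R * (m%:R + 2 * g + 3)) * wint (d + 1) (gegen m.-1 (g + 2)).
Proof.
move=> d0; have := wint_ibp (gegen m (g + 1)) d0.
have d10 : 0 < d + 1 by rewrite addr_gt0.
set G := gegen m (g + 1).
have E : wint d (omega * G^`()) = - (m%:R * (m%:R + 2 * g + 3)) * wint (d + 1) (gegen m.-1 (g + 2)).
  rewrite wint_omega// /G deriv_gegen -rmorphN wintC//.
  have -> : g + 1 + 1 = g + 2 by ring.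
  by have -> : m%:R + 2 * (g + 1) + 1 = m%:R + 2 * g + 3 by ring.
have -> : omega * G^`() - (2 * (d + 1))%:P * 'X * G = omega * G^`() + (- (2 * (d + 1)))%:P * ('X * G).
  by rewrite rmorphN; ring.
rewrite wintD// wintC// => /eqP; rewrite addr_eq0 => /eqP F.
rewrite gegenS -/G.
have -> : omega * G^`() - (2 * (g + 1))%:P * 'X * G = omega * G^`() + (- (2 * (g + 1)))%:P * ('X * G).
  by rewrite rmorphN; ring.
rewrite wintD// wintC//.
have -> : wint d ('X * G) = wint d (omega * G^`()) / (2 * (d + 1)).
  rewrite F; field; lra.
rewrite E; field; lra.
Qed.

Lemma wint_gegen_odd d g n : 0 < d -> wint d (gegen n.*2.+1 g) = 0.
Proof.
elim: n d g => [|n IH] d g d0; first by rewrite wint_gegenSS// mul0r mulr0 mul0r.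
by rewrite doubleS wint_gegenSS//= IH ?mulr0// addr_gt0.
Qed.

(** Each use of the recurrence replaces d by d + 1 and g by g + 2, so d - g falls by 1 and feeds the
    first product. The factor m (m + 2 g + 3) with m = 2 n + 1 splits into 2 (2 n + 1), the growth
    of (2 n)! / n!, and n + g + 2, the new head of the second product. *)
Lemma wint_gegen_even d g n : 0 < d ->
  wint d (gegen n.*2 g) = (-1) ^+ n * (n.*2)`!%:R / n`!%:R *
    \prod_(k < n) (d - g - k%:R) * \prod_(k < n) (n%:R + g + 1 + k%:R) *
    (Num.sqrt pi * Gamma (d + 1) / Gamma (d + n%:R + 3 / 2)).
Proof.
elim: n d g => [|n IH] d g d0.
  by rewrite !big_ord0 !mul1r invr1 !mulr1 mul1r addr0 wint1.
have d10 : 0 < d + 1 by rewrite addr_gt0.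
rewrite doubleS wint_gegenSS//= IH// !big_ord_recl/= subr0 addr0.
have -> : \prod_(i < n) (d - g - (bump 0 i)%:R) = \prod_(k < n) (d + 1 - (g + 2) - k%:R).
  by apply: eq_bigr => k _; rewrite /bump/= add1n -[k.+1%:R]natr1; ring.
have -> : \prod_(i < n) (n.+1%:R + g + 1 + (bump 0 i)%:R) = \prod_(k < n) (n%:R + (g + 2) + 1 + k%:R).
  by apply: eq_bigr => k _; rewrite /bump/= add1n -[k.+1%:R]natr1 -[n.+1%:R]natr1; ring.
have -> : d + 1 + n%:R + 3 / 2 = d + n.+1%:R + 3 / 2 by rewrite -natr1; ring.
rewrite (GammaS d10) !factS !natrM -[n.*2.+2%:R]natr1 -[n.*2.+1%:R]natr1 -[n.+1%:R]natr1.
rewrite -mul2n natrM exprS.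
have F0 : n`!%:R != 0 :> R by rewrite pnatr_eq0 -lt0n fact_gt0.
have n1 : n%:R + 1 != 0 :> R by rewrite natr1 pnatr_eq0.
have G0 : Gamma (d + (n%:R + 1) + 3 / 2) != 0.
  have n0 : 0 <= n%:R :> R by [].
  by rewrite gt_eqF// Gamma_gt0//; lra.
have d1 : d + 1 != 0 by rewrite gt_eqF.
by field; rewrite F0 n1 G0.
Qed.

End gegenbauer_integrals.

(** * Identification of the Jacobi sequence *)

Section jacobi.
Context {R : realType}.
Notation mu := (@lebesgue_measure R).
Implicit Types (p q : {poly R}) (a : R).

Let jnorm a n : R := 2 `^ (2 * a + 1) / (2 * n%:R + 2 * a + 1)
            * (Gamma (n%:R + a + 1) ^+ 2
               / (n`!%:R * Gamma (n%:R + 2 * a + 1))).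

Let is_jacobiE a (P : nat -> {poly R}) : is_jacobi a P <->
  [/\ forall n, size (P n) = n.+1, forall n, 0 < lead_coef (P n) &
    forall n m, wint a (P n * P m) = (n == m)%:R * jnorm a n].
Proof.
have E p q : wint a (p * q) = \int[mu]_(x in `]-1, 1[) (p.[x] * q.[x] * (1 - x ^+ 2) `^ a).
  by apply: eq_Rintegral => x _; rewrite hornerM mulrC.
by split=> -[H1 H2 H3]; split => // n m; rewrite ?E// -?E H3.
Qed.

Let jnorm_gt0 a n : 0 < a -> 0 < jnorm a n.
Proof.
move=> a0; have n0 : 0 <= n%:R :> R by [].
rewrite /jnorm mulr_gt0// divr_gt0 ?powR_gt0//; first by lra.
  by rewrite exprn_gt0// Gamma_gt0//; lra.
by rewrite mulr_gt0 ?ltr0n ?fact_gt0// Gamma_gt0//; lra.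
Qed.

(** The classical constant of Rodrigues' formula; the sign compensates the n negative factors of the
    leading coefficient of [gegen]. *)
Definition gegen_jacobi a n : {poly R} := ((-1) ^+ n / (2 ^+ n * n`!%:R)) *: gegen n a.

Lemma is_jacobi_gegen a : 0 < a -> is_jacobi a (gegen_jacobi a).
Proof.
move=> a0; have a0' := ltW a0; apply/is_jacobiE.
have D n : 0 < 2 ^+ n * n`!%:R :> R by rewrite mulr_gt0 ?exprn_gt0 ?ltr0n ?fact_gt0.
have k0 n : (-1) ^+ n / (2 ^+ n * n`!%:R) != 0 :> R.
  by rewrite mulf_neq0 ?signr_eq0// invr_eq0 gt_eqF.
split => [n|n|n m].
- by rewrite size_scale// size_gegen.
- rewrite /gegen_jacobi lead_coefZ lead_coefE size_gegen//= mulrAC.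
  by rewrite divr_gt0 ?coef_gegen_gt0.
have E i j : wint a (gegen_jacobi a i * gegen_jacobi a j) =
  (-1) ^+ i / (2 ^+ i * i`!%:R) * ((-1) ^+ j / (2 ^+ j * j`!%:R)) * wint a (gegen i a * gegen j a).
  by rewrite -scalerAl -scalerAr !wintZ// mulrA.
have [<-|nm] := eqVneq n m; last first.
  rewrite mul0r E; suff -> : wint a (gegen n a * gegen m a) = 0 by rewrite mulr0.
  case: ltngtP nm => // nm _; last by rewrite wint_gegen_small ?size_gegen.
  by rewrite mulrC wint_gegen_small ?size_gegen.
rewrite E mul1r wint_gegen_norm// /jnorm.
have n0 : 0 <= n%:R :> R by [].
have G1 : 0 < Gamma (n%:R + 2 * a + 1) by apply: Gamma_gt0; lra.
have -> : 2 `^ (2 * (a + n%:R) + 1) = 2 ^+ n * 2 ^+ n * 2 `^ (2 * a + 1) :> R.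
  have -> : 2 * (a + n%:R) + 1 = n%:R + n%:R + (2 * a + 1) by ring.
  by rewrite !powRD ?pnatr_eq0 ?implybT// !powR_mulrn.
set e := (-1) ^+ n; set Y := RHS; have ee : e * e = 1 by rewrite /e -expr2 sqrr_sign.
transitivity (e * e * Y); last by rewrite ee mul1r.
have F0 : n`!%:R != 0 :> R by rewrite pnatr_eq0 -lt0n fact_gt0.
have H2 : 2 ^+ n != 0 :> R by rewrite expf_neq0.
by rewrite /Y; field; rewrite F0 H2 !gt_eqF//; lra.
Qed.

Let basis (Q : nat -> {poly R}) n p : (forall k, size (Q k) = k.+1) -> (size p <= n)%N ->
  exists c : nat -> R, p = \sum_(k < n) c k *: Q k.
Proof.
move=> sQ; elim: n p => [|n IH] p sp.
  exists (fun=> 0); rewrite big_ord0; apply/eqP; by rewrite -size_poly_leq0.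
have lQ : (Q n)`_n != 0.
  by have := sQ n; move=> s; rewrite -[n in X in _`_X]/(n.+1.-1) -{1}s -lead_coefE lead_coef_eq0 -size_poly_eq0 s.
have [c cE] : exists c : nat -> R, p - (p`_n / (Q n)`_n) *: Q n = \sum_(k < n) c k *: Q k.
  apply: IH; apply/leq_sizeP => k; rewrite leq_eqVlt => /predU1P[<-|nk].
    by rewrite coefB coefZ divfK// subrr.
  rewrite coefB coefZ [p`_k]nth_default; last exact: leq_trans sp nk.
  by rewrite [(Q n)`_k]nth_default ?sQ// mulr0 subrr.
exists (fun k => if k == n then p`_n / (Q n)`_n else c k).
rewrite big_ord_recr/= eqxx -[LHS](subrK ((p`_n / (Q n)`_n) *: Q n)) cE; congr (_ + _).
by apply: eq_bigr => k _; rewrite (ltn_eqF (ltn_ord k)).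
Qed.

(** By strong induction: after matching leading terms, P n - c Q n has lower degree and is
    orthogonal to every Q k with k < n, hence is 0. Equal norms give c^2 = 1, and positive leading
    coefficients exclude c = -1. *)
Lemma is_jacobi_unique a P Q : 0 < a -> is_jacobi a P -> is_jacobi a Q -> P = Q.
Proof.
move=> a0 /is_jacobiE[sP lP nP] /is_jacobiE[sQ lQ nQ].
apply/funext => n; elim/ltn_ind: n => n IH.
pose c := lead_coef (P n) / lead_coef (Q n).
have c0 : 0 < c by rewrite divr_gt0.
have sr : (size (P n - c *: Q n)%R <= n)%N.
  apply/leq_sizeP => k; rewrite leq_eqVlt => /predU1P[<-|nk].
    rewrite coefB coefZ; have := lP n; have := lQ n.
    by rewrite /c !lead_coefE sP sQ /= => q0 _; rewrite divfK ?subrr// gt_eqF.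
  by rewrite coefB coefZ [(P n)`_k]nth_default ?sP// [(Q n)`_k]nth_default ?sQ// mulr0 subrr.
have [b bE] := basis sQ sr.
have b0 k : (k < n)%N -> b k = 0.
  move=> kn; have : wint a ((P n - c *: Q n) * Q k) = 0.
    rewrite mulrBl wintD// wintN// -scalerAl wintZ// nQ -IH// nP gtn_eqF//.
    by rewrite !mul0r mulr0 subr0.
  rewrite bE mulr_suml wint_sum// (bigD1 (Ordinal kn))//= big1 => [|l lk].
    rewrite addr0 -scalerAl wintZ// nQ eqxx mul1r => /eqP.
    by rewrite mulf_eq0 (gt_eqF (jnorm_gt0 k a0)) orbF => /eqP.
  rewrite -scalerAl wintZ// nQ (_ : (l == k :> nat) = false) ?mul0r ?mulr0//.
  by apply/negbTE; apply: contraNneq lk => lk; apply/eqP/val_inj.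
have PQ : P n = c *: Q n.
  apply/eqP; rewrite -subr_eq0 bE big1// => k _.
  by rewrite b0// scale0r.
have := nP n n; rewrite PQ -scalerAl -scalerAr !wintZ// nQ eqxx !mul1r mulrA => /eqP.
rewrite -subr_eq0 -[X in _ - X]mul1r -mulrBl mulf_eq0 (gt_eqF (jnorm_gt0 n a0)) orbF.
rewrite subr_eq0 -expr2 sqrf_eq1 => /orP[/eqP->|/eqP cN]; first by rewrite scale1r.
by move: c0; rewrite cN oppr_gt0 ltr10.
Qed.

Lemma jacobiE a : 0 < a -> jacobi a = gegen_jacobi a.
Proof.
move=> a0; have J := is_jacobi_gegen a0.
rewrite /jacobi; case: xgetP => [P _ JP|/(_ _ J)//].
exact: is_jacobi_unique JP J.
Qed.

End jacobi.

(** * Mass matrix *)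

Section mass.
Context {R : realType}.
Notation mu := (@lebesgue_measure R).
Implicit Types (p q : {poly R}) (a : R).

(** The normalisation of [phi] times the constant of Rodrigues' formula; the factorials cancel. *)
Definition phi_coef a n : R :=
  (-1) ^+ n * Num.sqrt (2 * n%:R + 2 * a + 1) /
  (2 ^+ n * 2 `^ (a + 2^-1) * Gamma (n%:R + a + 1)).

Lemma phiE a n x : 0 < a ->
  phi a n x = (phi_coef a n * ((1 - x ^+ 2) `^ a * (gegen n a).[x]))%:C.
Proof.
move=> a0; rewrite /phi jacobiE// /gegen_jacobi hornerZ /phi_coef; congr (_%:C).
have F0 : n`!%:R != 0 :> R by rewrite pnatr_eq0 -lt0n fact_gt0.
have H2 : 2 ^+ n != 0 :> R by rewrite expf_neq0.
have P0 : 2 `^ (a + 2^-1) != 0 :> R by rewrite gt_eqF// powR_gt0.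
have n0 : 0 <= n%:R :> R by [].
have G0 : Gamma (n%:R + a + 1) != 0 by rewrite gt_eqF// Gamma_gt0//; lra.
by field; rewrite F0 H2 P0 G0.
Qed.

(** Descending counterpart of [rGammaD]: if w - n + 1 is a pole and w + 1 is not, the product
    contains the factor 0. *)
Lemma rGammaB n (w : R) :
  (\prod_(k < n) (w - k%:R)) / Gamma (w + 1) = (Gamma (w - n%:R + 1))^-1.
Proof.
elim: n => [|n IH]; first by rewrite big_ord0 mul1r subr0.
rewrite big_ord_recr/= mulrAC IH mulrC.
have -> : w - n.+1%:R + 1 = w - n%:R by rewrite -natr1; ring.
by rewrite -rGammaS.
Qed.

Lemma mass_wint a i j : 0 < a ->
  mass a i j = (phi_coef a i * phi_coef a j * wint (2 * a) (gegen i a * gegen j a))%:C.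
Proof.
move=> a0; have a20 : 0 < 2 * a by rewrite mulr_gt0.
have mi1 : measurable (`]-1, 1[%classic : set (measurableTypeR R)) by exact: measurable_itv.
have H := has_intZ (phi_coef a i * phi_coef a j) mi1 (has_int_wint (gegen i a * gegen j a) a20).
have E (x : R) : x \in (`]-1, 1[%classic : set R) -> phi a j x * (phi a i x)^* =
    (phi_coef a i * phi_coef a j * ((1 - x ^+ 2) `^ (2 * a) * (gegen i a * gegen j a).[x]))%:C.
  rewrite inE/= in_itv/= => /andP[x1 x2].
  have w0 := one_sub_sqr_gt0 x1 x2.
  rewrite !phiE//; apply/eqP; rewrite eq_complex/= oppr0 !mulr0 !mul0r subr0 addr0 eqxx andbT.
  apply/eqP; rewrite hornerM mulrDl mul1r powRD ?(gt_eqF w0) ?implybT//.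
  ring.
rewrite /mass /inner /cintegral -(has_intE H) -[RHS]/(_ +i* 0); congr (_ +i* _).
  by apply: eq_Rintegral => x xi; rewrite E.
transitivity (\int[mu]_(x in `]-1, 1[) (0 : R)).
  by apply: eq_Rintegral => x xi; rewrite E.
by rewrite Rintegral_cst// mul0r.
Qed.

Lemma massE a i j : 0 < a ->
  mass a i j = (if ~~ odd (i + j) then
       (-1) ^ ((j%:Z - i%:Z) %/ 2)%Z
       * Num.sqrt (pi * (2 * i%:R + 2 * a + 1) * (2 * j%:R + 2 * a + 1))
       * Gamma (2 * a + 1) * (i + j)`!%:R
       / (2 `^ (2 * a + i%:R + j%:R + 1)
          * Gamma (2 * a + (i%:R + j%:R) / 2 + 3 / 2)
          * Gamma (a + (i%:R - j%:R) / 2 + 1)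
          * Gamma (a + (j%:R - i%:R) / 2 + 1)
          * ((i + j)./2)`!%:R)
     else 0)%:C.
Proof.
move=> a0; have a20 : 0 < 2 * a by rewrite mulr_gt0.
have i0 : 0 <= i%:R :> R by []. have j0 : 0 <= j%:R :> R by [].
rewrite mass_wint//; congr (_%:C).
(* The exponent is split as b + c with b = c = a; the derivatives then accumulate on parameter g = a
   - i, against the weight exponent d = 2 a. *)
have -> : 2 * a = a + a by ring.
rewrite wint_gegen_gegen ?addr_gt0//; have -> : a + a = 2 * a by ring.
have := odd_double_half (i + j); case: ifPn => [/negbTE->|/negbNE->]; last first.
  by rewrite add1n => <-; rewrite wint_gegen_odd// !mulr0.
rewrite add0n; set n := (i + j)./2 => nE.
have nR : i%:R + j%:R = 2 * n%:R :> R by rewrite -natrD -nE -mul2n natrM.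
rewrite -nE wint_gegen_even//.
have -> : (i%:R + j%:R) / 2 = n%:R :> R by rewrite nR; field.
have -> : (i%:R - j%:R) / 2 = i%:R - n%:R :> R.
  by have -> : n%:R = (i%:R + j%:R) / 2 :> R; [rewrite nR|]; field.
have -> : (j%:R - i%:R) / 2 = n%:R - i%:R :> R.
  by have -> : n%:R = (i%:R + j%:R) / 2 :> R; [rewrite nR|]; field.
(* Here d - g = a + i. The denominator may be Gamma at a pole, in which case the product has a zero
   factor and the quotient is 0 by convention. *)
have P1 : \prod_(k < n) (2 * a - (a - i%:R) - k%:R) =
    Gamma (i%:R + a + 1) / Gamma (a + (i%:R - n%:R) + 1).
  have -> : a + (i%:R - n%:R) + 1 = (2 * a - (a - i%:R)) - n%:R + 1 by ring.
  rewrite -rGammaB; have -> : 2 * a - (a - i%:R) = i%:R + a by ring.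
  by rewrite mulrCA divff ?mulr1// gt_eqF// Gamma_gt0//; lra.
have P2 : \prod_(k < n) (n%:R + (a - i%:R) + 1 + k%:R) =
    Gamma (j%:R + a + 1) / Gamma (a + (n%:R - i%:R) + 1).
  have -> : a + (n%:R - i%:R) + 1 = n%:R + (a - i%:R) + 1 by ring.
  rewrite -(rGammaD n).
  have -> : n%:R + (a - i%:R) + 1 + n%:R = j%:R + a + 1.
    by have -> : j%:R = 2 * n%:R - i%:R :> R; [rewrite -nR|]; ring.
  by rewrite mulrCA divff ?mulr1// gt_eqF// Gamma_gt0//; lra.
rewrite P1 P2.
(* The exponent (j - i) / 2 equals n - i and may be negative; as -1 is its own inverse, it becomes a
   product of natural powers. *)
have -> : (-1) ^ ((j%:Z - i%:Z) %/ 2)%Z = (-1) ^+ n * (-1) ^+ i :> R.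
  have -> : (j%:Z - i%:Z = (n%:Z - i%:Z) * 2)%R by lia.
  by rewrite mulzK// expfzDr ?oppr_eq0 ?oner_eq0// -exprnP -exprz_inv invrN invr1 -exprnP.
have -> : Num.sqrt (pi * (2 * i%:R + 2 * a + 1) * (2 * j%:R + 2 * a + 1)) =
   Num.sqrt pi * Num.sqrt (2 * i%:R + 2 * a + 1) * Num.sqrt (2 * j%:R + 2 * a + 1) :> R.
  have p0 := @pi_ge0 R.
  by rewrite !sqrtrM// ?mulr_ge0//; lra.
have -> : 2 `^ (2 * a + i%:R + j%:R + 1) = 2 ^+ i * 2 ^+ j * (2 `^ (a + 2^-1) * 2 `^ (a + 2^-1)) :> R.
  have -> : 2 * a + i%:R + j%:R + 1 = i%:R + j%:R + ((a + 2^-1) + (a + 2^-1)) by field.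
  by rewrite !powRD ?pnatr_eq0 ?implybT// !powR_mulrn.
rewrite /phi_coef.
set gi := Gamma (i%:R + a + 1); set gj := Gamma (j%:R + a + 1).
have gi0 : gi != 0 by rewrite gt_eqF// Gamma_gt0//; lra.
have gj0 : gj != 0 by rewrite gt_eqF// Gamma_gt0//; lra.
have I2 : 2 ^+ i != 0 :> R by rewrite expf_neq0.
have J2 : 2 ^+ j != 0 :> R by rewrite expf_neq0.
have Q0 : 2 `^ (a + 2^-1) != 0 :> R by rewrite gt_eqF// powR_gt0.
have -> : (-1) ^+ j = (-1) ^+ i :> R.
  by rewrite -[LHS]signr_odd -[RHS]signr_odd; have := congr1 odd nE; rewrite odd_double oddD; case: (odd i); case: (odd j).
rewrite !invfM -!/gi -!/gj.
(* The first two reciprocals may be taken at poles, so no nonvanishing condition can be supplied for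
   them: [field] has to see atoms. *)
move: ((Gamma (a + (i%:R - n%:R) + 1))^-1) ((Gamma (a + (n%:R - i%:R) + 1))^-1)
  ((Gamma (2 * a + n%:R + 3 / 2))^-1) ((n`!%:R)^-1) => r1 r2 r3 r4.
set e := (-1) ^+ i; set Y := RHS.
have ee : e * e = 1 by rewrite /e -expr2 sqrr_sign.
transitivity (e * e * Y); last by rewrite ee mul1r.
by rewrite /Y; field; rewrite gi0 gj0 I2 J2 Q0.
Qed.

End mass.

(** * Bessel series and Weber integrals *)

Section cauchy_product.
Context {R : realType}.
Implicit Types (u v : R^nat).

Definition cauchy_conv u v : R^nat := fun n => \sum_(k < n.+1) u k * v (n - k)%N.

(** A partial sum is the value at 1 of a polynomial. The product of two partial sums then splits
    into coefficients below N, which are those of the convolution, and a tail. *)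
Let trunc u N : {poly R} := \poly_(i < N) u i.

Let horner_trunc u N : (trunc u N).[1] = series u N.
Proof.
rewrite horner_poly /series/= big_mkord.
by apply: eq_bigr => i _; rewrite expr1n mulr1.
Qed.

Let coef_truncM u v N n :
  (trunc u N * trunc v N)`_n =
  \sum_(k < n.+1) (if (k < N)%N && (n - k < N)%N then u k * v (n - k)%N else 0).
Proof.
rewrite coefM; apply: eq_bigr => k _; rewrite !coef_poly.
by case: ifPn; case: ifPn; rewrite /= ?mulr0 ?mul0r.
Qed.

Let series_mul u v N :
  series u N * series v N = \sum_(n < N + N) (trunc u N * trunc v N)`_n.
Proof.
rewrite -!horner_trunc -hornerM (@horner_coef_wide _ (N + N)).
  by apply: eq_bigr => i _; rewrite expr1n mulr1.
apply: leq_trans (size_polyMleq _ _) _.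
apply: leq_trans (leq_pred _) _; apply: leq_add; exact: size_poly.
Qed.

Let coef_truncM_low u v N n : (n < N)%N -> (trunc u N * trunc v N)`_n = cauchy_conv u v n.
Proof.
move=> nN; rewrite coef_truncM; apply: eq_bigr => k _.
have := ltn_ord k; rewrite ltnS => kn.
by rewrite (leq_ltn_trans kn nN) (leq_ltn_trans (leq_subr _ _) nN).
Qed.

Let series_mul_conv u v N : series u N * series v N =
  series (cauchy_conv u v) N + \sum_(i < N) (trunc u N * trunc v N)`_(N + i).
Proof.
rewrite series_mul big_split_ord/=; congr (_ + _).
rewrite /series/= big_mkord; apply: eq_bigr => n _.
exact: coef_truncM_low.
Qed.

Let nu u := fun n => `|u n|.

Let nuM_ge0 u v k l : 0 <= nu u k * nu v l.
Proof. by apply: mulr_ge0; exact: normr_ge0. Qed.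

Let norm_coef u v N n :
  `|(trunc u N * trunc v N)`_n| <= (trunc (nu u) N * trunc (nu v) N)`_n.
Proof.
rewrite !coef_truncM; apply: le_trans (ler_norm_sum _ _ _) _.
by apply: ler_sum => k _; case: ifPn => _; rewrite ?normr0// normrM.
Qed.

Let conv_ge0 u v n : 0 <= cauchy_conv (nu u) (nu v) n.
Proof. by apply: sumr_ge0 => k _; exact: nuM_ge0. Qed.

Let coef_le_conv u v N n :
  (trunc (nu u) N * trunc (nu v) N)`_n <= cauchy_conv (nu u) (nu v) n.
Proof.
rewrite coef_truncM; apply: ler_sum => k _.
by case: ifPn => // _; exact: nuM_ge0.
Qed.

(** The product of partial sums differs from the partial sum of the convolution by the tail of
    coefficients from N on, which is bounded by the same tail for absolute values. That tail tends
    to 0 because [Q N] lies between the products of partial sums of absolute values at M and at N,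
    as soon as 2 M <= N. *)
Lemma cvg_cauchy_product u v (U V : R) :
  cvgn (series (fun n => `|u n|)) -> cvgn (series (fun n => `|v n|)) ->
  series u @ \oo --> U -> series v @ \oo --> V ->
  series (cauchy_conv u v) @ \oo --> U * V.
Proof.
move=> cu cv uU vV.
pose Un := limn (series (nu u)); pose Vn := limn (series (nu v)).
have cP : (fun N => series (nu u) N * series (nu v) N) @ \oo --> Un * Vn.
  by apply: cvgM; [exact: cu|exact: cv].
pose Q N := series (cauchy_conv (nu u) (nu v)) N.
have QP N : Q N <= series (nu u) N * series (nu v) N.
  rewrite series_mul_conv lerDl; apply: sumr_ge0 => i _.
  by rewrite coef_truncM sumr_ge0// => k _; case: ifPn => // _; exact: nuM_ge0.
have PQ M N : (M + M <= N)%N -> series (nu u) M * series (nu v) M <= Q N.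
  move=> MN; rewrite series_mul /Q /series/= big_mkord.
  apply: le_trans (_ : \sum_(n < M + M) cauchy_conv (nu u) (nu v) n <= _).
    by apply: ler_sum => n _; exact: coef_le_conv.
  rewrite -[leLHS](big_mkord xpredT) -[leRHS](big_mkord xpredT).
  rewrite [leRHS](big_cat_nat (leq0n _) MN)//= lerDl.
  by apply: sumr_ge0 => n _; exact: conv_ge0.
have ndm (w : R^nat) M N : (M <= N)%N -> series (nu w) M <= series (nu w) N.
  move=> MN; rewrite /series/= [leRHS](big_cat_nat (leq0n _) MN)//= lerDl.
  by apply: sumr_ge0 => n _; rewrite /nu.
have s0 (w : R^nat) M : 0 <= series (nu w) M by apply: sumr_ge0 => n _; rewrite /nu.
have cQ : Q @ \oo --> Un * Vn.
  have PU N : series (nu u) N * series (nu v) N <= Un * Vn.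
    apply: ler_pM => //; apply: nondecreasing_cvgn_le => //.
      by move=> m n; exact: ndm.
    by move=> m n; exact: ndm.
  apply/cvgrPdist_le => e e0.
  have /cvgrPdist_le/(_ e e0)[M _ HM] := cP.
  exists (M + M)%N => // N /= MN.
  rewrite ger0_norm; last by rewrite subr_ge0 (le_trans (QP N)).
  apply: le_trans (_ : Un * Vn - series (nu u) M * series (nu v) M <= _).
    by rewrite lerD2l lerN2 PQ.
  by apply: le_trans (ler_norm _) (HM M _) => /=.
have cD : (fun N => series (nu u) N * series (nu v) N - Q N) @ \oo --> (0 : R).
  by rewrite -(subrr (Un * Vn)); apply: cvgB.
have cE : (fun N => series u N * series v N - series (cauchy_conv u v) N) @ \oo --> (0 : R).
  apply/cvgr0Pnorm_le => e e0; near=> N.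
  apply: (@le_trans _ _ `|series (nu u) N * series (nu v) N - Q N|); last first.
    by near: N; move/cvgr0Pnorm_le : cD; exact.
  rewrite !series_mul_conv /Q -/(nu u) -/(nu v) [X in `|X|]addrC addKr [X in _ <= `|X|]addrC addKr.
  rewrite [leRHS]ger0_norm; last first.
    apply: sumr_ge0 => i _.
    by rewrite coef_truncM sumr_ge0// => k _; case: ifPn => // _; exact: nuM_ge0.
  apply: le_trans (ler_norm_sum _ _ _) _.
  by apply: ler_sum => i _; exact: norm_coef.
have -> : series (cauchy_conv u v) = (fun N => series u N * series v N - (series u N * series v N - series (cauchy_conv u v) N)).
  by apply/funext => N; rewrite subKr.
by rewrite -[U * V]subr0; apply: cvgB => //; apply: cvgM.
Unshelve. all: by end_near. Qed.

End cauchy_product.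

(** * Bessel series and their products *)

Section bessel.
Context {R : realType}.
Notation RM := (measurableTypeR R).

Definition ffact (n : nat) (x : R) := \prod_(i < n) (x - i%:R).

(** Generalised binomials e satisfy (m + 1) e (m + 1) z = (z - m) e m z. In the induction x + y - n
    is split as (x - (n - k)) + (y - k), each part raises one of the two indices, and the weights n
    + 1 - k and k add up to n + 1. *)
Lemma vandermonde (x y : R) n :
  \sum_(k < n.+1) ffact (n - k) x / (n - k)`!%:R * (ffact k y / k`!%:R) =
  ffact n (x + y) / n`!%:R.
Proof.
pose e m (z : R) := ffact m z / m`!%:R.
have eS m z : m.+1%:R * e m.+1 z = (z - m%:R) * e m z.
  rewrite /e /ffact big_ord_recr/= factS natrM.
  have F0 : m`!%:R != 0 :> R by rewrite pnatr_eq0 -lt0n fact_gt0.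
  have m0 : m.+1%:R != 0 :> R by rewrite pnatr_eq0.
  by field; rewrite F0 nat1r m0.
suff H m : \sum_(k < m.+1) e (m - k)%N x * e k y = e m (x + y) by exact: H.
elim: m => [|{}n IH].
  by rewrite big_ord1 /e /ffact !big_ord0 !fact0 !divr1 mulr1.
apply: (@mulfI _ n.+1%:R); first by rewrite pnatr_eq0.
rewrite eS -IH [RHS]mulr_sumr.
have -> : \sum_(k < n.+1) (x + y - n%:R) * (e (n - k)%N x * e k y) =
   \sum_(k < n.+1) (n.+1 - k)%:R * (e (n.+1 - k)%N x * e k y) +
   \sum_(k < n.+1) k.+1%:R * (e (n - k)%N x * e k.+1 y).
  rewrite -big_split/=; apply: eq_bigr => k _.
  have kn : (k <= n)%N by rewrite -ltnS.
  rewrite subSn// [X in _ = X + _]mulrA eS [X in _ = _ + X]mulrCA eS natrB//; ring.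
have -> : \sum_(k < n.+1) (n.+1 - k)%:R * (e (n.+1 - k)%N x * e k y) =
   \sum_(k < n.+2) (n.+1 - k)%:R * (e (n.+1 - k)%N x * e k y).
  by rewrite [RHS]big_ord_recr/= subnn mul0r addr0.
have -> : \sum_(k < n.+1) k.+1%:R * (e (n - k)%N x * e k.+1 y) =
   \sum_(k < n.+2) k%:R * (e (n.+1 - k)%N x * e k y).
  by rewrite [RHS]big_ord_recl/= mul0r add0r; apply: eq_bigr => k _; rewrite /bump/= add1n subSS.
rewrite mulr_sumr -big_split/=; apply: eq_bigr => k _.
have kn : (k <= n.+1)%N by rewrite -ltnS.
by rewrite -mulrDl -natrD subnK.
Qed.

(* With [t = x^2 / 4], [(x / 2)^a] times the sum of this series is the Bessel function [J_a]. *)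
Definition bessel_coeff (a t : R) : R^nat :=
  fun k => (-1) ^+ k * t ^+ k / (k`!%:R * Gamma (k%:R + a + 1)).

Lemma Gamma_inv_le (z : R) : 1 <= z -> (Gamma z)^-1 <= expR 1.
Proof.
move=> z1; rewrite -[expR 1]invrK -expRN lef_pV2 ?posrE ?expR_gt0//.
  exact: Gamma_ge_expN1.
by apply: Gamma_gt0; exact: lt_le_trans z1.
Qed.

Lemma is_cvg_series_exp_scale (c t : R) : cvgn (series (fun n => c * (t ^+ n / n`!%:R))).
Proof.
have -> : (fun n => c * (t ^+ n / n`!%:R)) = c *: exp_coeff t by [].
exact/is_cvg_seriesZ/is_cvg_series_exp_coeff.
Qed.

Lemma is_cvg_bessel_norm (a t : R) : 0 <= a ->
  cvgn (series (fun n => `|bessel_coeff a t n|)).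
Proof.
move=> a0; have := @is_cvg_series_exp_scale (expR 1) `|t|; apply: series_le_cvg => [n|n|n] /=.
- exact: normr_ge0.
- by rewrite mulr_ge0 ?expR_ge0// divr_ge0 ?exprn_ge0.
have n0 : 0 <= n%:R :> R by [].
have z1 : 1 <= n%:R + a + 1 by lra.
have G0 : 0 < Gamma (n%:R + a + 1) by apply: Gamma_gt0; lra.
rewrite /bessel_coeff invfM !normrM normrX normrN1 expr1n mul1r normrX.
rewrite mulrA mulrC [`|n`!%:R^-1|]ger0_norm ?invr_ge0 ?ler0n//.
rewrite [`|(Gamma _)^-1|]ger0_norm ?invr_ge0 ?(ltW G0)//.
by rewrite ler_wpM2r ?Gamma_inv_le// divr_ge0 ?exprn_ge0.
Qed.

Definition bessel (a t : R) : R := limn (series (bessel_coeff a t)).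

Lemma cvg_bessel (a t : R) : 0 <= a -> series (bessel_coeff a t) @ \oo --> bessel a t.
Proof. by move=> a0; exact/normed_cvg/is_cvg_bessel_norm. Qed.

Lemma measurable_bessel (a : R) : 0 <= a -> measurable_fun (setT : set RM) (bessel a).
Proof.
move=> a0; apply: (measurable_fun_cvg (h := fun n t => series (bessel_coeff a t) n)); last first.
  by move=> t _; exact: cvg_bessel.
move=> n; apply: measurable_sum => k.
apply: measurable_funM => //; apply: measurable_funM => //.
Qed.

Definition bessel_prod_coeff (a b t : R) : R^nat := fun n =>
  (-1) ^+ n * t ^+ n * Gamma (2 * n%:R + a + b + 1) /
  (n`!%:R * Gamma (n%:R + a + b + 1) * Gamma (n%:R + a + 1) * Gamma (n%:R + b + 1)).

(** Both reciprocal Gammas are written as falling factorials of n + a and n + b over denominators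
    independent of k; what remains is Vandermonde's sum. *)
Lemma conv_bessel (a b t : R) : 0 <= a -> 0 <= b ->
  cauchy_conv (bessel_coeff a t) (bessel_coeff b t) = bessel_prod_coeff a b t.
Proof.
move=> a0 b0; apply/funext => n; rewrite /cauchy_conv /bessel_prod_coeff.
have n0 : 0 <= n%:R :> R by [].
have Ga : Gamma (n%:R + a + 1) != 0 by rewrite gt_eqF// Gamma_gt0//; lra.
have Gb : Gamma (n%:R + b + 1) != 0 by rewrite gt_eqF// Gamma_gt0//; lra.
have Gab : Gamma (n%:R + a + b + 1) != 0 by rewrite gt_eqF// Gamma_gt0//; lra.
have Gab2 : Gamma (2 * n%:R + a + b + 1) != 0 by rewrite gt_eqF// Gamma_gt0//; lra.
transitivity ((-1) ^+ n * t ^+ n / (Gamma (n%:R + a + 1) * Gamma (n%:R + b + 1)) *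
   \sum_(k < n.+1) ffact (n - k) (n%:R + a) / (n - k)`!%:R * (ffact k (n%:R + b) / k`!%:R)).
  rewrite mulr_sumr; apply: eq_bigr => k _.
  have kn : (k <= n)%N by rewrite -ltnS.
  rewrite /bessel_coeff !invfM.
  have -> : (Gamma (k%:R + a + 1))^-1 = ffact (n - k) (n%:R + a) / Gamma (n%:R + a + 1).
    by rewrite rGammaB natrB//; congr (Gamma _)^-1; ring.
  have -> : (Gamma ((n - k)%:R + b + 1))^-1 = ffact k (n%:R + b) / Gamma (n%:R + b + 1).
    by rewrite rGammaB natrB//; congr (Gamma _)^-1; ring.
  have E1 (z : R) : z ^+ n = z ^+ k * z ^+ (n - k) by rewrite -exprD subnKC.
  rewrite (E1 t) (E1 (-1)); ring.
rewrite vandermonde.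
have -> : ffact n (n%:R + a + (n%:R + b)) = Gamma (2 * n%:R + a + b + 1) / Gamma (n%:R + a + b + 1).
  have := rGammaB n (2 * n%:R + a + b).
  have -> : 2 * n%:R + a + b - n%:R + 1 = n%:R + a + b + 1 by ring.
  have -> : n%:R + a + (n%:R + b) = 2 * n%:R + a + b by ring.
  by move=> <-; rewrite /ffact mulrCA divff ?mulr1.
rewrite !invfM; ring.
Qed.

Lemma cvg_bessel_prod (a b t : R) : 0 <= a -> 0 <= b ->
  series (bessel_prod_coeff a b t) @ \oo --> bessel a t * bessel b t.
Proof.
move=> a0 b0; rewrite -conv_bessel//.
by apply: cvg_cauchy_product; [exact: is_cvg_bessel_norm|exact: is_cvg_bessel_norm|exact: cvg_bessel|exact: cvg_bessel].
Qed.

(** Writing x^(2 k + 2) = x^(2 k) - (1 - x^2) x^(2 k) trades two degrees for a shift of the weight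
    from b to b + 1. *)
Lemma wint_Xeven (b : R) k : 0 < b -> wint b 'X^(k.*2) =
  (k.*2)`!%:R / (4 ^+ k * k`!%:R) * (Num.sqrt pi * Gamma (b + 1) / Gamma (k%:R + b + 3 / 2)).
Proof.
elim: k b => [|k IH] b b0.
  by rewrite double0 !expr0 wint1// !fact0 add0r mul1r invr1 !mul1r.
have b10 : 0 < b + 1 by rewrite addr_gt0.
have -> : 'X^(k.+1.*2) = 'X^(k.*2) - omega * 'X^(k.*2) :> {poly R}.
  by rewrite doubleS !exprS /omega; ring.
rewrite wintD// wintN// wint_omega// !IH// (GammaS b10) -[k.+1%:R]natr1.
have k0 : 0 <= k%:R :> R by [].
have kb : 0 < k%:R + b + 3 / 2 by lra.
have -> : k%:R + (b + 1) + 3 / 2 = k%:R + b + 3 / 2 + 1 by ring.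
have -> : k%:R + 1 + b + 3 / 2 = k%:R + b + 3 / 2 + 1 by ring.
rewrite (GammaS kb) doubleS !factS !natrM -[k.*2.+2%:R]natr1 -[k.*2.+1%:R]natr1 -[k.+1%:R]natr1.
rewrite -mul2n natrM exprS.
have F0 : k`!%:R != 0 :> R by rewrite pnatr_eq0 -lt0n fact_gt0.
have F4 : 4 ^+ k != 0 :> R by rewrite expf_neq0.
have k1 : k%:R + 1 != 0 :> R by rewrite natr1 pnatr_eq0.
have G0 : Gamma (k%:R + b + 3 / 2) != 0 by rewrite gt_eqF// Gamma_gt0.
have kb0 : 2 * k%:R + 2 * b + 3 != 0 by rewrite gt_eqF//; lra.
by field; rewrite F0 F4 k1 G0/= andbT gt_eqF//; lra.
Qed.

End bessel.

(** * Poisson's integral and the Weber integrals *)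

Section weber.
Context {R : realType}.
Notation mu := (@lebesgue_measure R).
Notation RM := (measurableTypeR R).
Let itvoy : set RM := `]0, +oo[%classic.
Let mi : measurable itvoy. Proof. exact: measurable_itv. Qed.
Let itv11 : set RM := `]-1, 1[%classic.
Let mi1 : measurable itv11. Proof. exact: measurable_itv. Qed.

Lemma seriesZ (c : R) (u : R^nat) : series (fun n => c * u n) = (fun n => c * series u n).
Proof. by apply/funext => n; rewrite /series/= mulr_sumr. Qed.

Lemma cvg_seriesZ (c l : R) (u : R^nat) : series u @ \oo --> l ->
  series (fun n => c * u n) @ \oo --> c * l.
Proof. by move=> ul; rewrite seriesZ; apply: cvgMr. Qed.

(** Poisson's integral for the Bessel function of order b + 1/2: the cosine series is integrated
    term by term. Each term has constant sign on (-1, 1), so its absolute value serves as bound and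
    integrates to the absolute Bessel coefficient. *)
Lemma has_int_cos_bessel (b xi : R) : 0 < b ->
  has_int `]-1, 1[%classic (fun x => (1 - x ^+ 2) `^ b * cos (xi * x))
    (Num.sqrt pi * Gamma (b + 1) * bessel (b + 2^-1) (xi ^+ 2 / 4)).
Proof.
move=> b0; pose t := xi ^+ 2 / 4; pose C := Num.sqrt pi * Gamma (b + 1).
have C0 : 0 <= C by rewrite mulr_ge0 ?sqrtr_ge0// ltW// Gamma_gt0// addr_gt0.
have b2 : 0 <= b + 2^-1 by rewrite addr_ge0 ?invr_ge0// ltW.
have E k : xi ^+ k.*2 / k.*2`!%:R * wint b 'X^(k.*2) =
    C * (t ^+ k / (k`!%:R * Gamma (k%:R + (b + 2^-1) + 1))).
  rewrite wint_Xeven// /t /C -mul2n exprM expr_div_n.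
  have -> : k%:R + (b + 2^-1) + 1 = k%:R + b + 3 / 2 by field.
  have F0 : k`!%:R != 0 :> R by rewrite pnatr_eq0 -lt0n fact_gt0.
  have F1 : (2 * k)`!%:R != 0 :> R by rewrite pnatr_eq0 -lt0n fact_gt0.
  have F4 : 4 ^+ k != 0 :> R by rewrite expf_neq0.
  have k0 : 0 <= k%:R :> R by [].
  have G0 : Gamma (k%:R + b + 3 / 2) != 0 by rewrite gt_eqF// Gamma_gt0//; lra.
  by field; rewrite F0 F1 F4 G0.
have V k : has_int itv11 (fun x => (1 - x ^+ 2) `^ b * cos_coeff' (xi * x) k)
    (C * bessel_coeff (b + 2^-1) t k).
  have := has_intZ ((-1) ^+ k * (xi ^+ k.*2 / k.*2`!%:R)) mi1 (has_int_wint 'X^(k.*2) b0).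
  rewrite -[X in has_int _ _ X]mulrA E.
  have -> : (-1) ^+ k * (C * (t ^+ k / (k`!%:R * Gamma (k%:R + (b + 2^-1) + 1)))) =
    C * bessel_coeff (b + 2^-1) t k by rewrite /bessel_coeff; ring.
  move=> /eq_has_int; apply => // x _.
  rewrite /cos_coeff' hornerXn -exprnP exprMn; ring.
have M k : has_int itv11 (fun x => (xi ^+ k.*2 / k.*2`!%:R) * ((1 - x ^+ 2) `^ b * ('X^(k.*2)).[x]))
    (C * `|bessel_coeff (b + 2^-1) t k|).
  have := has_intZ (xi ^+ k.*2 / k.*2`!%:R) mi1 (has_int_wint 'X^(k.*2) b0).
  rewrite E; suff -> : `|bessel_coeff (b + 2^-1) t k| = t ^+ k / (k`!%:R * Gamma (k%:R + (b + 2^-1) + 1)) by [].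
  have k0 : 0 <= k%:R :> R by [].
  rewrite /bessel_coeff -mulrA normrM normrX normrN1 expr1n mul1r ger0_norm// divr_ge0//.
    by rewrite exprn_ge0// /t divr_ge0 ?sqr_ge0.
  by rewrite mulr_ge0// ltW// Gamma_gt0//; lra.
have [||x _|w Hw cw] := has_int_series mi1 V M (F := fun x => (1 - x ^+ 2) `^ b * cos (xi * x)).
- move=> k x _; rewrite hornerXn /cos_coeff' -exprnP exprMn.
  rewrite !normrM normfV (ger0_norm (powR_ge0 _ _)) normrX normrN1 expr1n mul1r.
  rewrite (ger0_norm (ler0n _ _)) -!normrM.
  rewrite -mul2n !(exprM _ 2 k) -exprMn ger0_norm; last by rewrite exprn_ge0// mulr_ge0// sqr_ge0.
  by rewrite exprMn le_eqVlt; apply/orP; left; apply/eqP; ring.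
- rewrite seriesZ; apply: is_cvgMr; exact: is_cvg_bessel_norm.
- by apply: cvg_seriesZ; exact: cvg_cos_coeff'.
- suff -> : C * bessel (b + 2^-1) (xi ^+ 2 / 4) = w by [].
  have h := cvg_seriesZ (c := C) (cvg_bessel (t := t) b2).
  exact: (cvg_unique (@Rhausdorff R) h cw).
Qed.

(** Consecutive polynomials are kept in a pair to make the recursion structural; 4 x - 2 is 2 cos (2
    t) for x = cos(t)^2. *)
Fixpoint cheb_pair (k : nat) : {poly R} * {poly R} :=
  if k is m.+1 then
    let: (p, q) := cheb_pair m in (q, (4 *: 'X - 2%:P) * q - p)
  else (1, 2 *: 'X - 1).

(* [(cheb k).[cos^2 t] = cos (2 k t)]. *)
Definition cheb k := (cheb_pair k).1.

Lemma cheb0 : cheb 0 = 1. Proof. by []. Qed.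
Lemma cheb1 : cheb 1 = 2 *: 'X - 1. Proof. by []. Qed.
Lemma chebSS k : cheb k.+2 = (4 *: 'X - 2%:P) * cheb k.+1 - cheb k.
Proof. by rewrite /cheb/=; case: (cheb_pair k). Qed.

(** This is cos(t)^2 for y = tan t, and dt = [rr y] dy; hence the exponent s + 1 where cos(t)^(2 s)
    is meant. *)
Let rr (y : R) := (1 + y ^+ 2)^-1.
Let rr_gt0 y : 0 < rr y.
Proof. by rewrite invr_gt0 ltr_pwDl// sqr_ge0. Qed.
Let rr_le1 y : rr y <= 1.
Proof. by rewrite invf_le1 ?ltr_pwDl ?sqr_ge0// lerDl sqr_ge0. Qed.

Let measurable_rr : measurable_fun (setT : set RM) rr.
Proof.
have -> : rr = (fun y => (1 + y ^+ 2) `^ (- 1)).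
  by apply/funext => y; rewrite powR_inv1// addr_ge0// sqr_ge0.
apply: (measurableT_comp (measurable_powR _)).
apply: measurable_funD => //.
Qed.

(* The integral of [cos (2 k t) * cos t ^ (2 s)] over [(0, pi / 2)], seen with [y = tan t]. *)
Definition cheb_moment k (s : R) : R :=
  pi / 2 * (Gamma (2 * s + 1) * 4 `^ (- s)) / Gamma (s + k%:R + 1) / Gamma (s - k%:R + 1).

(** Multiplication by [rr] raises s by 1, so the Chebyshev recursion relates the moments at s and s
    + 1, and the closed form obeys the same relation. The induction carries two consecutive k for
    all s; k = 0 comes from [has_int_cauchy_power] and the duplication formula. *)
Lemma has_int_cheb_moment k (s : R) : - 2^-1 < s ->
  has_int `]0, +oo[%classic (fun y => (cheb k).[rr y] * rr y `^ (s + 1)) (cheb_moment k s).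
Proof.
have sh (z : R) : - 2^-1 < z -> Gamma (2 * (z + 1) + 1) * 4 `^ (- (z + 1)) =
    (2 * z + 2) * (2 * z + 1) / 4 * (Gamma (2 * z + 1) * 4 `^ (- z)).
  move=> z0; have -> : 2 * (z + 1) + 1 = 2 * z + 1 + 1 + 1 by ring.
  rewrite GammaS; last by lra.
  rewrite GammaS; last by lra.
  have -> : - (z + 1) = - z - 1 by ring.
  by rewrite powRB ?pnatr_eq0 ?implybT// powRr1//; field.
have base (z : R) : - 2^-1 < z ->
    has_int itvoy (fun y => rr y `^ (z + 1)) (cheb_moment 0 z).
  move=> z0; have := has_int_cauchy_power z0.
  have p0 : 0 < z + 2^-1 by lra.
  have z10 : 0 < z + 1 by lra.
  have := Gamma_dup p0.
  have -> : 2 * (z + 2^-1) = 2 * z + 1 by field.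
  have -> : z + 2^-1 + 2^-1 = z + 1 by field.
  have -> : 2 * z + 1 - 1 = 2 * z by ring.
  move=> D; have G0 : Gamma (z + 1) != 0 by rewrite gt_eqF// Gamma_gt0.
  have Q : 4 `^ (- z) = (2 `^ (2 * z))^-1 :> R.
    have -> : 4 = 2 `^ 2%:R :> R by rewrite powR_mulrn//; ring.
    by rewrite -powRrM -powRN; congr powR; ring.
  have Q0 : 2 `^ (2 * z) != 0 :> R by rewrite gt_eqF// powR_gt0.
  have -> : Num.sqrt pi * Gamma (z + 2^-1) / (2 * Gamma (z + 1)) = cheb_moment 0 z.
    rewrite /cheb_moment addr0 subr0 Q.
    have -> : pi / 2 * (Gamma (2 * z + 1) / 2 `^ (2 * z)) =
        Num.sqrt pi * (Num.sqrt pi * Gamma (2 * z + 1)) / (2 * 2 `^ (2 * z)) :> R.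
      have {1}-> : pi = Num.sqrt pi ^+ 2 :> R by rewrite sqr_sqrtr// pi_ge0.
      by field.
    by rewrite D; field; rewrite G0 Q0.
  move=> /eq_has_int; apply => // y _.
  have r0 : 0 < 1 + y ^+ 2 by rewrite ltr_pwDl// sqr_ge0.
  by rewrite /rr powRN -powR_inv1 ?ltW// -powRrM mulN1r powRN.
have rS (y z : R) : rr y * rr y `^ (z + 1) = rr y `^ (z + 1 + 1).
  by rewrite [RHS]powRDr1 ?rr_gt0// mulrC.
suff H (k' : nat) : (forall s, - 2^-1 < s -> has_int itvoy (fun y => (cheb k').[rr y] * rr y `^ (s + 1)) (cheb_moment k' s))
  /\ (forall s, - 2^-1 < s -> has_int itvoy (fun y => (cheb k'.+1).[rr y] * rr y `^ (s + 1)) (cheb_moment k'.+1 s)).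
  exact: (H k).1.
elim: k' => [|m [IH0 IH1]].
  split => {}s s0.
    by apply: eq_has_int (base s s0) mi => y _; rewrite cheb0 hornerC mul1r.
  have s1 : - 2^-1 < s + 1 by lra.
  have := has_intB mi (has_intZ 2 mi (base _ s1)) (base _ s0).
  have -> : 2 * cheb_moment 0 (s + 1) - cheb_moment 0 s = cheb_moment 1 s.
    rewrite /cheb_moment sh// !addr0 !subr0 subrK.
    rewrite (rGammaS (s + 1)) (rGammaS s) (rGammaS (s + 1)).
    by move: (Gamma (s + 1 + 1))^-1 => w; field.
  by move=> /eq_has_int; apply => // y _; rewrite cheb1 !hornerE mulrBl mul1r -mulrA rS.
split => // {}s s0.
have s1 : - 2^-1 < s + 1 by lra.
have := has_intB mi (has_intB mi (has_intZ 4 mi (IH1 _ s1)) (has_intZ 2 mi (IH1 _ s0))) (IH0 _ s0).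
have -> : 4 * cheb_moment m.+1 (s + 1) - 2 * cheb_moment m.+1 s - cheb_moment m s = cheb_moment m.+2 s.
  rewrite /cheb_moment sh//.
  have -> : s + 1 + m.+1%:R + 1 = s + m%:R + 3 by rewrite -natr1; ring.
  have -> : s + 1 - m.+1%:R + 1 = s - m%:R + 1 by rewrite -natr1; ring.
  have -> : s + m.+1%:R + 1 = s + m%:R + 2 by rewrite -natr1; ring.
  have -> : s - m.+1%:R + 1 = s - m%:R by rewrite -natr1; ring.
  have -> : s + m.+2%:R + 1 = s + m%:R + 3 by rewrite -[m.+2%:R]natr1 -natr1; ring.
  have -> : s - m.+2%:R + 1 = s - m%:R - 1 by rewrite -[m.+2%:R]natr1 -natr1; ring.
  (* The reciprocals can vanish, so all are expressed through two of them by [rGammaS] and then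
     treated as atoms. *)
  rewrite (rGammaS (s + m%:R + 1)) (rGammaS (s - m%:R - 1)) subrK (rGammaS (s - m%:R)).
  have -> : s + m%:R + 1 + 1 = s + m%:R + 2 by ring.
  rewrite (rGammaS (s + m%:R + 2)); have -> : s + m%:R + 2 + 1 = s + m%:R + 3 by ring.
  move: (Gamma (s + m%:R + 3))^-1 (Gamma (s - m%:R + 1))^-1 => u w.
  by field.
move=> /eq_has_int; apply => // y _.
rewrite chebSS !(hornerD, hornerN, hornerM, hornerZ, hornerX, hornerC) -rS; ring.
Qed.

Let P k y := (cheb k).[rr y] : R.

Let measurable_P k : measurable_fun (setT : set RM) (P k).
Proof.
apply: (measurableT_comp (f := horner (cheb k))) => //.
by apply: continuous_measurable_fun; exact: continuous_horner.
Qed.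

Let P_bounded k : exists B, forall y, `|P k y| <= B.
Proof.
have N01 : 0 <= 1 :> R by [].
have cnf : {within `[0, 1], continuous (fun x : R => `|(cheb k).[x]|)}.
  apply: continuous_subspaceT => x; apply: continuous_comp; first exact: continuous_horner.
  exact: norm_continuous.
have [c _ fc] := EVT_max N01 cnf.
exists `|(cheb k).[c]| => y; apply: fc.
by rewrite in_itv/= rr_le1 ltW.
Qed.

Let has_int_normP k s : - 2^-1 < s -> exists C,
  has_int itvoy (fun y => `|P k y| * rr y `^ (s + 1)) C.
Proof.
move=> s0; have [B PB] := P_bounded k.
have H := has_intZ B mi (has_int_cheb_moment 0 s0).
exists (\int[mu]_(y in itvoy) (`|P k y| * rr y `^ (s + 1))).
apply: (dom_has_int mi _ H) => [|y _].
  apply: measurable_funTS; apply: measurable_funM.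
    exact: measurableT_comp.
  exact: (measurableT_comp (measurable_powR _)).
rewrite ger0_norm ?mulr_ge0 ?powR_ge0// cheb0 hornerC mul1r.
by rewrite ler_wpM2r ?powR_ge0// PB.
Qed.

(** Since [rr] <= 1, the moments at s, s + 1, s + 2, ... share one bound; exponential series then
    dominate the expansions in 1/s. *)
Let cheb_moment_le k s C n : - 2^-1 < s ->
  has_int itvoy (fun y => `|P k y| * rr y `^ (s + 1)) C ->
  `|cheb_moment k (n%:R + s)| <= C.
Proof.
move=> s0 HC; have n0 : 0 <= n%:R :> R by [].
have ns0 : - 2^-1 < n%:R + s by lra.
have H := has_int_cheb_moment k ns0.
have L y : rr y `^ (n%:R + s + 1) <= rr y `^ (s + 1).
  by apply: ger_powR; rewrite ?rr_gt0 ?rr_le1//; lra.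
rewrite ler_norml; apply/andP; split.
  have HN := has_intZ (- 1) mi HC.
  rewrite -mulN1r; apply: (le_has_int mi HN H) => y _.
  rewrite mulN1r -mulNr -/(P k y).
  apply: (@le_trans _ _ (- `|P k y| * rr y `^ (n%:R + s + 1))).
    by rewrite !mulNr lerN2 ler_wpM2l.
  by rewrite ler_wpM2r ?powR_ge0// lerNl -normrN ler_norm.
apply: (le_has_int mi H HC) => y _; rewrite -/(P k y).
apply: (@le_trans _ _ (`|P k y| * rr y `^ (n%:R + s + 1))).
  by rewrite ler_wpM2r ?powR_ge0// ler_norm.
by rewrite ler_wpM2l.
Qed.

Let Psi k h s : R := \int[mu]_(y in itvoy) (P k y * rr y `^ (h + 1) * expR (- (rr y / s))).

Let psi_term k h s : R^nat := fun n => (-1) ^+ n * (s^-1 ^+ n / n`!%:R) * cheb_moment k (n%:R + h).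

Let psi_term_cvg k h s : 0 < h -> 0 < s -> cvgn (series (fun n => `|psi_term k h s n|)).
Proof.
move=> h0 s0; have h2 : - 2^-1 < h by lra.
have [C HC] := has_int_normP k h2.
have := @is_cvg_series_exp_scale R C s^-1; apply: series_le_cvg => [n|n|n] /=.
- exact: normr_ge0.
- have C0 := le_trans (normr_ge0 _) (cheb_moment_le n h2 HC).
  by rewrite mulr_ge0// divr_ge0 ?exprn_ge0// invr_ge0 ltW.
have := cheb_moment_le n h2 HC; rewrite /psi_term.
move: (cheb_moment k (n%:R + h)) => z zC.
rewrite !normrM normrX normrN1 expr1n mul1r mulrC.
rewrite (ger0_norm (_ : 0 <= s^-1 ^+ n)); last by rewrite exprn_ge0// invr_ge0 ltW.
rewrite (ger0_norm (_ : 0 <= (n`!%:R)^-1)) ?invr_ge0//.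
by apply: ler_wpM2r => //; rewrite divr_ge0 ?exprn_ge0// invr_ge0 ltW.
Qed.

Let has_int_Psi k h s : 0 < h -> 0 < s ->
  has_int itvoy (fun y => P k y * rr y `^ (h + 1) * expR (- (rr y / s))) (Psi k h s) /\
  series (psi_term k h s) @ \oo --> Psi k h s.
Proof.
move=> h0 s0; have h2 : - 2^-1 < h by lra.
have [C HC] := has_int_normP k h2.
have V n : has_int itvoy (fun y => P k y * rr y `^ (h + 1) * exp_coeff (- (rr y / s)) n)
    (psi_term k h s n).
  have n0 : 0 <= n%:R :> R by [].
  have nh2 : - 2^-1 < n%:R + h by lra.
  have := has_intZ ((-1) ^+ n * (s^-1 ^+ n / n`!%:R)) mi (has_int_cheb_moment k nh2).
  move=> /eq_has_int; apply => // y _; rewrite -/(P k y).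
  have -> : n%:R + h + 1 = h + 1 + n%:R by ring.
    rewrite (@powRD _ (rr y) (h + 1) n%:R) ?(gt_eqF (rr_gt0 y)) ?implybT// powR_mulrn ?ltW//.
  have -> : exp_coeff (- (rr y / s)) n = (-1) ^+ n * (rr y ^+ n * s^-1 ^+ n) / n`!%:R by rewrite /exp_coeff/= -!exprMn mulN1r.
  by ring.
have M n : has_int itvoy (fun y => (s^-1 ^+ n / n`!%:R) * (`|P k y| * rr y `^ (h + 1)))
   ((s^-1 ^+ n / n`!%:R) * C) by exact: has_intZ.
have [||y _|w Hw cw] := has_int_series mi V M
   (F := fun y => P k y * rr y `^ (h + 1) * expR (- (rr y / s))).
- move=> n y _ /=; rewrite normrM [X in _ <= X]mulrC normrM (ger0_norm (powR_ge0 _ _)) ler_wpM2l//.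
    by rewrite mulr_ge0// powR_ge0.
  have Er : `|- (rr y / s)| <= s^-1.
    rewrite normrN ger0_norm; last by rewrite divr_ge0 ?ltW.
    by rewrite ler_piMl ?invr_ge0 ?(ltW s0)// rr_le1.
  rewrite /exp_coeff/= normrM normrX normfV (ger0_norm (ler0n _ _)).
  apply: ler_wpM2r; first by rewrite invr_ge0.
  by apply: lerXn2r; rewrite ?nnegrE ?invr_ge0 ?(ltW s0).
- rewrite (_ : (fun n => _) = fun n => C * (s^-1 ^+ n / n`!%:R)); last first.
    by apply/funext => n; rewrite mulrC.
  exact: is_cvg_series_exp_scale.
- apply: cvg_seriesZ; rewrite /expR; exact: is_cvg_series_exp_coeff.
- by rewrite /Psi (has_intE Hw).
Qed.

(** The weight x^(4 h + 1) is chosen so that the n-th Gaussian moment yields Gamma (n + 2 h + 1),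
    cancelling a denominator of the product series. What is left is [cheb_moment k (n + h)], so the
    sum is the expansion of [Psi] in powers of 1/s. *)
Let has_int_bessel_gauss k h s : 0 < h - k%:R -> 0 < s ->
  has_int itvoy (fun x => x `^ (4 * h + 1) * expR (- (s * x ^+ 2)) *
      (bessel (h + k%:R) (x ^+ 2 / 4) * bessel (h - k%:R) (x ^+ 2 / 4)))
    (4 `^ h / pi * s `^ (- (2 * h) - 1) * Psi k h s).
Proof.
move=> hk s0; have k0 : 0 <= k%:R :> R by [].
have h0 : 0 < h by lra.
have a0 : 0 <= h + k%:R by lra.
have b0 := ltW hk.
pose c := 4 `^ h / pi * s `^ (- (2 * h) - 1).
have c0 : 0 <= c by rewrite mulr_ge0 ?powR_ge0// divr_ge0 ?powR_ge0 ?pi_ge0.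
pose w0 n x := x `^ (2 * (n%:R + 2 * h + 1) - 1) * expR (- (s * x ^+ 2)).
pose f n x := x `^ (4 * h + 1) * expR (- (s * x ^+ 2)) *
     bessel_prod_coeff (h + k%:R) (h - k%:R) (x ^+ 2 / 4) n.
pose I n := Gamma (n%:R + 2 * h + 1) / 2 * s `^ (- (n%:R + 2 * h + 1)).
have m0 n : 0 < n%:R + 2 * h + 1 :> R by have : 0 <= n%:R :> R by []; lra.
have Hg n : has_int itvoy (w0 n) (I n) := has_int_gauss_moment (m0 n) s0.
(* Each term is a constant times the positive function [w0 n]; its absolute value is therefore
   integrated by the same formula. *)
have key n : exists2 d, forall x, 0 < x -> f n x = d * w0 n x & d * I n = c * psi_term k h s n.
  have n0 : 0 <= n%:R :> R by [].
  pose d : R := (-1) ^+ n / 4 ^+ n * Gamma (2 * n%:R + (h + k%:R) + (h - k%:R) + 1) /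
     (n`!%:R * Gamma (n%:R + (h + k%:R) + (h - k%:R) + 1) *
      Gamma (n%:R + (h + k%:R) + 1) * Gamma (n%:R + (h - k%:R) + 1)).
  exists d => [x x0|].
    rewrite /f /w0.
    have -> : 2 * (n%:R + 2 * h + 1) - 1 = 4 * h + 1 + (n%:R + n%:R) by ring.
    rewrite (@powRD _ x (4 * h + 1)) ?(gt_eqF x0) ?implybT// (@powRD _ x n%:R) ?(gt_eqF x0) ?implybT//.
    rewrite powR_mulrn ?ltW// /d /bessel_prod_coeff expr_div_n -exprM mulnC exprM expr2.
    ring.
  rewrite /I /d /c /psi_term /cheb_moment.
  have -> : n%:R + (h + k%:R) + (h - k%:R) + 1 = n%:R + 2 * h + 1 by ring.
  have -> : 2 * n%:R + (h + k%:R) + (h - k%:R) + 1 = 2 * (n%:R + h) + 1 by ring.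
  have -> : n%:R + (h + k%:R) + 1 = n%:R + h + k%:R + 1 by ring.
  have -> : n%:R + (h - k%:R) + 1 = n%:R + h - k%:R + 1 by ring.
  have -> : - (n%:R + 2 * h + 1) = - (2 * h) - 1 - n%:R by ring.
  rewrite [s `^ (_ - n%:R)]powRB ?(gt_eqF s0) ?implybT// powR_mulrn ?ltW//.
  have -> : 4 `^ (- (n%:R + h)) = (4 ^+ n * 4 `^ h)^-1 :> R.
    by rewrite powRN powRD ?pnatr_eq0 ?implybT// powR_mulrn.
  rewrite exprVn.
  have F0 : n`!%:R != 0 :> R by rewrite pnatr_eq0 -lt0n fact_gt0.
  have F4 : 4 ^+ n != 0 :> R by rewrite expf_neq0.
  have Q0 : 4 `^ h != 0 :> R by rewrite gt_eqF// powR_gt0.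
  have S0 : s ^+ n != 0 by rewrite expf_neq0// gt_eqF.
  have p0 : pi != 0 :> R by rewrite gt_eqF// pi_gt0.
  have G1 : Gamma (n%:R + 2 * h + 1) != 0 by rewrite gt_eqF// Gamma_gt0// m0.
  have G2 : Gamma (n%:R + h + k%:R + 1) != 0 by rewrite gt_eqF// Gamma_gt0//; lra.
  have G3 : Gamma (n%:R + h - k%:R + 1) != 0 by rewrite gt_eqF// Gamma_gt0//; lra.
  move: (pi : R) p0 => p p0.
  by field; rewrite F0 F4 Q0 S0 p0 G1 G2 G3.
have V n : has_int itvoy (f n) (c * psi_term k h s n).
  have [d fd <-] := key n.
  apply: eq_has_int (has_intZ d mi (Hg n)) mi => x.
  by rewrite inE /itvoy/= in_itv/= andbT; exact: fd.
have M n : has_int itvoy (fun x => `|f n x|) (`|c * psi_term k h s n|).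
  have [d fd <-] := key n.
  have I0 : 0 <= I n by rewrite mulr_ge0 ?powR_ge0// divr_ge0// ltW// Gamma_gt0.
  rewrite normrM (ger0_norm I0).
  apply: eq_has_int (has_intZ `|d| mi (Hg n)) mi => x.
  rewrite inE /itvoy/= in_itv/= andbT => x0.
  by rewrite fd// normrM [`|w0 n x|]ger0_norm// mulr_ge0 ?powR_ge0 ?expR_ge0.
have [||x _|w Hw cw] := has_int_series mi V M
   (F := fun x => x `^ (4 * h + 1) * expR (- (s * x ^+ 2)) *
      (bessel (h + k%:R) (x ^+ 2 / 4) * bessel (h - k%:R) (x ^+ 2 / 4))).
- by [].
- rewrite (_ : (fun n => _) = fun n => c * `|psi_term k h s n|); last first.
    by apply/funext => n; rewrite normrM (ger0_norm c0).
  rewrite seriesZ; apply: is_cvgMr; exact: psi_term_cvg.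
- by apply: cvg_seriesZ; exact: cvg_bessel_prod.
- suff -> : 4 `^ h / pi * s `^ (- (2 * h) - 1) * Psi k h s = w by [].
  have hh := cvg_seriesZ (c := c) (has_int_Psi k h0 s0).2.
  exact: (cvg_unique (@Rhausdorff R) hh cw).
Qed.

(** Exchanging the integrals, the one in s gives Gamma h times [rr y] to the power - h. This cancels
    the damping in y and leaves the moment at exponent 0. *)
Let has_int_Psi_power k h : 0 < h ->
  has_int itvoy (fun s => s `^ (- h - 1) * Psi k h s) (Gamma h * cheb_moment k 0).
Proof.
move=> h0; have h2 : - 2^-1 < h by lra.
have z2 : - 2^-1 < 0 :> R by lra.
pose f (z : RM * RM) := z.1 `^ (- h - 1) * (P k z.2 * rr z.2 `^ (h + 1) * expR (- (rr z.2 * z.1 `^ (- 1)))).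
have mPr : measurable_fun setT (fun z : RM * RM => P k z.2 * rr z.2 `^ (h + 1)).
  apply: measurable_funM; first exact: (measurableT_comp (measurable_P k) measurable_snd).
  exact: (measurableT_comp (measurable_powR _) (measurableT_comp measurable_rr measurable_snd)).
have me : measurable_fun setT (fun z : RM * RM => expR (- (rr z.2 * z.1 `^ (- 1)))).
  apply: measurableT_comp => //; apply: measurableT_comp => //; apply: measurable_funM.
    exact: (measurableT_comp measurable_rr measurable_snd).
  exact: (measurableT_comp (measurable_powR _) measurable_fst).
have mf : measurable_fun setT f.
  apply: measurable_funM; first exact: (measurableT_comp (measurable_powR _) measurable_fst).
  exact: measurable_funM.
have fE x y : 0 < x -> f (x, y) = x `^ (- h - 1) * (P k y * rr y `^ (h + 1) * expR (- (rr y / x))).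
  by move=> x0; rewrite /f/= powR_inv1// ltW.
have itvP x : itvoy x -> 0 < x by rewrite /itvoy/= in_itv/= andbT.
have inner y : has_int itvoy (fun x => x `^ (- h - 1) * expR (- (rr y / x))) (Gamma h * rr y `^ (- h)).
  exact: has_int_Gamma_inv.
have rE y : rr y `^ (h + 1) * rr y `^ (- h) = rr y `^ (0 + 1).
  rewrite -powRD ?(gt_eqF (rr_gt0 y)) ?implybT//; congr (_ `^ _); ring.
have [C HC] := has_int_normP k z2.
have [C' HC'] := has_int_normP k h2.
pose ga s := \int[mu]_(y in itvoy) `|f (s, y)|.
have Hga s : itvoy s -> has_int itvoy (fun y => `|f (s, y)|) (ga s).
  move=> /itvP s0.
  apply: (dom_has_int mi _ (has_intZ (s `^ (- h - 1)) mi HC')) => [|y _].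
    apply: measurableT_comp => //; apply: measurable_funTS.
    exact: (measurableT_comp mf (measurable_pair1 _)).
  rewrite normr_id fE// !normrM !(ger0_norm (powR_ge0 _ _)) (ger0_norm (expR_ge0 _)).
  rewrite ler_wpM2l ?powR_ge0// ler_piMr ?mulr_ge0 ?powR_ge0//.
  by rewrite -expR0 ler_expR oppr_le0 divr_ge0// ltW.
have Hgaw : has_int itvoy ga (Gamma h * C).
  have mnf : measurable_fun setT (fun z => `|f z|) by apply: measurableT_comp.
  apply: (@has_int_tonelli R itvoy itvoy (fun z => `|f z|) ga (fun y => Gamma h * (`|P k y| * rr y `^ (0 + 1))) _ mi mi mnf).
  - by [].
  - exact: Hga.
  - move=> y _; have := has_intZ (`|P k y| * rr y `^ (h + 1)) mi (inner y).
    rewrite [X in has_int _ _ X -> _](_ : _ = Gamma h * (`|P k y| * rr y `^ (0 + 1))); last by rewrite -rE; ring.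
    move=> /eq_has_int; apply => // x /[!inE] /itvP x0.
    rewrite fE// !normrM !(ger0_norm (powR_ge0 _ _)) (ger0_norm (expR_ge0 _)); ring.
  - exact: has_intZ.
apply: (@has_int_fubini R itvoy itvoy f (fun s => s `^ (- h - 1) * Psi k h s)
   (fun y => Gamma h * (P k y * rr y `^ (0 + 1))) ga _ _ mi mi mf Hga Hgaw).
- move=> s /itvP s0.
  have := has_intZ (s `^ (- h - 1)) mi (has_int_Psi k h0 s0).1.
  by move=> /eq_has_int; apply => // y _; rewrite fE.
- move=> y _; have := has_intZ (P k y * rr y `^ (h + 1)) mi (inner y).
  rewrite [X in has_int _ _ X -> _](_ : _ = Gamma h * (P k y * rr y `^ (0 + 1))); last by rewrite -rE; ring.
  move=> /eq_has_int; apply => // x /[!inE] /itvP x0.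
  by rewrite fE//; ring.
- exact: (has_intZ _ mi (has_int_cheb_moment k z2)).
Qed.

(** The integral of cos (2 k t) over (0, pi / 2). For k > 0 its vanishing is the pole of Gamma at 1
    - k. *)
Let cheb_moment0 k : cheb_moment k 0 = (k == 0%N)%:R * (pi / 2) :> R.
Proof.
rewrite /cheb_moment mulr0 oppr0 powRr0 !add0r Gamma1.
case: k => [|k]; first by rewrite oppr0 !add0r Gamma1 !divr1 !mulr1 mul1r.
have -> : - k.+1%:R + 1 = - k%:R :> R by rewrite -natr1; ring.
by rewrite Gamma_pole invr0 mulr0 mul0r.
Qed.

Let bprod k h x := bessel (h + k%:R) (x ^+ 2 / 4) * bessel (h - k%:R) (x ^+ 2 / 4) : R.

Let measurable_bprod k h : 0 < h - k%:R -> measurable_fun (setT : set RM) (bprod k h).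
Proof.
move=> hk; have k0 : 0 <= k%:R :> R by [].
have msq : measurable_fun (setT : set RM) (fun x : R => x ^+ 2 / 4).
  by apply: measurable_funM => //; exact: (measurableT_comp (f := fun x : R => x ^+ 2)).
apply: measurable_funM.
  by apply: (measurableT_comp _ msq); apply: measurable_bessel; lra.
by apply: (measurableT_comp _ msq); apply: measurable_bessel; exact: ltW.
Qed.

(** Integrated in the second variable it gives the Weber integrand, as 4 h + 1 - 2 (h + 1) = 2 h -
    1; integrated in the first it gives [has_int_bessel_gauss]. *)
Let weber_kernel k h (z : RM * RM) : R :=
  z.1 `^ (4 * h + 1) * bprod k h z.1 * (z.2 `^ (h + 1 - 1) * expR (- (z.1 ^+ 2 * z.2))).

Let measurable_kernel k h : 0 < h - k%:R -> measurable_fun setT (weber_kernel k h).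
Proof.
move=> hk; apply: measurable_funM; apply: measurable_funM.
- exact: (measurableT_comp (measurable_powR _) measurable_fst).
- exact: (measurableT_comp (measurable_bprod hk) measurable_fst).
- exact: (measurableT_comp (measurable_powR _) measurable_snd).
- apply: measurableT_comp => //; apply: measurableT_comp => //; apply: measurable_funM => //.
  exact: (measurableT_comp (f := fun x : R => x ^+ 2)).
Qed.

Let itvP x : itvoy x -> 0 < x. Proof. by rewrite /itvoy/= in_itv/= andbT. Qed.

Let kernel_s h x (B : R) : 0 < h -> 0 < x ->
  has_int itvoy (fun s => x `^ (4 * h + 1) * B * (s `^ (h + 1 - 1) * expR (- (x ^+ 2 * s))))
    (Gamma (h + 1) * (x `^ (2 * h - 1) * B)).
Proof.
move=> h0 x0; have h10 : 0 < h + 1 by rewrite addr_gt0.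
have x20 : 0 < x ^+ 2 by rewrite exprn_gt0.
have := has_intZ (x `^ (4 * h + 1) * B) mi (has_int_Gamma_scale h10 x20).
suff -> : x `^ (4 * h + 1) * B * (Gamma (h + 1) * (x ^+ 2) `^ (- (h + 1))) =
   Gamma (h + 1) * (x `^ (2 * h - 1) * B) by [].
have -> : (x ^+ 2) `^ (- (h + 1)) = x `^ (- (2 * h + 2)).
  by rewrite -powR_mulrn ?ltW// -powRrM; congr (_ `^ _); ring.
have -> : 4 * h + 1 = (2 * h - 1) + (2 * h + 2) by ring.
rewrite (@powRD _ x (2 * h - 1)) ?(gt_eqF x0) ?implybT// powRN.
have Q0 : x `^ (2 * h + 2) != 0 by rewrite gt_eqF// powR_gt0.
by field.
Qed.

Let kernel_x k h s : 0 < h - k%:R -> 0 < s ->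
  has_int itvoy (fun x => weber_kernel k h (x, s)) (4 `^ h / pi * (s `^ (- h - 1) * Psi k h s)).
Proof.
move=> hk s0; have k0 : 0 <= k%:R :> R by [].
have h0 : 0 < h by lra.
have := has_intZ (s `^ (h + 1 - 1)) mi (has_int_bessel_gauss hk s0).
rewrite [X in has_int _ _ X -> _](_ : _ = 4 `^ h / pi * (s `^ (- h - 1) * Psi k h s)); last first.
  have -> : - h - 1 = (h + 1 - 1) + (- (2 * h) - 1) by ring.
  by rewrite (@powRD _ s (h + 1 - 1)) ?(gt_eqF s0) ?implybT//; ring.
move=> /eq_has_int; apply => // x _; rewrite /weber_kernel/= /bprod.
by rewrite [x ^+ 2 * s]mulrC; ring.
Qed.

Let has_int_weber0 h : 0 < h ->
  has_int itvoy (fun x => x `^ (2 * h - 1) * bessel h (x ^+ 2 / 4) ^+ 2) (4 `^ h / (2 * h)).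
Proof.
move=> h0; have h10 : 0 < h + 1 by rewrite addr_gt0.
have hk : 0 < h - 0%:R by rewrite subr0.
have G0 : Gamma (h + 1) != 0 by rewrite gt_eqF// Gamma_gt0.
have : has_int itvoy (fun x => Gamma (h + 1) * (x `^ (2 * h - 1) * bprod 0 h x))
   (4 `^ h / pi * (Gamma h * cheb_moment 0 0)).
  apply: (@has_int_tonelli R itvoy itvoy (weber_kernel 0 h) _
    (fun s => 4 `^ h / pi * (s `^ (- h - 1) * Psi 0 h s)) _ mi mi (measurable_kernel hk)).
  - move=> x s _ _; rewrite /weber_kernel /bprod [h - _]subr0 [h + 0%:R]addr0 -expr2.
    apply: mulr_ge0; apply: mulr_ge0; rewrite ?powR_ge0 ?expR_ge0 ?sqr_ge0//.
  - by move=> x /itvP x0; exact: (kernel_s (bprod 0 h x) h0 x0).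
  - by move=> s /itvP s0; exact: kernel_x.
  - exact: (has_intZ _ mi (has_int_Psi_power 0 h0)).
move=> /(has_intZ (Gamma (h + 1))^-1 mi).
rewrite [X in has_int _ _ X -> _](_ : _ = 4 `^ h / (2 * h)); last first.
  rewrite cheb_moment0 eqxx mul1r GammaS//.
  have p0 : pi != 0 :> R by rewrite gt_eqF// pi_gt0.
  have G1 : Gamma h != 0 by rewrite gt_eqF// Gamma_gt0.
  move: (pi : R) p0 => p p0; by field; rewrite p0 G1 gt_eqF.
move=> /eq_has_int; apply => // x _; rewrite mulrA mulVf// mul1r.
by rewrite /bprod subr0 addr0 expr2.
Qed.

(* [Gamma (h + 1) * x^(- 2 h - 2)] is written as the integral of [s^h * expR (- s x^2)] and
   the order of integration is exchanged.  For [k = 0] the integrand is nonnegative; by AM-GM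
   that case supplies the integrable bound for the others. *)
Lemma has_int_weber (k : nat) (h : R) : 0 < h - k%:R ->
  has_int `]0, +oo[%classic
    (fun x : R => x `^ (2 * h - 1) *
       (bessel (h + k%:R) (x ^+ 2 / 4) * bessel (h - k%:R) (x ^+ 2 / 4)))
    ((k == 0%N)%:R * (4 `^ h / (2 * h))).
Proof.
move=> hk; have k0 : 0 <= k%:R :> R by [].
have h0 : 0 < h by lra.
have ha0 : 0 < h + k%:R by lra.
have h10 : 0 < h + 1 by rewrite addr_gt0.
have G0 : Gamma (h + 1) != 0 by rewrite gt_eqF// Gamma_gt0.
pose w := \int[mu]_(x in itvoy) (x `^ (2 * h - 1) * `|bprod k h x|).
have Hw : has_int itvoy (fun x => x `^ (2 * h - 1) * `|bprod k h x|) w.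
  have H2 := has_intZ 2^-1 mi (has_intD mi (has_int_weber0 ha0) (has_int_weber0 hk)).
  apply: (dom_has_int mi _ H2) => [|x /itvP x0].
    apply: measurable_funTS; apply: measurable_funM => //.
    by apply: measurableT_comp => //; exact: measurable_bprod.
  rewrite ger0_norm; last by rewrite mulr_ge0 ?powR_ge0.
  rewrite /= /bprod normrM.
  move: (bessel _ _) (bessel _ _) => v u.
  have xE z : x `^ (2 * z - 1) = (x `^ (z - 2^-1)) ^+ 2.
    by rewrite -powR_mulrn ?powR_ge0// -powRrM; congr (_ `^ _); field.
  rewrite !xE.
  (* The weight is shared between the two Bessel factors with their own exponents h + k - 1/2 and h
     - k - 1/2, so that AM-GM produces exactly the two diagonal integrands. *)
  have -> : x `^ (h - 2^-1) ^+ 2 = x `^ (h + k%:R - 2^-1) * x `^ (h - k%:R - 2^-1).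
    rewrite -powRD ?(gt_eqF x0) ?implybT// -powR_mulrn ?powR_ge0// -powRrM.
    by congr (_ `^ _); field.
  rewrite -(real_normK (num_real u)) -(real_normK (num_real v)).
  move: (x `^ _) (x `^ _) `|u| `|v| => p q {}u {}v.
  have : 0 <= (q * u - p * v) ^+ 2 by exact: sqr_ge0.
  nra.
have : has_int itvoy (fun x => Gamma (h + 1) * (x `^ (2 * h - 1) * bprod k h x))
   (4 `^ h / pi * (Gamma h * cheb_moment k 0)).
  apply: (@has_int_fubini R itvoy itvoy (weber_kernel k h) _
    (fun s => 4 `^ h / pi * (s `^ (- h - 1) * Psi k h s))
    (fun x => Gamma (h + 1) * (x `^ (2 * h - 1) * `|bprod k h x|)) _
    (Gamma (h + 1) * w) mi mi (measurable_kernel hk)).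
  - move=> x /itvP x0; have := kernel_s `|bprod k h x| h0 x0.
    move=> /eq_has_int; apply => // s _.
    by rewrite /weber_kernel/= !normrM !(ger0_norm (powR_ge0 _ _)) (ger0_norm (expR_ge0 _)).
  - exact: has_intZ.
  - by move=> x /itvP x0; exact: (kernel_s (bprod k h x) h0 x0).
  - by move=> s /itvP s0; exact: kernel_x.
  - exact: (has_intZ _ mi (has_int_Psi_power k h0)).
move=> /(has_intZ (Gamma (h + 1))^-1 mi).
rewrite [X in has_int _ _ X -> _](_ : _ = (k == 0%N)%:R * (4 `^ h / (2 * h))); last first.
  rewrite cheb_moment0 GammaS//.
  have p0 : pi != 0 :> R by rewrite gt_eqF// pi_gt0.
  have G1 : Gamma h != 0 by rewrite gt_eqF// Gamma_gt0.
  move: (pi : R) p0 => p p0; by field; rewrite p0 G1 gt_eqF.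
by move=> /eq_has_int; apply => // x _; rewrite [RHS]mulrA mulVf// mul1r.
Qed.

End weber.

(** * Stiffness matrix *)

Section fourier_phi.
Context {R : realType}.
Notation mu := (@lebesgue_measure R).
Notation RM := (measurableTypeR R).
Let itv11 : set RM := `]-1, 1[%classic.
Let mi1 : measurable itv11. Proof. exact: measurable_itv. Qed.

(* Up to a unimodular factor, the Fourier transform of the weighted polynomial of degree [n]. *)
Definition spectrum n (a x : R) : R :=
  x ^+ n * (Num.sqrt pi * Gamma (n%:R + a + 1) * bessel (n%:R + a + 2^-1) (x ^+ 2 / 4)).

Let has_int_sin_weight (b xi : R) : 0 < b ->
  has_int itv11 (fun x => (1 - x ^+ 2) `^ b * sin (xi * x)) 0.
Proof.
move=> b0.
have cs : continuous (fun x : R => sin (xi * x)).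
  move=> x; apply: (continuous_comp (f := fun x : R => xi * x) (g := @sin R)); last exact: continuous_sin.
  exact: mulrl_continuous.
have H := has_int_weight b0 cs.
set v := (X in has_int _ _ X) in H.
have N1 : -1 != 0 :> R by rewrite oppr_eq0 oner_eq0.
have H2 := @has_int_affine R (-1) 0 _ _ _ N1 mi1 H.
rewrite normrN1 divr1 in H2.
rewrite (_ : [set x | _] = itv11) in H2; last first.
  apply/seteqP; split => x; rewrite /itv11/= !in_itv/= addr0 mulN1r => /andP[x1 x2]; apply/andP; split; lra.
have H3 := has_intZ (-1) mi1 H.
have E : v = -1 * v.
  apply: (has_int_unique H2); apply: eq_has_int H3 mi1 => x _ /=.
  by rewrite addr0 mulN1r sqrrN mulrN sinN; ring.
by have -> : 0 = v by lra.
Qed.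

(* Integrating by parts once advances the phase of the cosine by a quarter period. *)
Lemma has_int_gegen_cos n (a xi t : R) : 0 < a ->
  has_int `]-1, 1[%classic
    (fun x => (1 - x ^+ 2) `^ a * ((gegen n a).[x] * cos (xi * x + t)))
    ((-1) ^+ n * cos (t + n%:R * (pi / 2)) * spectrum n a xi).
Proof.
elim: n a t => [|n IH] a t a0.
  have H := has_intB mi1 (has_intZ (cos t) mi1 (has_int_cos_bessel xi a0))
                     (has_intZ (sin t) mi1 (has_int_sin_weight xi a0)).
  rewrite [X in has_int _ _ X](_ : _ = cos t * (Num.sqrt pi * Gamma (a + 1) * bessel (a + 2^-1) (xi ^+ 2 / 4)) - sin t * 0).
    apply: eq_has_int H mi1 => x _.
    by rewrite /= hornerC cosD; ring.
  by rewrite /spectrum mul0r addr0 add0r !expr0 mulr0 subr0 !mul1r.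
have a10 : 0 < a + 1 by rewrite addr_gt0.
have := IH (a + 1) (t + pi / 2) a10 => H1.
have dc (x : R) : is_derive x 1 (fun x => cos (xi * x + t)) (- (xi * sin (xi * x + t))).
  have dl : is_derive x 1 (fun x : R => xi * x + t) xi.
    by apply: is_derive_eq; rewrite /GRing.scale/=; ring.
  have := @is_derive1_comp R (@cos R) _ x _ _ (is_derive_cos _) dl.
  by rewrite mulNr [_ * xi]mulrC.
have dp (x : R) : is_derive x 1 (horner (gegen n (a + 1))) ((gegen n (a + 1))^`()).[x].
  exact: is_derive_poly.
have cc : continuous (fun x : R => cos (xi * x + t)).
  move=> x; apply: (continuous_comp (f := fun x : R => xi * x + t) (g := @cos R)); last exact: continuous_cos.
  by apply: cvgD; [exact: mulrl_continuous|exact: cvg_cst].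
have cs : continuous (fun x : R => sin (xi * x + t)).
  move=> x; apply: (continuous_comp (f := fun x : R => xi * x + t) (g := @sin R)); last exact: continuous_sin.
  by apply: cvgD; [exact: mulrl_continuous|exact: cvg_cst].
pose p := gegen n (a + 1).
pose f x := p.[x] * cos (xi * x + t).
pose g x := p^`().[x] * cos (xi * x + t) - xi * (p.[x] * sin (xi * x + t)).
have df (x : R) : is_derive x 1 f (g x).
  apply: is_derive_eq (is_deriveM (dp x) (dc x)) _.
  by rewrite /g /GRing.scale/= -/p; ring.
have cg : continuous g.
  move=> x; apply: cvgB; first by apply: cvgM; [exact: continuous_horner|exact: cc].
  apply: cvgM; first exact: cvg_cst.
  by apply: cvgM; [exact: continuous_horner|exact: cs].
have H2 := has_intB mi1 (has_int_weight_deriv a0 df cg) (has_intZ xi mi1 H1).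
rewrite [X in has_int _ _ X](_ : _ = 0 - xi * ((-1) ^+ n * cos (t + pi / 2 + n%:R * (pi / 2)) * spectrum n (a + 1) xi)).
  apply: eq_has_int H2 mi1 => x; rewrite inE /itv11/= in_itv/= => /andP[x1 x2].
  have w0 := one_sub_sqr_gt0 x1 x2.
  rewrite [xi * x + (t + _)]addrA cosDpihalf powRDr1//= -/p /f /g /omega.
  by rewrite !(hornerD, hornerN, hornerM, hornerX, hornerC, hornerXn); ring.
rewrite /spectrum.
have -> : n%:R + (a + 1) = n.+1%:R + a by rewrite -natr1; ring.
have -> : t + pi / 2 + n%:R * (pi / 2) = t + n.+1%:R * (pi / 2) by rewrite -natr1; ring.
by rewrite !exprS; ring.
Qed.

(** The real and imaginary parts are the same cosine integral at phases 0 and - pi / 2. *)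
Lemma fourier_phi n (a xi : R) : 0 < a ->
  fourier (zero_ext (phi a n)) xi =
    ((-1) ^+ n * phi_coef a n * spectrum n a xi)%:C *
    (cos (n%:R * (pi / 2)) -i* sin (n%:R * (pi / 2))).
Proof.
move=> a0; rewrite /fourier /cintegral.
have HC := has_intZ (phi_coef a n) mi1 (has_int_gegen_cos n xi 0 a0).
have HS := has_intZ (- phi_coef a n) mi1 (has_int_gegen_cos n xi (- (pi / 2)) a0).
have E x : zero_ext (phi a n) x * (cos (xi * x) -i* sin (xi * x)) =
   ((fun x => phi_coef a n * ((1 - x ^+ 2) `^ a * ((gegen n a).[x] * cos (xi * x + 0)))) \_ itv11) x
   +i* ((fun x => - phi_coef a n * ((1 - x ^+ 2) `^ a * ((gegen n a).[x] * cos (xi * x + - (pi / 2))))) \_ itv11) x.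
  rewrite /zero_ext /patch -/itv11; case: ifP => _; last by rewrite mul0r.
  rewrite phiE// cosBpihalf addr0; apply/eqP; rewrite eq_complex/= !mul0r.
  by apply/andP; split; apply/eqP; ring.
have e1 := has_intE ((has_int_mkcond _ _ mi1).1 HC).
have e2 := has_intE ((has_int_mkcond _ _ mi1).1 HS).
rewrite [X in X +i* _](_ : _ = phi_coef a n * ((-1) ^+ n * cos (0 + n%:R * (pi / 2)) * spectrum n a xi)); last first.
  by rewrite -e1; apply: eq_Rintegral => x _; rewrite E.
rewrite [X in _ +i* X](_ : _ = - phi_coef a n * ((-1) ^+ n * cos (- (pi / 2) + n%:R * (pi / 2)) * spectrum n a xi)); last first.
  by rewrite -e2; apply: eq_Rintegral => x _; rewrite E.
rewrite add0r [- (pi / 2) + _]addrC cosBpihalf.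
apply/eqP; rewrite eq_complex/= !mul0r; apply/andP; split; apply/eqP; ring.
Qed.

Let itvoy : set RM := `]0, +oo[%classic.
Let mi : measurable itvoy. Proof. exact: measurable_itv. Qed.
Let mT : measurable (setT : set RM). Proof. exact: measurableT. Qed.

Let has_int_opp (f : R -> R) v : has_int (setT : set RM) f v ->
  has_int (setT : set RM) (fun x => f (- x)) v.
Proof.
move=> H; have N1 : -1 != 0 :> R by rewrite oppr_eq0 oner_eq0.
have := @has_int_affine R (-1) 0 _ _ _ N1 mT H.
rewrite normrN1 divr1; rewrite (_ : [set x | _] = setT).
  by move=> /eq_has_int; apply => // x _; rewrite mulN1r addr0.
by apply/seteqP.
Qed.

(** The condition f 0 = 0 makes f the sum of its two open half-line restrictions at the origin as
    well. *)
Let has_int_even (f : R -> R) v : f 0 = 0 -> (forall x, f (- x) = f x) ->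
  has_int itvoy f v -> has_int (setT : set RM) f (2 * v).
Proof.
move=> f0 fE /(has_int_mkcond _ _ mi).1 H.
have := has_intD mT H (has_int_opp H).
rewrite -mulr2n mulr_natl; move=> /eq_has_int; apply => // x _.
rewrite !patchE /itvoy !mem_setE !in_itv/= !andbT oppr_gt0.
case: (ltgtP x 0) => [x0|x0|->]; rewrite ?addr0 ?add0r//.
Qed.

Let sprod a i j x := `|x| `^ (2 * a) * (spectrum i a x * spectrum j a x).

Let spectrumN n a x : spectrum n a (- x) = (-1) ^+ n * spectrum n a x.
Proof. by rewrite /spectrum sqrrN [(- x) ^+ n]exprNn -[LHS]mulrA. Qed.

(** Twice the Weber value 4^h / (2 h) at h = n + a + 1/2, times the constant pi * Gamma (n + a +
    1)^2 of the two spectra. *)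
Definition spectral_mass n a : R :=
  2 * pi * Gamma (n%:R + a + 1) ^+ 2 * (4 `^ (n%:R + a + 2^-1) / (2 * n%:R + 2 * a + 1)).

(** The Bessel orders i + a + 1/2 and j + a + 1/2 are h - k and h + k for the midpoint h and k = (j
    - i) / 2, and the total power of x is 2 a + i + j = 2 h - 1. *)
Let sprod_even a i j : 0 < a -> (i <= j)%N -> ~~ odd (i + j) ->
  has_int (setT : set RM) (sprod a i j) ((i == j)%:R * spectral_mass i a).
Proof.
move=> a0 ij oij.
pose k := (j - i)./2.
have jE : j = (i + k.*2)%N.
  have := odd_double_half (j - i); rewrite oddB// addbC -oddD (negbTE oij) add0n => kE.
  by rewrite /k kE subnKC.
have i0 : 0 <= i%:R :> R by [].
have k0 : 0 <= k%:R :> R by [].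
pose h := i%:R + k%:R + a + 2^-1.
have hk : 0 < h - k%:R by rewrite /h; lra.
have H := has_intZ (pi * Gamma (i%:R + a + 1) * Gamma (j%:R + a + 1)) mi (has_int_weber hk).
have jR : j%:R = i%:R + 2 * k%:R :> R by rewrite jE natrD -mul2n natrM.
have hp : h + k%:R = j%:R + a + 2^-1 by rewrite jR /h; ring.
have hm : h - k%:R = i%:R + a + 2^-1 by rewrite /h; ring.
have h2 : 2 * h - 1 = 2 * a + (i%:R + j%:R) by rewrite jR /h; field.
rewrite hp hm h2 in H.
have H2 : has_int itvoy (sprod a i j) (pi * Gamma (i%:R + a + 1) * Gamma (j%:R + a + 1) *
    ((k == 0%N)%:R * (4 `^ h / (2 * h)))).
  apply: eq_has_int H mi => x; rewrite inE /itvoy/= in_itv/= andbT => x0.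
  rewrite /sprod gtr0_norm// (@powRD _ x (2 * a)) ?(gt_eqF x0) ?implybT//.
  rewrite (@powRD _ x i%:R) ?(gt_eqF x0) ?implybT// !powR_mulrn ?ltW//.
  rewrite /spectrum -[X in X * Gamma (i%:R + a + 1) * _ * _](sqr_sqrtr (@pi_ge0 R)); ring.
rewrite (_ : _ * spectral_mass i a = 2 * (pi * Gamma (i%:R + a + 1) * Gamma (j%:R + a + 1) *
    ((k == 0%N)%:R * (4 `^ h / (2 * h))))).
  apply: has_int_even => // [|x].
    by rewrite /sprod normr0 powR0 ?mul0r// mulf_neq0 ?gt_eqF.
  by rewrite /sprod normrN !spectrumN mulrACA -exprD -signr_odd (negbTE oij) expr0 mul1r.
have kE : (i == j) = (k == 0%N) by clear -jE; lia.
rewrite kE /spectral_mass; case: eqP => [kz|_]; last by rewrite !mul0r !mulr0.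
have -> : j = i by rewrite jE kz addn0.
have -> : h = i%:R + a + 2^-1 by rewrite /h kz addr0.
rewrite !mul1r; have -> : 2 * (i%:R + a + 2^-1) = 2 * i%:R + 2 * a + 1 by field.
by rewrite expr2; ring.
Qed.

Let measurable_spectrum n a : 0 < a -> measurable_fun (setT : set RM) (spectrum n a).
Proof.
move=> a0; have n0 : 0 <= n%:R :> R by [].
apply: measurable_funM; first exact: (measurableT_comp (f := fun x : R => x ^+ n)).
apply: measurable_funM => //.
have msq : measurable_fun (setT : set RM) (fun x : R => x ^+ 2 / 4).
  by apply: measurable_funM => //; exact: (measurableT_comp (f := fun x : R => x ^+ 2)).
by apply: (measurableT_comp _ msq); apply: measurable_bessel; lra.
Qed.

Let sprodC a i j : sprod a i j = sprod a j i.
Proof. by apply/funext => x; rewrite /sprod [_ * spectrum j a x]mulrC. Qed.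

(** The integrand is odd, so its integral equals its own negative; integrability comes from AM-GM
    and the diagonal cases, which are even. *)
Let sprod_odd a i j : 0 < a -> odd (i + j) -> has_int (setT : set RM) (sprod a i j) 0.
Proof.
move=> a0 oij.
have e k : ~~ odd (k + k) by rewrite addnn odd_double.
have H2 := has_intZ 2^-1 mT (has_intD mT (sprod_even a0 (leqnn i) (e i)) (sprod_even a0 (leqnn j) (e j))).
have H : has_int (setT : set RM) (sprod a i j) (\int[mu]_(x in (setT : set RM)) sprod a i j x).
  apply: (dom_has_int mT _ H2) => [|x _].
    apply: measurable_funM.
      apply: (measurableT_comp (measurable_powR _)); exact: (measurableT_comp (@normr_measurable R setT)).
    by apply: measurable_funM; exact: measurable_spectrum.
  rewrite /sprod normrM ger0_norm ?powR_ge0// -mulrDr [leRHS]mulrCA.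
  apply: ler_wpM2l; first exact: powR_ge0.
  rewrite normrM -[spectrum i a x * _]expr2 -[spectrum j a x * spectrum j a x]expr2.
  rewrite -(real_normK (num_real (spectrum i a x))) -(real_normK (num_real (spectrum j a x))).
  move: `|_| `|_| => u v.
  have : 0 <= (u - v) ^+ 2 by exact: sqr_ge0.
  nra.
set v := (X in has_int _ _ X) in H.
suff <- : v = 0 by [].
have E : v = -1 * v.
  apply: (has_int_unique (has_int_opp H)).
  apply: eq_has_int (has_intZ (-1) mT H) mT => x _.
  rewrite /sprod normrN !spectrumN mulrACA -exprD -signr_odd oij expr1; ring.
lra.
Qed.

Lemma has_int_spectrum a i j : 0 < a ->
  has_int (setT : set RM) (fun x => `|x| `^ (2 * a) * (spectrum i a x * spectrum j a x))
    ((i == j)%:R * spectral_mass i a).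
Proof.
move=> a0; rewrite -/(sprod a i j); have [oij|oij] := boolP (odd (i + j)).
  have /negPf -> : i != j by apply: contraTneq oij => ->; rewrite addnn odd_double.
  by rewrite mul0r; exact: sprod_odd.
have [ij|/ltnW ij] := leqP i j; first exact: sprod_even.
have := sprod_even a0 ij; rewrite addnC sprodC eq_sym => /(_ oij).
by case: eqP => [->//|_]; rewrite !mul0r.
Qed.

Lemma stiffnessE (a : R) i j : 0 < a -> stiffness a i j = (i == j)%:R.
Proof.
move=> a0; rewrite /stiffness /energy /cintegral.
set c := fun n : nat => (-1) ^+ n * phi_coef a n : R.
pose t (n : nat) : R := n%:R * (pi / 2).
(* The quarter-turn phases of the two transforms combine into one constant of angle t j - t i, which
   leaves a single real integral; on the diagonal this phase is 1. *)
have E x : (`|x| `^ (2 * a))%:C * fourier (zero_ext (phi a j)) x * (fourier (zero_ext (phi a i)) x)^* =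
   (c i * c j * cos (t j - t i) * (`|x| `^ (2 * a) * (spectrum i a x * spectrum j a x)))
   +i* (c i * c j * - sin (t j - t i) * (`|x| `^ (2 * a) * (spectrum i a x * spectrum j a x))).
  rewrite !fourier_phi// -/(c i) -/(c j) -/(t i) -/(t j) cosB sinB.
  apply/eqP; rewrite eq_complex/= !mul0r; apply/andP; split; apply/eqP; ring.
have H := has_int_spectrum i j a0.
have HC := has_intE (has_intZ (c i * c j * cos (t j - t i)) mT H).
have HS := has_intE (has_intZ (c i * c j * - sin (t j - t i)) mT H).
rewrite [X in _ * (X +i* _)](_ : _ = c i * c j * cos (t j - t i) * ((i == j)%:R * spectral_mass i a)); last first.
  by rewrite -HC; apply: eq_Rintegral => x _; rewrite E.
rewrite [X in _ * (_ +i* X)](_ : _ = c i * c j * - sin (t j - t i) * ((i == j)%:R * spectral_mass i a)); last first.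
  by rewrite -HS; apply: eq_Rintegral => x _; rewrite E.
case: eqP => [<-|_]; last by rewrite /= !mulr0n !mul0r !mulr0.
rewrite subrr cos0 sin0 oppr0 !mulr0 !mul0r mulr1 mul1r.
apply/eqP; rewrite eq_complex/= !mulr0 !mul0r subr0 addr0 eqxx andbT; apply/eqP.
have i0 : 0 <= i%:R :> R by [].
have m0 : 0 < 2 * i%:R + 2 * a + 1 by lra.
have G0 : Gamma (i%:R + a + 1) != 0 by rewrite gt_eqF// Gamma_gt0//; lra.
have I2 : 2 ^+ i != 0 :> R by rewrite expf_neq0.
have Q0 : 2 `^ (a + 2^-1) != 0 :> R by rewrite gt_eqF// powR_gt0.
have p0 : pi != 0 :> R by rewrite gt_eqF// pi_gt0.
have s0 : Num.sqrt (2 * i%:R + 2 * a + 1) != 0 by rewrite gt_eqF// sqrtr_gt0.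
have cE : c i = Num.sqrt (2 * i%:R + 2 * a + 1) / (2 ^+ i * 2 `^ (a + 2^-1) * Gamma (i%:R + a + 1)).
  by rewrite /c /phi_coef mulrA mulrA -expr2 sqrr_sign mul1r.
(* In this form the mass is visibly 2 pi / (c i)^2, so the prefactor 1 / (2 pi) of the energy gives
   1. *)
have -> : spectral_mass i a = 2 * pi * Gamma (i%:R + a + 1) ^+ 2 *
    ((2 ^+ i * 2 `^ (a + 2^-1)) ^+ 2 / Num.sqrt (2 * i%:R + 2 * a + 1) ^+ 2).
  rewrite /spectral_mass sqr_sqrtr ?ltW//; congr (_ * (_ / _)).
  rewrite -[2 ^+ i]powR_mulrn// -powRD ?pnatr_eq0 ?implybT// -[RHS]powR_mulrn ?powR_ge0// -powRrM.
  have -> : (i%:R + (a + 2^-1)) * 2 = 2 * (i%:R + a + 2^-1) by ring.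
  by rewrite powRrM powR_mulrn// -natrX.
rewrite cE; move: (pi : R) p0 => p p0.
by field; rewrite G0 I2 Q0 p0 s0.
Qed.

End fourier_phi.

Theorem lemma2 (R : realType) (alpha : R) (halpha : 0 < alpha) (i j : nat) :
  stiffness alpha i j = (i == j)%:R /\
  mass alpha i j =
    (if ~~ odd (i + j) then
       (-1) ^ ((j%:Z - i%:Z) %/ 2)%Z
       * Num.sqrt (pi * (2 * i%:R + 2 * alpha + 1) * (2 * j%:R + 2 * alpha + 1))
       * Gamma (2 * alpha + 1) * (i + j)`!%:R
       / (2 `^ (2 * alpha + i%:R + j%:R + 1)
          * Gamma (2 * alpha + (i%:R + j%:R) / 2 + 3 / 2)
          * Gamma (alpha + (i%:R - j%:R) / 2 + 1)
          * Gamma (alpha + (j%:R - i%:R) / 2 + 1)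
          * ((i + j)./2)`!%:R)
     else 0)%:C.
Proof. by split; [exact: stiffnessE|exact: massE]. Qed.
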